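(* Let $N\ge 3$, $\Omega=\{x\in\mathbb{R}^N : 1<|x|<3\}$, $\Psi_\alpha(x)=\big||x|-2\big|^\alpha$, and for $p>2$, $u\in H^1_0(\Omega)\setminus\{0\}$, $$R_{\alpha,p}(u)=\frac{\int_\Omega|\nabla u|^2\,dx}{\left(\int_\Omega \Psi_\alpha |u|^p\,dx\right)^{2/p}}.$$ Let $\alpha>0$. Then for all $p<2^*=2N/(N-2)$ sufficiently close to $2^*$, the functional $R_{\alpha,p}$ has at least two non-radial local minima in $H^1_0(\Omega)\setminus\{0\}$. *)

(* Defs.v *)
From HB Require Import structures.
From mathcomp Require Import all_boot all_order all_algebra.
From mathcomp Require Import all_classical all_reals all_analysis.
Set Implicit Arguments. Unset Strict Implicit. Unset Printing Implicit Defensive.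
Import Order.TTheory GRing.Theory Num.Theory.
Import numFieldNormedType.Exports.
Local Open Scope classical_set_scope.
Local Open Scope ring_scope.

Section Defs.
Variables (R : realType) (N : nat).

Definition eucl (x : 'rV[R]_N) : R := Num.sqrt (\sum_(i < N) x ord0 i ^+ 2).

Definition ebasis (i : 'I_N) : 'rV[R]_N := delta_mx ord0 i.

Definition pderiv (f : 'rV[R]_N -> R) (i : 'I_N) (x : 'rV[R]_N) : R :=
  'D_(ebasis i) f x.

Definition grad_sq (f : 'rV[R]_N -> R) (x : 'rV[R]_N) : R :=
  \sum_(i < N) pderiv f i x ^+ 2.

Definition C1c_annulus (f : 'rV[R]_N -> R) : Prop :=
  (forall i x, derivable f x (ebasis i)) /\
  (forall i, continuous (pderiv f i)) /\
  exists r1 r2 : R, [/\ 1 < r1, r1 < r2, r2 < 3 &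
    forall x, (eucl x <= r1 \/ r2 <= eucl x) -> f x = 0].

(* Lebesgue integral over R^N, computed as an iterated one-dimensional Lebesgue
   integral (Fubini); only applied to continuous compactly supported functions *)
Definition upd (g : nat -> R) (k : nat) (t : R) : nat -> R :=
  fun j => if j == k then t else g j.

Fixpoint iint (n : nat) (F : (nat -> R) -> R) : R :=
  match n with
  | 0 => F (fun _ => 0)
  | n'.+1 => Rintegral (@lebesgue_measure R) setT
               (fun t => iint n' (fun g => F (upd g n' t)))
  end.

Definition integral_RN (f : 'rV[R]_N -> R) : R :=
  iint N (fun g => f (\row_(i < N) g (nat_of_ord i))).

Definition h1sq (f : 'rV[R]_N -> R) : R :=
  integral_RN (fun x => f x ^+ 2 + grad_sq f x).

Definition Psi (alpha : R) (x : 'rV[R]_N) : R := powR `|eucl x - 2| alpha.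

Definition Rquot (alpha p : R) (f : 'rV[R]_N -> R) : R :=
  integral_RN (grad_sq f) /
  powR (integral_RN (fun x => Psi alpha x * powR `|f x| p)) (2 / p).

(* H^1_0(Omega) realised as the completion of C^1_c(Omega) in the H^1 norm:
   an element is an H^1-Cauchy sequence of C^1_c(Omega) functions *)
Definition H10 (u : nat -> 'rV[R]_N -> R) : Prop :=
  (forall n, C1c_annulus (u n)) /\
  forall eps : R, 0 < eps -> exists M, forall m n, (M <= m)%N -> (M <= n)%N ->
    h1sq (u m \- u n) < eps.

Definition h1dist (u v : nat -> 'rV[R]_N -> R) : R :=
  limn (fun n => Num.sqrt (h1sq (u n \- v n))).

Definition nonzero (u : nat -> 'rV[R]_N -> R) : Prop :=
  0 < h1dist u (fun _ _ => 0).

Definition Rlim (alpha p : R) (u : nat -> 'rV[R]_N -> R) : R :=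
  limn (fun n => Rquot alpha p (u n)).

Definition local_min (alpha p : R) (u : nat -> 'rV[R]_N -> R) : Prop :=
  H10 u /\ nonzero u /\
  exists2 delta : R, 0 < delta &
    forall v, H10 v -> nonzero v -> h1dist u v < delta ->
      Rlim alpha p u <= Rlim alpha p v.

Definition orthogonal_mx (A : 'M[R]_N) : Prop := A *m A^T = 1%:M.

Definition rotate (A : 'M[R]_N) (u : nat -> 'rV[R]_N -> R) :=
  fun n (x : 'rV[R]_N) => u n (x *m A).

Definition nonradial (u : nat -> 'rV[R]_N -> R) : Prop :=
  exists A, orthogonal_mx A /\ 0 < h1dist (rotate A u) u.

(* u and v are genuinely different critical points: v is not a multiple of a
   rotation of u (R_{alpha,p} is invariant under scaling and rotations) *)
Definition essentially_distinct (u v : nat -> 'rV[R]_N -> R) : Prop :=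
  forall (c : R) (A : 'M[R]_N), orthogonal_mx A ->
    0 < h1dist v (fun n x => c * rotate A u n x).

End Defs.

Definition crit_exp {R : realType} (N : nat) : R := (2 * N%:R) / (N%:R - 2).

(* Main.v *)
Require Import Defs.
From HB Require Import structures.
From mathcomp Require Import all_boot all_order all_algebra.
From mathcomp Require Import perm.
From mathcomp Require Import all_classical all_reals all_analysis.
From mathcomp Require Import ring lra.
Set Implicit Arguments.
Unset Strict Implicit.
Unset Printing Implicit Defensive.
Import Order.TTheory GRing.Theory Num.Theory.
Import numFieldNormedType.Exports.
Local Open Scope classical_set_scope.
Local Open Scope ring_scope.

(** Let [S] be the best constant of the Sobolev inequality in the energy norm and
    normalise [f] by [int Psi |f|^p = 1]. As [p] tends to the critical exponent, the
    infimum of the energy over such [f] living near either boundary sphere tends to [S]: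
    a concentrated near-optimiser placed where [Psi] is close to [1] almost attains it.
    By the strict concavity of [t |-> t^(2/p)] and the IMS localization formula, an [f]
    whose mass splits into two parts of definite size has energy at least [S + d]: the
    localization error is controlled by [int f^2], and if that does not tend to zero then
    a definite part of the [L^p] mass is lost to the region where [Psi < 1].
    Hence both the functions with mass [1/4] to [3/4] outside the sphere [|x| = 2] and the
    functions whose mass is symmetric under the coordinate permutations and reflections
    have energy at least [S + d]. Minimising over the functions with at least half of
    their mass inside, resp. outside, that sphere therefore yields, by Rellich compactness
    and the parallelogram identity, two interior minimisers, neither of which is radial,
    and comparing their masses on the two sides shows that they are distinct. *)

(** * Positive functionals on compactly supported functions *)

(** The integral is an iterated one-dimensional one and the elements of H^1_0 are Cauchy sequences.
    Hence Fubini, Hoelder and rotation invariance are derived for positive functionals on compactly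
    supported continuous functions, and every estimate is an inequality for C^1_c functions with
    uniform constants, which then passes along the sequences. Compactness fails at the critical
    exponent s, so no limit in p is taken: each gap d is found uniformly for p in a left
    neighbourhood of s, before the test functions of energy below S + d are chosen. Compactness is
    used only at a fixed p < s. The constraint that the mass be at most 1/2 is never active: 1/2
    lies inside the window from 1/4 to 3/4, which costs at least S + d, so a function of smaller
    energy has mass at most 1/4 and its neighbours still satisfy the constraint. Finitely many
    symmetries suffice against radial functions. Under them the 2N pieces obtained by cutting along
    the coordinates have equal mass, more than 2^(-s/2), the mass at which two equal pieces would
    reach energy exactly S. *)

Section Continuity.
Context {R : realType} {T : topologicalType}.
Implicit Types f g : T -> R.

Lemma cont_cst (c : R) : continuous (fun _ : T => c).
Proof. by move=> x; exact: cvg_cst. Qed.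

Lemma cont_add f g : continuous f -> continuous g -> continuous (fun x => f x + g x).
Proof. by move=> cf cg x; apply: cvgD; [exact: cf|exact: cg]. Qed.

Lemma cont_opp f : continuous f -> continuous (fun x => - f x).
Proof. by move=> cf x; apply: cvgN; exact: cf. Qed.

Lemma cont_sub f g : continuous f -> continuous g -> continuous (fun x => f x - g x).
Proof. by move=> cf cg x; apply: cvgB; [exact: cf|exact: cg]. Qed.

Lemma cont_mul f g : continuous f -> continuous g -> continuous (fun x => f x * g x).
Proof. by move=> cf cg x; apply: cvgM; [exact: cf|exact: cg]. Qed.

Lemma cont_exp f n : continuous f -> continuous (fun x => f x ^+ n).
Proof.
move=> cf; elim: n => [|n ih]; first exact: cont_cst.
by under [X in continuous X]eq_fun do rewrite exprS; apply: cont_mul.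
Qed.

Lemma cont_comp (U V : topologicalType) (h : U -> V) (k : T -> U) :
  continuous h -> continuous k -> continuous (fun x => h (k x)).
Proof. by move=> ch ck x; apply: continuous_comp; [exact: ck|exact: ch]. Qed.

Lemma cont_norm f : continuous f -> continuous (fun x => `|f x|).
Proof. by move=> cf x; apply: cvg_norm; exact: cf. Qed.

Lemma cont_max f g : continuous f -> continuous g ->
  continuous (fun x => Num.max (f x) (g x)).
Proof. by move=> cf cg x; apply: continuous_max; [exact: cf|exact: cg]. Qed.

Lemma cont_min f g : continuous f -> continuous g ->
  continuous (fun x => Num.min (f x) (g x)).
Proof. by move=> cf cg x; apply: continuous_min; [exact: cf|exact: cg]. Qed.

Lemma cont_sum (I : Type) (r : seq I) (P : pred I) (F : I -> T -> R) :
  (forall i, continuous (F i)) -> continuous (fun x => \sum_(i <- r | P i) F i x).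
Proof.
move=> cF; elim: r => [|i r ih].
  by under [X in continuous X]eq_fun do rewrite big_nil; exact: cont_cst.
under [X in continuous X]eq_fun do rewrite big_cons.
by case: (P i) => //; apply: cont_add.
Qed.

Lemma cont_sqrt f : continuous f -> continuous (fun x => Num.sqrt (f x)).
Proof. by move=> cf; apply: cont_comp cf; exact: sqrt_continuous. Qed.

End Continuity.

Lemma continuous_powR_norm {R : realType} (p : R) : 0 < p ->
  continuous (fun x : R => powR `|x| p).
Proof.
move=> p0 x; have [->|x0] := eqVneq x 0.
  rewrite /continuous_at normr0 powR0 ?gt_eqF//.
  apply/cvgrPdist_lt => e e0.
  exists (powR e p^-1); first by rewrite /= powR_gt0.
  move=> y /=; rewrite sub0r normrN => ye.
  rewrite sub0r normrN ger0_norm ?powR_ge0//.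
  have -> : e = powR (powR e p^-1) p.
    by rewrite -powRrM mulVf ?gt_eqF// powRr1 ?ltW.
  by apply: gt0_ltr_powR; rewrite ?nnegrE ?powR_ge0.
rewrite /=; apply: (@cvg_trans _ (expR (p * ln `|y|) @[y --> x])).
  apply: near_eq_cvg; near=> y; rewrite /powR normr_eq0 ifF//.
  by apply/negbTE; near: y; apply: open_neq.
have -> : powR `|x| p = expR (p * ln `|x|) by rewrite /powR normr_eq0 (negbTE x0).
apply: (@continuous_comp _ _ _ (fun y => p * ln `|y|) expR); last exact: continuous_expR.
apply: cvgM; first exact: cvg_cst.
apply: (@cvg_comp _ _ _ (fun y : R => `|y|) (@ln R) _ (nbhs `|x|)).
  exact: norm_continuous.
by apply: continuous_ln; rewrite normr_gt0.
Unshelve. all: by end_near. Qed.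

Lemma cont_powR {R : realType} {T : topologicalType} (p : R) (f : T -> R) :
  0 < p -> continuous f -> continuous (fun x => powR `|f x| p).
Proof. by move=> p0 cf; apply: (cont_comp (continuous_powR_norm p0) cf). Qed.

(** * Compactly supported functions and positive functionals on them *)

Section CompactSupport.
Context {R : realType}.
Implicit Types T U : normedModType R.

(** Only boundedness of the support is recorded; on a [proper_space] this makes it compact. *)
Definition Cc T (f : T -> R) :=
  continuous f /\ exists K : R, forall x, K < `|x| -> f x = 0.

Definition proper_space T := forall K : R, compact [set x : T | `|x| <= K].

Lemma Cc_cont T (f : T -> R) : Cc f -> continuous f.
Proof. by case. Qed.

Lemma Cc_supp T (f : T -> R) : Cc f ->
  exists2 K : R, 0 < K & forall x, K < `|x| -> f x = 0.
Proof.
case=> _ [K fK]; exists (Num.max K 1); first by rewrite lt_max ltr01 orbT.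
by move=> x; rewrite gt_max => /andP[/fK].
Qed.

Lemma Cc0 T : Cc (fun _ : T => 0 : R).
Proof. by split; [exact: cont_cst|exists 0]. Qed.

Lemma CcD T (f g : T -> R) : Cc f -> Cc g -> Cc (fun x => f x + g x).
Proof.
move=> fc gc; have [K _ fK] := Cc_supp fc; have [L _ gL] := Cc_supp gc.
case: fc gc => cf _ [cg _]; split; first exact: cont_add.
by exists (Num.max K L) => x; rewrite gt_max => /andP[/fK-> /gL->]; rewrite addr0.
Qed.

Lemma CcMl T (f g : T -> R) : continuous f -> Cc g -> Cc (fun x => f x * g x).
Proof.
move=> cf [cg [L gL]]; split; first exact: cont_mul.
by exists L => x /gL->; rewrite mulr0.
Qed.

Lemma CcMr T (f g : T -> R) : Cc f -> continuous g -> Cc (fun x => f x * g x).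
Proof.
move=> [cf [L fL]] cg; split; first exact: cont_mul.
by exists L => x /fL->; rewrite mul0r.
Qed.

Lemma CcZ T (c : R) (f : T -> R) : Cc f -> Cc (fun x => c * f x).
Proof. by apply: CcMl; exact: cont_cst. Qed.

Lemma Cc_comp T (h : R -> R) (f : T -> R) : continuous h -> h 0 = 0 -> Cc f ->
  Cc (fun x => h (f x)).
Proof.
move=> ch h0 [cf [K fK]]; split; first exact: cont_comp.
by exists K => x /fK->.
Qed.

Lemma CcN T (f : T -> R) : Cc f -> Cc (fun x => - f x).
Proof. by apply: (@Cc_comp T -%R); [exact: opp_continuous|rewrite oppr0]. Qed.

Lemma CcB T (f g : T -> R) : Cc f -> Cc g -> Cc (fun x => f x - g x).
Proof. by move=> fc gc; apply: CcD => //; exact: CcN. Qed.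

Lemma Cc_norm T (f : T -> R) : Cc f -> Cc (fun x => `|f x|).
Proof. by apply: (@Cc_comp T Num.norm); [exact: norm_continuous|rewrite normr0]. Qed.

Lemma Cc_powR T (f : T -> R) p : 0 < p -> Cc f -> Cc (fun x => powR `|f x| p).
Proof.
move=> p0; apply: (@Cc_comp T (fun y => powR `|y| p)).
  exact: continuous_powR_norm.
by rewrite normr0 powR0 ?gt_eqF.
Qed.

Lemma Cc_exp T (f : T -> R) n : (0 < n)%N -> Cc f -> Cc (fun x => f x ^+ n).
Proof.
move=> n0; apply: (@Cc_comp T (fun y => y ^+ n)); last by rewrite expr0n; case: n n0.
by move=> y; exact: exprn_continuous.
Qed.

Lemma Cc_sum T (I : Type) (r : seq I) (P : pred I) (F : I -> T -> R) :
  (forall i, Cc (F i)) -> Cc (fun x => \sum_(i <- r | P i) F i x).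
Proof.
move=> cF; elim: r => [|i r ih].
  by under eq_fun do rewrite big_nil; exact: Cc0.
under eq_fun do rewrite big_cons.
by case: (P i) => //; apply: CcD.
Qed.

(** Constants need not lie in [Cc]. This cutoff, 1 on the ball of radius K and 0 beyond radius K +
    1, replaces them: a uniform bound e for functions supported in that ball becomes e times the
    functional at the plateau. *)
Definition plateau T (K : R) (x : T) : R := Num.max 0 (Num.min 1 (K + 1 - `|x|)).

Lemma plateau_ge0 T K (x : T) : 0 <= plateau K x.
Proof. by rewrite le_max lexx. Qed.

Lemma plateau1 T K (x : T) : `|x| <= K -> plateau K x = 1.
Proof.
move=> xK; rewrite /plateau min_l; last by rewrite lerBrDr addrC lerD2r.
by rewrite max_r.
Qed.

Lemma Cc_plateau T K : Cc (@plateau T K).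
Proof.
split.
  apply: cont_max; first exact: cont_cst.
  apply: cont_min; first exact: cont_cst.
  apply: cont_sub; first exact: cont_cst.
  exact: norm_continuous.
exists (K + 1) => x Kx; rewrite /plateau max_l// ge_min; apply/orP; right.
by rewrite subr_le0 ltW.
Qed.

Lemma continuousP_norm T (f : T -> R) : continuous f <-> forall x (e : R), 0 < e ->
  exists2 d : R, 0 < d & forall y, `|x - y| < d -> `|f x - f y| < e.
Proof.
split=> [cf x e e0|H x].
  have /cvgrPdist_lt/(_ e e0)/nbhs_ballP[d d0 dP] := cf x.
  by exists d => // y xy; apply: dP; rewrite -ball_normE.
apply/cvgrPdist_lt => e e0; have [d d0 dP] := H x e e0.
apply/nbhs_ballP; exists d => // y; rewrite -ball_normE /=; exact: dP.
Qed.

Lemma Cc_unif T (f : T -> R) : proper_space T -> Cc f -> forall e : R, 0 < e ->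
  exists2 d : R, 0 < d & forall x y, `|x - y| < d -> `|f x - f y| < e.
Proof.
move=> pT fc e e0; have [K K0 fK] := Cc_supp fc; case: fc => cf _.
have /compact_near_coveringP cov := pT (K + 1).
have := cov _ (0^'+ : set_system R)
  (fun d x => forall y, `|x - y| < d -> `|f x - f y| < e) _.
case=> [x _|].
  have [||r r0 fr] := (continuousP_norm f).1 _ x (e / 2); [exact: cf|by rewrite divr_gt0|].
  exists (ball x (r / 2), [set d | d < r / 2]).
    split; first by apply: nbhsx_ballx; rewrite divr_gt0.
    by apply: nbhs_right_lt; rewrite divr_gt0.
  move=> [x' d]/= [xx' dr] y yd.
  have h1 : `|f x - f x'| < e / 2.
    apply: fr; rewrite -ball_normE /= in xx'; apply: (lt_le_trans xx').
    by rewrite ler_pdivrMr// ler_peMr ?ler1n ?ltW.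
  have h2 : `|f x - f y| < e / 2.
    apply: fr; rewrite -ball_normE /= in xx'.
    rewrite (splitr r); apply: le_lt_trans (ler_distD x' _ _) _.
    by rewrite ltrD// (lt_trans yd).
  rewrite (splitr e); apply: le_lt_trans (ler_distD (f x) _ _) _.
  by rewrite ltrD// distrC.
move=> d0 /= d0p H.
(* Since d <= 1, all points within d of a point beyond radius K + 1 lie beyond radius K, where f
   vanishes; the covering argument is needed only inside. *)
pose d := Num.min (d0 / 2) 1.
have dp : 0 < d by rewrite lt_min ltr01 divr_gt0.
exists d => // x y xyd.
have [xK|Kx] := leP `|x| (K + 1).
  apply: (H (d0 / 2)) => //=.
  - by rewrite sub0r normrN gtr0_norm ?divr_gt0// ltr_pdivrMr// ltr_pMr ?ltr1n.
  - by rewrite divr_gt0.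
  - by move: xyd; rewrite lt_min => /andP[].
rewrite !fK ?subrr ?normr0//; last by rewrite (lt_trans _ Kx)// ltrDl.
have : `|x| < `|y| + 1.
  rewrite -{1}(subrK y x) (le_lt_trans (ler_normD _ _))// addrC ltrD2l.
  by move: xyd; rewrite lt_min => /andP[].
by move=> h; have := lt_trans Kx h; rewrite ltrD2r.
Qed.

Lemma Cc_bounded T (f : T -> R) : proper_space T -> Cc f ->
  exists2 M : R, 0 < M & forall x, `|f x| <= M.
Proof.
move=> pT fc; have [K K0 fK] := Cc_supp fc; have cf := Cc_cont fc.
have [||/= c _ cP] := @compact_EVT_max T R (fun x => `|f x|) [set x | `|x| <= K] _ (pT K).
- by exists 0; rewrite /= normr0 ltW.
- by apply: continuous_subspaceT; exact: cont_norm.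
exists (`|f c| + 1); first by rewrite ltr_pwDr.
move=> x; have [xK|/fK->] := leP `|x| K; last by rewrite normr0 addr_ge0.
by rewrite (le_trans (cP x _)) ?inE//= lerDl.
Qed.

Lemma proper_R : proper_space (R : normedModType R).
Proof.
move=> K; apply: (subclosed_compact _ (@segment_compact R (- K) K)).
  by apply: closed_comp (@closed_le R K); move=> x _; exact: norm_continuous.
by move=> x /=; rewrite in_itv/= ler_norml.
Qed.

Lemma proper_rV n : proper_space ('rV[R]_n : normedModType R).
Proof.
move=> K; apply: bounded_closed_compact.
  exists K; split; first exact: num_real.
  by move=> M KM x /= xK; rewrite (le_trans xK)// ltW.
by apply: closed_comp (@closed_le R K); move=> x _; exact: norm_continuous.
Qed.

Lemma proper_prod T U : proper_space T -> proper_space U -> proper_space (T * U)%type.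
Proof.
move=> pT pU K.
have -> : [set x : T * U | `|x| <= K] = [set x : T | `|x| <= K] `*` [set x : U | `|x| <= K].
  by apply/seteqP; split => -[x y]/=; rewrite prod_normE ge_max => /andP.
exact: compact_setX.
Qed.

(** Radon measures seen as functionals. Nothing is required outside [Cc], so measurability is
    settled once on the line, and the structure survives iteration of integrals. *)
Record posfun T (I : (T -> R) -> R) : Prop := Posfun {
  posfunD : forall f g, Cc f -> Cc g -> I (fun x => f x + g x) = I f + I g;
  posfunZ : forall c f, Cc f -> I (fun x => c * f x) = c * I f;
  posfun_ge0 : forall f, Cc f -> (forall x, 0 <= f x) -> 0 <= I f }.

Section PosfunTheory.
Context {T : normedModType R} {I : (T -> R) -> R}.
Hypothesis HI : posfun I.
Implicit Types f g : T -> R.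

Lemma posfunN f : Cc f -> I (fun x => - f x) = - I f.
Proof.
move=> fc; rewrite -mulN1r -(posfunZ HI)//; congr I.
by apply/funext => x; rewrite mulN1r.
Qed.

Lemma posfunB f g : Cc f -> Cc g -> I (fun x => f x - g x) = I f - I g.
Proof. by move=> fc gc; rewrite (posfunD HI)// ?posfunN//; exact: CcN. Qed.

Lemma posfun0 : I (fun=> 0) = 0.
Proof.
have h : (fun _ : T => 0 : R) = (fun x => 0 * (fun=> 0) x).
  by apply/funext => x; rewrite mul0r.
by rewrite h (posfunZ HI 0 (@Cc0 T)) mul0r.
Qed.

Lemma posfunZr c f : Cc f -> I (fun x => f x * c) = I f * c.
Proof. by move=> fc; under eq_fun do rewrite mulrC; rewrite (posfunZ HI)// mulrC. Qed.

Lemma posfun_le f g : Cc f -> Cc g -> (forall x, f x <= g x) -> I f <= I g.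
Proof.
move=> fc gc fg; rewrite -subr_ge0 -posfunB//.
by apply: (posfun_ge0 HI); [exact: CcB|move=> x; rewrite subr_ge0].
Qed.

Lemma posfun_sum (J : Type) (r : seq J) (P : pred J) (F : J -> T -> R) :
  (forall i, Cc (F i)) ->
  I (fun x => \sum_(i <- r | P i) F i x) = \sum_(i <- r | P i) I (F i).
Proof.
move=> cF; elim: r => [|i r ih].
  by rewrite big_nil; under eq_fun do rewrite big_nil; exact: posfun0.
rewrite big_cons; under eq_fun do rewrite big_cons.
case: (P i) => //; rewrite (posfunD HI)// ?ih//; exact: Cc_sum.
Qed.

Lemma posfun_norm f : Cc f -> `|I f| <= I (fun x => `|f x|).
Proof.
move=> fc; have nc := Cc_norm fc; rewrite ler_norml; apply/andP; split.
  rewrite -posfunN//; apply: posfun_le => //; first exact: CcN.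
  by move=> x; rewrite lerNl -normrN ler_norm.
by apply: posfun_le => // x; rewrite ler_norm.
Qed.

Lemma posfun_norm_le f K (e : R) : Cc f -> (forall x, `|f x| <= e * plateau K x) ->
  `|I f| <= e * I (plateau K).
Proof.
move=> fc fe; rewrite (le_trans (posfun_norm fc))//.
rewrite -(posfunZ HI); last exact: Cc_plateau.
by apply: posfun_le => //; [exact: Cc_norm|apply: CcZ; exact: Cc_plateau].
Qed.

Lemma posfun_hoelder f g t : 0 < t -> t < 1 -> Cc f -> Cc g ->
  (forall x, 0 <= f x) -> (forall x, 0 <= g x) ->
  I (fun x => powR (f x) (1 - t) * powR (g x) t) <=
  powR (I f) (1 - t) * powR (I g) t.
Proof.
move=> t0 t1 fc gc f0 g0.
have t1' : 0 < 1 - t by rewrite subr_gt0.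
have amgm a b : 0 <= a -> 0 <= b -> powR a (1 - t) * powR b t <= (1 - t) * a + t * b.
  move=> a0 b0.
  have := @conjugate_powR R (powR a (1 - t)) (powR b t) (1 - t)^-1 t^-1
    (powR_ge0 _ _) (powR_ge0 _ _).
  rewrite !invr_gt0 !invrK subrK -!powRrM !divff ?gt_eqF// !powRr1// [_ * (1 - t)]mulrC.
  by rewrite [b * t]mulrC; apply.
have cpow h q : 0 < q -> Cc h -> (forall x, 0 <= h x) -> Cc (fun x => powR (h x) q).
  move=> q0 hc h0; have := Cc_powR q0 hc.
  by under eq_fun do rewrite ger0_norm//.
have prodc : Cc (fun x => powR (f x) (1 - t) * powR (g x) t).
  by apply: CcMr; [exact: cpow|apply: Cc_cont; exact: cpow].
have If0 := posfun_ge0 HI fc f0; have Ig0 := posfun_ge0 HI gc g0.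
(* scaling both factors to mass 1; the slack [e] covers the case of zero mass *)
have key e : 0 < e -> I (fun x => powR (f x) (1 - t) * powR (g x) t) <=
    powR (I f + e) (1 - t) * powR (I g + e) t.
  move=> e0; set A := I f + e; set B := I g + e.
  have A0 : 0 < A by rewrite ltr_wpDl.
  have B0 : 0 < B by rewrite ltr_wpDl.
  set C := powR A (1 - t) * powR B t.
  have C0 : 0 < C by rewrite mulr_gt0// powR_gt0.
  have le1 x : powR (f x) (1 - t) * powR (g x) t <=
      (C * (1 - t) / A) * f x + (C * t / B) * g x.
    have := amgm (f x / A) (g x / B) (divr_ge0 (f0 x) (ltW A0)) (divr_ge0 (g0 x) (ltW B0)).
    move=> h; rewrite !powRM ?invr_ge0 ?(ltW A0) ?(ltW B0)// in h.
    have -> : powR (f x) (1 - t) * powR (g x) t =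
       C * (powR (f x) (1 - t) * powR A^-1 (1 - t) * (powR (g x) t * powR B^-1 t)).
      have hA : powR A (1 - t) * powR A^-1 (1 - t) = 1.
        by rewrite -powRM ?divff ?powR1 ?invr_ge0 ?ltW// gt_eqF.
      have hB : powR B t * powR B^-1 t = 1.
        by rewrite -powRM ?divff ?powR1 ?invr_ge0 ?ltW// gt_eqF.
      have aux (a a' b b' u v : R) : a * a' = 1 -> b * b' = 1 ->
          u * v = a * b * (u * a' * (v * b')).
        move=> ha hb; have -> : a * b * (u * a' * (v * b')) = (a * a') * (b * b') * (u * v).
          by ring.
        by rewrite ha hb !mul1r.
      exact: aux.
    have := ler_wpM2l (ltW C0) h; move/le_trans; apply.
    by rewrite le_eqVlt; apply/orP; left; apply/eqP; field; rewrite !gt_eqF.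
  have := @posfun_le _ (fun x => (C * (1 - t) / A) * f x + (C * t / B) * g x) prodc _ le1.
  rewrite (posfunD HI); try exact: CcZ.
  rewrite !(posfunZ HI)//.
  move=> /(_ (CcD (CcZ _ fc) (CcZ _ gc)))/le_trans; apply.
  rewrite [leRHS](_ : _ = C * (1 - t) / A * A + C * t / B * B); last first.
    by rewrite -/C; field; rewrite !gt_eqF.
  apply: lerD; apply: ler_wpM2l.
  - by apply: divr_ge0; [apply: mulr_ge0|]; exact: ltW.
  - by rewrite /A lerDl ltW.
  - by apply: divr_ge0; [apply: mulr_ge0|]; exact: ltW.
  - by rewrite /B lerDl ltW.
have cvgp q a : 0 < q -> 0 <= a -> (fun e : R => powR (a + e) q) @ 0^'+ --> powR a q.
  move=> q0 a0.
  have h : (fun e : R => powR `|a + e| q) @ 0^'+ --> powR a q.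
    have := @continuous_powR_norm R q q0 a; rewrite /continuous_at ger0_norm// => h.
    apply: (@cvg_comp _ _ _ (fun e => a + e) (fun y => powR `|y| q) _ (nbhs a)) => //.
    have -> : nbhs a = nbhs (a + 0) by rewrite addr0.
    by apply: cvgD; [exact: cvg_cst|exact: cvg_within].
  apply: cvg_trans h; apply: near_eq_cvg; have := @nbhs_right_ge R 0; apply: filterS => e e0.
  by rewrite ger0_norm// addr_ge0.
have lim : (fun e => powR (I f + e) (1 - t) * powR (I g + e) t) @ 0^'+ -->
    powR (I f) (1 - t) * powR (I g) t.
  by apply: cvgM; exact: cvgp.
rewrite -(cvg_lim _ lim)//; apply: limr_ge; first by apply/cvg_ex; eexists; exact: lim.
by near=> e; apply: key; near: e; exact: nbhs_right_gt.
Unshelve. all: by end_near. Qed.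

Lemma posfun_CS f g : Cc f -> Cc g ->
  I (fun x => `|f x| * `|g x|) <=
  Num.sqrt (I (fun x => f x ^+ 2)) * Num.sqrt (I (fun x => g x ^+ 2)).
Proof.
move=> fc gc; have f2 : Cc (fun x => f x ^+ 2) by exact: Cc_exp.
have g2 : Cc (fun x => g x ^+ 2) by exact: Cc_exp.
have h0 : 0 < 2^-1 :> R by rewrite invr_gt0.
have h1 : 2^-1 < 1 :> R by rewrite invf_lt1// ltr1n.
have f0 : 0 <= I (fun x => f x ^+ 2).
  by apply: (posfun_ge0 HI) => // x; rewrite sqr_ge0.
have g0 : 0 <= I (fun x => g x ^+ 2).
  by apply: (posfun_ge0 HI) => // x; rewrite sqr_ge0.
have := posfun_hoelder h0 h1 f2 g2 (fun x => sqr_ge0 _) (fun x => sqr_ge0 _).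
have -> : 1 - 2^-1 = 2^-1 :> R by field.
rewrite !powR12_sqrt//.
rewrite (_ : (fun x => _) = fun x => `|f x| * `|g x|)//.
by apply/funext => x; rewrite !powR12_sqrt ?sqr_ge0// !sqrtr_sqr.
Qed.

End PosfunTheory.

Section Parametric.
Context {T U : normedModType R} {J : (U -> R) -> R}.
Hypotheses (pT : proper_space T) (pU : proper_space U) (HJ : posfun J).

Lemma Cc_slice (f : T * U -> R) x : Cc f -> Cc (fun y => f (x, y)).
Proof.
move=> [cf [K fK]]; split.
  apply: (cont_comp cf) => y; apply: cvg_pair; [exact: cvg_cst|exact: cvg_id].
by exists K => y Ky; apply: fK; rewrite prod_normE lt_max Ky orbT.
Qed.

Lemma Cc_slice2 (f : T * U -> R) y : Cc f -> Cc (fun x => f (x, y)).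
Proof.
move=> [cf [K fK]]; split.
  apply: (cont_comp cf) => x; apply: cvg_pair; [exact: cvg_id|exact: cvg_cst].
by exists K => x Kx; apply: fK; rewrite prod_normE lt_max Kx.
Qed.

Lemma slice_bound (f : T * U -> R) K e x x' :
  (forall z, K < `|z| -> f z = 0) -> 0 <= e ->
  (forall y, `|f (x, y) - f (x', y)| <= e) ->
  forall y, `|f (x, y) - f (x', y)| <= e * plateau K y.
Proof.
move=> fK e0 h y; have [yK|Ky] := leP `|y| K; first by rewrite plateau1// mulr1.
rewrite !fK ?prod_normE ?lt_max ?Ky ?orbT// subrr normr0 mulr_ge0//.
exact: plateau_ge0.
Qed.

(** By uniform continuity two nearby slices differ by at most e' on a fixed ball, hence their values
    under J by e' times [J (plateau K)]. This is what allows functionals to be iterated. *)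
Lemma Cc_posfun (f : T * U -> R) : Cc f -> Cc (fun x => J (fun y => f (x, y))).
Proof.
move=> fc; have [K K0 fK] := Cc_supp fc; split; last first.
  exists K => x Kx; rewrite -[RHS](posfun0 HJ); congr J.
  by apply/funext => y; apply: fK; rewrite prod_normE lt_max Kx.
apply/continuousP_norm => x e e0.
have b0 : 0 <= J (plateau K) by apply: (posfun_ge0 HJ); [exact: Cc_plateau|exact: plateau_ge0].
pose e' := e / (J (plateau K) + 1).
have b1 : 0 < J (plateau K) + 1 by rewrite ltr_wpDl.
have e'0 : 0 < e' by rewrite divr_gt0.
have [d d0 H] := Cc_unif (proper_prod pT pU) fc e'0.
exists d => // x' xx'; rewrite -(posfunB HJ); try exact: Cc_slice.
apply: (@le_lt_trans _ _ (e' * J (plateau K))).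
  apply: (posfun_norm_le HJ); first by apply: CcB; exact: Cc_slice.
  apply: slice_bound => //; first exact: ltW.
  move=> y; apply/ltW/H; rewrite prod_normE /= subrr normr0 gt_max d0 andbT.
  exact: xx'.
by rewrite /e' -mulrA gtr_pMr// mulrC ltr_pdivrMr// mul1r ltrDl.
Qed.

End Parametric.

(** * Exchange of two positive functionals *)

Section Swap.
Context {U : normedModType R} {I : (R -> R) -> R} {J : (U -> R) -> R}.
Hypotheses (pU : proper_space U) (HI : posfun I) (HJ : posfun J).

Let clamp (y : R) : R := Num.max 0 (Num.min 1 y).
(** The hat function of width h at the node a + k h. Written as a difference of consecutive ramps,
    the hats telescope to a partition of unity. *)
Let tent h a k (x : R) : R := clamp ((x - a) / h - k%:R + 1) - clamp ((x - a) / h - k%:R).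

Let tent_ge0 h a k x : 0 <= tent h a k x.
Proof.
rewrite /tent /clamp; set y := (x - a) / h - k%:R.
rewrite /Num.max /Num.min /Order.max /Order.min.
by case: ifP; case: ifP; case: ifP; case: ifP => *; lra.
Qed.

Let tent_supp h a k x : 0 < h -> 0 < tent h a k x -> `|x - (a + k%:R * h)| <= h.
Proof.
move=> h0; rewrite /tent /clamp; set y := (x - a) / h - k%:R => H.
have -> : x - (a + k%:R * h) = y * h by rewrite /y; field; rewrite gt_eqF.
rewrite normrM (gtr0_norm h0) ger_pMl// ler_norml.
move: H; rewrite /Num.max /Num.min /Order.max /Order.min.
by case: ifP; case: ifP; case: ifP; case: ifP => *; lra.
Qed.

Let tent_sum h a M x : 0 < h -> a <= x -> x <= a + M%:R * h ->
  \sum_(k < M.+1) tent h a k x = 1.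
Proof.
move=> h0 ax xM; rewrite -(big_mkord xpredT (fun k => tent h a k x)).
have -> : \sum_(0 <= k < M.+1) tent h a k x =
   \sum_(0 <= k < M.+1) (- clamp ((x - a) / h - k.+1%:R + 1) - - clamp ((x - a) / h - k%:R + 1)).
  apply: eq_bigr => k _; rewrite opprK addrC; congr (_ - _); congr clamp.
  by rewrite -natr1; ring.
rewrite telescope_sumr//.
have y0 : 0 <= (x - a) / h by rewrite divr_ge0 ?subr_ge0// ltW.
have yM : (x - a) / h <= M%:R by rewrite ler_pdivrMr// lerBlDl.
rewrite -natr1; move: y0 yM; set y := (x - a) / h; set m := M%:R => y0 yM.
rewrite /clamp /Num.max /Num.min /Order.max /Order.min.
by case: ifP; case: ifP; case: ifP; case: ifP => *; lra.
Qed.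

Let tent_cont h a k : continuous (tent h a k : R -> R).
Proof.
have cc : continuous clamp.
  apply: cont_max; first exact: cont_cst.
  by apply: (@cont_min R R); [exact: cont_cst|move=> x; exact: cvg_id].
have ca : continuous (fun x : R => (x - a) / h - k%:R).
  apply: cont_sub; last exact: cont_cst.
  apply: cont_mul; last exact: cont_cst.
  by apply: (@cont_sub R R); [move=> x; exact: cvg_id|exact: cont_cst].
apply: cont_sub; apply: (cont_comp cc) => //.
by apply: cont_add => //; exact: cont_cst.
Qed.

(* Both iterated functionals agree on the approximants
   [\sum_k tent_k x * f (x_k, y)], which converge uniformly to [f]. *)
Lemma posfun_swap1 (f : R * U -> R) : Cc f ->
  I (fun x => J (fun y => f (x, y))) = J (fun y => I (fun x => f (x, y))).
Proof.
move=> fc; have [K K0 fK] := Cc_supp fc.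
(* The mesh satisfies h <= 1, so a node whose hat is nonzero at a point beyond L lies beyond K + 1;
   there both f and its approximant vanish. *)
have pR := proper_R; pose L := K + 2.
have fc' : Cc (fun z : U * R => f (z.2, z.1)).
  case: (fc) => cf _; split.
    apply: (cont_comp cf) => z.
    by apply: (@cvg_pair _ _ _ _ (nbhs z.2) (nbhs z.1)); [exact: cvg_snd|exact: cvg_fst].
  exists K => -[x y] /=; rewrite prod_normE /= => h; apply: fK.
  by rewrite prod_normE /= maxC.
have b0 (V : normedModType R) (F : (V -> R) -> R) k : posfun F -> 0 <= F (plateau k).
  by move=> HF; apply: (posfun_ge0 HF); [exact: Cc_plateau|exact: plateau_ge0].
have bI := b0 _ _ L HI; have bJ := b0 _ _ K HJ.
(* Each iterated value moves by at most [e / B] times the product of the two plateau values, so the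
   total error is [e / B * (B - 1)]. *)
pose B := 2 * (I (plateau L) * J (plateau K)) + 1.
have B0 : 0 < B by rewrite ltr_wpDl// mulr_ge0// mulr_ge0.
apply/eqP; rewrite -subr_eq0 -normr_le0; apply/ler_addgt0Pr => e e0; rewrite add0r.
have e'0 : 0 < e / B by rewrite divr_gt0.
have [d d0 H] := Cc_unif (proper_prod pR pU) fc e'0.
pose h := Num.min (d / 2) 1; have h0 : 0 < h by rewrite lt_min divr_gt0//= ltr01.
have hd : h < d by rewrite gt_min ltr_pdivrMr// ltr_pMr// ltr1n.
have h1 : h <= 1 by rewrite ge_min lexx orbT.
pose M := Num.bound (2 * L / h).
have hM : 2 * L <= M%:R * h.
  rewrite -ler_pdivrMr// ltW// archi_boundP// divr_ge0 ?(ltW h0)//.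
  by rewrite mulr_ge0// /L addr_ge0 ?(ltW K0).
pose tk k : R -> R := tent h (- L) k; pose xk k := - L + k%:R * h.
pose G (x : R) y := \sum_(k < M.+1) f (xk k, y) * tk k x.
have tc k : Cc (tk k).
  split; first exact: tent_cont.
  exists (`|xk k| + h) => x hx; apply/eqP; rewrite eq_le tent_ge0 andbT leNgt.
  apply/negP => /(tent_supp h0); rewrite -/(xk k) => xh.
  have := ler_normD (x - xk k : R) (xk k); rewrite subrK => h2.
  by move: hx xh h2; lra.
have fk k : Cc (fun y => f (xk k, y)) by exact: Cc_slice.
have Gy x : Cc (G x) by apply: Cc_sum => k; apply: CcMr => //; exact: cont_cst.
have Gx y : Cc (fun x => G x y) by apply: Cc_sum => k; apply: CcZ.
have JG : (fun x => J (G x)) = (fun x => \sum_(k < M.+1) J (fun y => f (xk k, y)) * tk k x).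
  apply/funext => x; rewrite /G (posfun_sum HJ); last first.
    by move=> k; apply: CcMr => //; exact: cont_cst.
  by apply: eq_bigr => k _; rewrite (posfunZr HJ).
have IG : (fun y => I (fun x => G x y)) = (fun y => \sum_(k < M.+1) f (xk k, y) * I (tk k)).
  apply/funext => y; rewrite /G (posfun_sum HI); last by move=> k; apply: CcZ.
  by apply: eq_bigr => k _; rewrite (posfunZ HI).
have swapG : I (fun x => J (G x)) = J (fun y => I (fun x => G x y)).
  rewrite JG IG (posfun_sum HI); last by move=> k; apply: CcZ.
  rewrite (posfun_sum HJ); last by move=> k; apply: CcMr => //; exact: cont_cst.
  by apply: eq_bigr => k _; rewrite (posfunZ HI)// (posfunZr HJ).
have EB x : 0 <= e / B * plateau L x :> R by rewrite mulr_ge0 ?plateau_ge0// ltW.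
have err x y : `|f (x, y) - G x y| <= e / B * plateau L x * plateau K y.
  have [yK|Ky] := leP `|y| K; last first.
    rewrite /G big1 ?fK ?subr0 ?normr0; first by rewrite mulr_ge0 ?plateau_ge0.
    - by rewrite prod_normE lt_max Ky orbT.
    - by move=> k _; rewrite fK ?mul0r// prod_normE lt_max Ky orbT.
  rewrite (plateau1 yK) mulr1.
  have [xL|Lx] := leP `|x| L; last first.
    rewrite fK; last by rewrite prod_normE lt_max (lt_trans _ Lx)// /L ltrDl.
    rewrite /G big1 ?subrr ?normr0//.
    move=> k _; have := tent_ge0 h (- L) k x; rewrite le_eqVlt => /orP[/eqP t0|tp].
      by rewrite /tk -t0 mulr0.
    rewrite fK ?mul0r// prod_normE lt_max; apply/orP; left => /=.
    have := tent_supp h0 tp; rewrite -/(xk k) => xh.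
    have := ler_normD (x - xk k : R) (xk k); rewrite subrK => h2.
    by move: Lx xh h2; rewrite /L; lra.
  rewrite plateau1// mulr1.
  have s1 : \sum_(k < M.+1) tk k x = 1.
    move: xL; rewrite ler_norml => /andP[x1 x2]; apply: tent_sum => //.
    by rewrite (le_trans x2)//; lra.
  rewrite -[f (x, y)]mulr1 -s1 mulr_sumr /G -sumrB.
  rewrite -[leRHS]mulr1 -s1 mulr_sumr (le_trans (ler_norm_sum _ _ _))//.
  apply: ler_sum => k _; rewrite -mulrBl normrM [X in _ * X]ger0_norm ?tent_ge0//.
  have := tent_ge0 h (- L) k x; rewrite le_eqVlt => /orP[/eqP t0|tp].
    by rewrite /tk -t0 !mulr0.
  apply: ler_wpM2r; first exact: ltW.
  apply/ltW/H; rewrite prod_normE /= subrr normr0 gt_max d0 andbT.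
  by apply: le_lt_trans hd; exact: tent_supp.
have ctsJ : Cc (fun x : R => J (fun y => f (x, y))) by exact: (Cc_posfun pR pU HJ fc).
have ctsI : Cc (fun y => I (fun x : R => f (x, y))).
  exact: (@Cc_posfun U R I pU pR HI _ fc').
have e1 : `|I (fun x => J (fun y => f (x, y))) - I (fun x => J (G x))| <= e / B * J (plateau K) * I (plateau L).
  rewrite -(posfunB HI)//; last by rewrite JG; apply: Cc_sum => k; apply: CcZ.
  apply: (posfun_norm_le HI) => [|x].
    by apply: CcB => //; rewrite JG; apply: Cc_sum => k; apply: CcZ.
  rewrite -(posfunB HJ)//; last exact: Cc_slice.
  rewrite [leRHS]mulrAC; apply: (posfun_norm_le HJ); last exact: err.
  by apply: CcB => //; exact: Cc_slice.
have e2 : `|J (fun y => I (fun x => f (x, y))) - J (fun y => I (fun x => G x y))| <= e / B * I (plateau L) * J (plateau K).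
  have c2 : Cc (fun y => I (fun x => G x y)).
    by rewrite IG; apply: Cc_sum => k; apply: CcMr => //; exact: cont_cst.
  rewrite -(posfunB HJ)//; apply: (posfun_norm_le HJ) => [|y]; first exact: CcB.
  rewrite -(posfunB HI)//; last exact: Cc_slice2.
  rewrite [leRHS]mulrAC; apply: (posfun_norm_le HI); last by move=> x; rewrite mulrAC; exact: err.
  by apply: CcB => //; exact: Cc_slice2.
apply: le_trans (ler_distD (I (fun x => J (G x))) _ _) _.
rewrite [X in _ + X]distrC {2}swapG; apply: le_trans (lerD e1 e2) _.
have -> : e / B * J (plateau K) * I (plateau L) + e / B * I (plateau L) * J (plateau K) =
   e / B * (B - 1) by rewrite /B; ring.
rewrite -[leRHS](divfK (lt0r_neq0 B0)); apply: ler_wpM2l; first exact: ltW.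
by rewrite gerBl.
Qed.

End Swap.
End CompactSupport.

(** * The iterated integral *)

Section LineIntegral.
Context {R : realType}.
Notation mu := (@lebesgue_measure R).
Implicit Types f g : R -> R.

Definition int1 f : R := Rintegral mu setT f.

Let restrict_supp (K : R) f : (forall x, K < `|x| -> f x = 0) -> f \_ `[- K, K] = f.
Proof.
move=> fK; apply/funext => x; rewrite patchE; case: ifPn => // xK.
apply/esym/fK; rewrite ltNge ler_norml; apply: contra xK => h.
by rewrite inE /= in_itv.
Qed.

Let integrable_patch (D : set R) f : measurable (D : set (measurableTypeR R)) ->
  mu.-integrable D (EFin \o f) -> mu.-integrable setT (EFin \o f \_ D).
Proof.
move=> mD h; rewrite -restrict_EFin.
exact: (@integrable_mkcond _ (measurableTypeR R) R mu D (EFin \o f) mD).1 h.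
Qed.

Lemma Cc_integrable f : Cc f -> mu.-integrable setT (EFin \o f).
Proof.
move=> fc; have [K K0 fK] := Cc_supp fc.
rewrite -(restrict_supp fK); apply: integrable_patch; first exact: measurable_itv.
apply: continuous_compact_integrable; first exact: segment_compact.
exact: continuous_subspaceT (Cc_cont fc).
Qed.

Lemma int1_restrict K f : (forall x, K < `|x| -> f x = 0) ->
  int1 f = \int[mu]_(x in `[- K, K]) f x.
Proof. by move=> fK; rewrite [RHS]Rintegral_mkcond restrict_supp. Qed.

Lemma posfun_int1 : posfun int1.
Proof.
split=> [f g fc gc|c f fc|f fc f0].
- by apply: RintegralD => //; exact: Cc_integrable.
- by apply: RintegralZl => //; exact: Cc_integrable.
- exact: Rintegral_ge0.
Qed.

Lemma int1_affine f (l a : R) : 0 < l -> Cc f ->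
  int1 (fun t => f (l * t + a)) = l^-1 * int1 f.
Proof.
move=> l0 fc; have [K K0 fK] := Cc_supp fc.
pose F t := l * t + a.
have dF t : is_derive t (1 : R) F l.
  have h : is_derive t (1 : R) (l *: (@id R) + cst a) (l *: (1 : R) + 0) by apply: is_deriveD.
  by apply: (is_derive_eq h); rewrite addr0 /GRing.scale /= mulr1.
have F' : (derive1 F) = cst l by apply/funext => t; rewrite derive1E; exact: derive_val.
have cF : continuous F.
  apply: cont_add; last exact: cont_cst.
  by apply: cont_mul; [exact: cont_cst|move=> x; exact: cvg_id].
(* The image of [-M, M] under F then contains [-K, K], so the substitution on a compact interval
   sees the whole support. *)
pose M := (K + `|a|) / l.
have M0 : 0 < M by rewrite divr_gt0// ltr_pwDl.
have lM : l * M = K + `|a| by rewrite /M mulrC divfK// gt_eqF.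
have aa := ler_norm a; have na : - a <= `|a| by rewrite -normrN ler_norm.
have FM : K <= F M by rewrite /F lM; lra.
have FN : F (- M) <= - K by rewrite /F mulrN lM; lra.
have gM t : M < `|t| -> f (F t) = 0.
  move=> Mt; apply: fK.
  have : `|l * t| <= `|F t| + `|a|.
    by have := ler_normB (F t) a; rewrite /F addrK.
  rewrite normrM (gtr0_norm l0).
  have : l * M < l * `|t| by rewrite ltr_pM2l.
  by rewrite lM; lra.
have e1 : int1 f = \int[mu]_(x in `[F (- M), F M]) f x.
  rewrite [RHS]Rintegral_mkcond; congr Rintegral; apply/funext => x.
  rewrite patchE; case: ifPn => // xF; apply: fK; rewrite ltNge.
  apply: contra xF; rewrite ler_norml => /andP[x1 x2].
  by rewrite inE/= in_itv/= (le_trans FN x1) (le_trans x2 FM).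
have sub : (\int[mu]_(x in `[F (- M)%R, F M]) (f x)%:E =
    \int[mu]_(x in `[(- M)%R, M]) (((f \o F) * (derive1 F)) x)%:E)%E.
  apply: integration_by_substitution_increasing.
  - by rewrite ge0_cp ?ltW.
  - by move=> x y _ _ xy; rewrite /F ltrD2r ltr_pM2l.
  - by rewrite F' => x _; exact: cvg_cst.
  - by rewrite F'; exact: is_cvg_cst.
  - by rewrite F'; exact: is_cvg_cst.
  - split=> [x _||]; first by have := dF x; case.
      by apply: cvg_at_right_filter; exact: cF.
    by apply: cvg_at_left_filter; exact: cF.
  - exact: continuous_subspaceT (Cc_cont fc).
rewrite e1 /Rintegral sub F' (int1_restrict gM) /Rintegral.
have ig : mu.-integrable `[- M, M] (EFin \o (f \o F)).
  apply: continuous_compact_integrable; first exact: segment_compact.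
  by apply: continuous_subspaceT; apply: cont_comp => //; exact: Cc_cont fc.
have -> : fine (\int[mu]_(x in `[- M, M]) (((f \o F) * cst l) x)%:E) =
    \int[mu]_(x in `[- M, M]) ((f \o F) x * l) by [].
rewrite RintegralZr//.
by rewrite mulrCA mulVf ?gt_eqF// mulr1.
Qed.

(** The fundamental theorem of calculus started left of the support. Used on every coordinate line,
    it provides the hypothesis of the Gagliardo-Nirenberg inequality. *)
Lemma norm_le_int1 f g t : (forall x : R, is_derive x (1 : R) f (g x)) -> Cc f -> Cc g ->
  `|f t| <= int1 (fun x => `|g x|).
Proof.
move=> fg fc gc; have [K K0 fK] := Cc_supp fc.
pose M := K + `|t| + 1.
have nt := ler_norm t; have nnt : - t <= `|t| by rewrite -normrN ler_norm.
have Mt : - M < t by rewrite /M; lra.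
have f0 : f (- M) = 0.
  by apply: fK; rewrite normrN ger0_norm /M; have := normr_ge0 t; lra.
have cg := Cc_cont gc.
have ftc : (\int[mu]_(x in `[(- M)%R, t]) (g x)%:E = (f t)%:E - (f (- M))%:E)%E.
  apply: continuous_FTC2 => //.
  - exact: continuous_subspaceT.
  - split=> [x _||]; first by have := fg x; case.
      by apply: cvg_at_right_filter; exact: (Cc_cont fc).
    by apply: cvg_at_left_filter; exact: (Cc_cont fc).
  - by move=> x _; rewrite derive1E; have := fg x; move=> h; exact: derive_val.
have ig : mu.-integrable `[- M, t] (EFin \o g).
  apply: continuous_compact_integrable; first exact: segment_compact.
  exact: continuous_subspaceT.
have -> : f t = \int[mu]_(x in `[- M, t]) g x.
  by rewrite /Rintegral ftc f0 sube0.
apply: le_trans (le_normr_Rintegral _ ig) _; first exact: measurable_itv.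
have ign : mu.-integrable setT (EFin \o (fun x => `|g x|)) by apply/Cc_integrable/Cc_norm.
rewrite Rintegral_mkcond; apply: le_Rintegral => //.
  apply: integrable_patch; first exact: measurable_itv.
  exact: (integrableS _ _ _ ign).
by move=> x _; rewrite patchE; case: ifP => // _; exact: normr_ge0.
Qed.

Lemma int1_gt0 f x0 : Cc f -> (forall x, 0 <= f x) -> 0 < f x0 -> 0 < int1 f.
Proof.
move=> fc f0 fx0; have [||d d0 dP] := (continuousP_norm f).1 _ x0 (f x0 / 2).
- exact: Cc_cont.
- by rewrite divr_gt0.
pose A := `[x0 - d / 2, x0 + d / 2]%classic : set R.
pose c := f x0 / 2.
have c0 : 0 < c by rewrite divr_gt0.
have fA x : A x -> c <= f x.
  rewrite /A /= in_itv /= => /andP[h1 h2].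
  have : `|x0 - x| < d by rewrite ltr_norml; lra.
  by move=> /dP; rewrite ltr_norml /c; lra.
have mA : measurable A by exact: measurable_itv.
have iA : mu.-integrable A (EFin \o cst c).
  apply: continuous_compact_integrable; first exact: segment_compact.
  by apply: continuous_subspaceT; exact: cst_continuous.
apply: (@lt_le_trans _ _ (\int[mu]_(x in A) cst c x)).
  have muA : mu `[x0 - d / 2, x0 + d / 2]%classic = d%:E.
    rewrite lebesgue_measure_itv/= lte_fin ifT; last by lra.
    by rewrite -EFinB; congr EFin; lra.
  by rewrite Rintegral_cst// [X in fine X]muA mulr_gt0.
rewrite Rintegral_mkcond; apply: le_Rintegral => //.
- exact: integrable_patch.
- exact: Cc_integrable.
- by move=> x _; rewrite patchE; case: ifPn => // /set_mem/fA.
Qed.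

End LineIntegral.

Section SpaceIntegral.
Context {R : realType}.

Lemma coord_le_norm n (v : 'rV[R]_n) i : `|v ord0 i| <= `|v|.
Proof.
have := @mx_normrE R 1 n v; rewrite /Num.norm /= => ->.
by apply/bigmax_geP; right; exists (ord0, i).
Qed.

Lemma norm_le_coord n (v : 'rV[R]_n) e : 0 <= e ->
  (forall i, `|v ord0 i| <= e) -> `|v| <= e.
Proof.
move=> e0 H; have := @mx_normrE R 1 n v; rewrite [X in _ -> X <= _]/Num.norm /= => ->.
apply/bigmax_leP; split => // -[i j] _ /=; rewrite (ord1 i); exact: H.
Qed.

(** The outermost integral of [iint] runs over the coordinate of highest index, so inductions on the
    dimension split off the last coordinate. *)
Definition rsnoc n (x : 'rV[R]_n) (t : R) : 'rV[R]_n.+1 :=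
  \row_i oapp (fun j => x ord0 j) t (unlift ord_max i).

Definition rbelast n (x : 'rV[R]_n.+1) : 'rV[R]_n := \row_j x ord0 (lift ord_max j).

Lemma rsnoc_lift n (x : 'rV[R]_n) t j : rsnoc x t ord0 (lift ord_max j) = x ord0 j.
Proof. by rewrite mxE liftK. Qed.

Lemma rsnoc_max n (x : 'rV[R]_n) t : rsnoc x t ord0 ord_max = t.
Proof. by rewrite mxE unlift_none. Qed.

Lemma rsnocK n (x : 'rV[R]_n.+1) : rsnoc (rbelast x) (x ord0 ord_max) = x.
Proof.
apply/rowP => i; case: (unliftP ord_max i) => [j|] ->; last by rewrite rsnoc_max.
by rewrite rsnoc_lift mxE.
Qed.

Lemma rsnocD n (x y : 'rV[R]_n) t s : rsnoc x t + rsnoc y s = rsnoc (x + y) (t + s).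
Proof. by apply/rowP => i; rewrite !mxE; case: unlift => [j|]//=; rewrite mxE. Qed.

Lemma rsnocZ n (x : 'rV[R]_n) t c : c *: rsnoc x t = rsnoc (c *: x) (c * t).
Proof. by apply/rowP => i; rewrite !mxE; case: unlift => [j|]//=; rewrite mxE. Qed.

Lemma rsnocB n (x y : 'rV[R]_n) t s : rsnoc x t - rsnoc y s = rsnoc (x - y) (t - s).
Proof. by rewrite -scaleN1r rsnocZ rsnocD scaleN1r mulN1r. Qed.

Lemma norm_rsnoc n (x : 'rV[R]_n) t : `|rsnoc x t| = Num.max `|t| `|x|.
Proof.
apply/eqP; rewrite eq_le; apply/andP; split.
  apply: norm_le_coord; first by rewrite le_max normr_ge0.
  move=> i; case: (unliftP ord_max i) => [j|] ->; last by rewrite rsnoc_max le_max lexx.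
  by rewrite rsnoc_lift le_max coord_le_norm orbT.
rewrite ge_max; apply/andP; split.
  by rewrite -(rsnoc_max x t) {2}rsnoc_max; exact: coord_le_norm.
apply: norm_le_coord => // i; rewrite -(rsnoc_lift x t); exact: coord_le_norm.
Qed.

Lemma Cc_rsnoc n (f : 'rV[R]_n.+1 -> R) : Cc f ->
  Cc (fun z : R * 'rV[R]_n => f (rsnoc z.2 z.1)).
Proof.
move=> [cf [K fK]]; split; last first.
  by exists K => -[t x]; rewrite prod_normE /= => h; apply: fK; rewrite norm_rsnoc.
apply/continuousP_norm => -[t x] e e0 /=.
have [d d0 dP] := (continuousP_norm f).1 cf (rsnoc x t) e e0.
exists d => // -[s y]; rewrite prod_normE /= => h; apply: dP.
by rewrite rsnocB norm_rsnoc.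
Qed.

Lemma integral_RNS n (f : 'rV[R]_n.+1 -> R) :
  integral_RN f = int1 (fun t => integral_RN (fun x => f (rsnoc x t))).
Proof.
rewrite /integral_RN /= /int1; congr Rintegral; apply/funext => t; congr iint.
apply/funext => g; congr f; apply/rowP => i; rewrite !mxE /upd.
case: (unliftP ord_max i) => [j|] ->; last by rewrite /= eqxx.
by rewrite /oapp mxE lift_max ltn_eqF.
Qed.

Lemma integral_RN0 (f : 'rV[R]_0 -> R) : integral_RN f = f 0.
Proof. by rewrite /integral_RN /=; congr f; apply/rowP => -[]. Qed.

Lemma posfun_integral n : posfun (@integral_RN R n).
Proof.
elim: n => [|n ih].
  split=> [f g _ _|c f _|f _ f0]; rewrite !integral_RN0//.
have slice f t : Cc f -> Cc (fun x : 'rV[R]_n => f (rsnoc x t)).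
  by move=> /Cc_rsnoc/(@Cc_slice _ _ _ _ t).
have outer f : Cc f -> Cc (fun t : R => integral_RN (fun x : 'rV[R]_n => f (rsnoc x t))).
  move=> /Cc_rsnoc h.
  exact: (@Cc_posfun R R 'rV[R]_n (@integral_RN R n) proper_R (@proper_rV R n) ih _ h).
split=> [f g fc gc|c f fc|f fc f0]; rewrite !integral_RNS.
- rewrite -(posfunD posfun_int1); try exact: outer.
  by congr int1; apply/funext => t; rewrite -(posfunD ih)//; exact: slice.
- rewrite -(posfunZ posfun_int1); last exact: outer.
  by congr int1; apply/funext => t; rewrite -(posfunZ ih)//; exact: slice.
- apply: (posfun_ge0 posfun_int1); first exact: outer.
  by move=> t; apply: (posfun_ge0 ih); [exact: slice|].
Qed.

Lemma Cc_slice_rsnoc n (f : 'rV[R]_n.+1 -> R) t : Cc f ->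
  Cc (fun x : 'rV[R]_n => f (rsnoc x t)).
Proof. by move=> /Cc_rsnoc/(@Cc_slice _ _ _ _ t). Qed.

Lemma Cc_integral_rsnoc n (f : 'rV[R]_n.+1 -> R) : Cc f ->
  Cc (fun t : R => integral_RN (fun x : 'rV[R]_n => f (rsnoc x t))).
Proof.
move=> /Cc_rsnoc h.
exact: (@Cc_posfun R R 'rV[R]_n (@integral_RN R n) proper_R (@proper_rV R n) (posfun_integral n) _ h).
Qed.

(** Fubini with an arbitrary positive functional in the second variable. At a fixed last coordinate
    the induction hypothesis exchanges J with the integral over the others; the last one is then
    exchanged by [posfun_swap1]. *)
Lemma integral_swap n (U : normedModType R) (J : (U -> R) -> R) (f : 'rV[R]_n * U -> R) :
  proper_space U -> posfun J -> Cc f ->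
  integral_RN (fun x => J (fun y => f (x, y))) =
  J (fun y => integral_RN (fun x => f (x, y))).
Proof.
move=> pU HJ; elim: n f => [|n ih] f fc.
  by rewrite integral_RN0; congr J; apply/funext => y; rewrite integral_RN0.
have fc3 : Cc (fun z : (R * U) * 'rV[R]_n => f (rsnoc z.2 z.1.1, z.1.2)).
  case: (fc) => cf [K fK]; split; last first.
    exists K => -[[t y] x]; rewrite prod_normE /= prod_normE /= => h; apply: fK.
    by rewrite prod_normE /= norm_rsnoc maxAC.
  apply/continuousP_norm => -[[t y] x] e e0 /=.
  have [d d0 dP] := (continuousP_norm f).1 cf (rsnoc x t, y) e e0.
  exists d => // -[[s y'] x']; rewrite prod_normE /= prod_normE /= => h; apply: dP.
  by rewrite prod_normE /= rsnocB norm_rsnoc maxAC.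
rewrite integral_RNS.
transitivity (int1 (fun t => J (fun y => integral_RN (fun x => f (rsnoc x t, y))))).
  congr int1; apply/funext => t.
  apply: (ih (fun z => f (rsnoc z.1 t, z.2))).
  case: (fc) => cf [K fK]; split; last first.
    exists K => -[x y]; rewrite prod_normE /= => h; apply: fK.
    by rewrite prod_normE /= norm_rsnoc -maxA lt_max h orbT.
  apply/continuousP_norm => -[x y] e e0 /=.
  have [d d0 dP] := (continuousP_norm f).1 cf (rsnoc x t, y) e e0.
  exists d => // -[x' y']; rewrite prod_normE /= => h; apply: dP.
  by rewrite prod_normE /= rsnocB norm_rsnoc subrr normr0 -maxA gt_max d0.
have c2 : Cc (fun z : R * U => integral_RN (fun x => f (rsnoc x z.1, z.2))).
  exact: (@Cc_posfun R (R * U)%type 'rV[R]_n _ (proper_prod proper_R pU) (@proper_rV R n)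
    (posfun_integral n) _ fc3).
have := posfun_swap1 pU posfun_int1 HJ c2 => /= ->.
by congr J; apply/funext => y; rewrite integral_RNS.
Qed.

Lemma integral_affine n (f : 'rV[R]_n -> R) (l : R) a : 0 < l -> Cc f ->
  integral_RN (fun x => f (l *: x + a)) = (l ^+ n)^-1 * integral_RN f.
Proof.
move=> l0; elim: n f a => [|n ih] f a fc.
  by rewrite !integral_RN0 expr0 invr1 mul1r; congr f; apply/rowP => -[].
rewrite !integral_RNS exprS invfM -mulrA.
rewrite -(posfunZ posfun_int1); last exact: Cc_integral_rsnoc.
rewrite -(int1_affine (a ord0 ord_max) l0); last first.
  by apply: CcZ; exact: Cc_integral_rsnoc.
congr int1; apply/funext => t.
rewrite -(ih _ (rbelast a)); last exact: Cc_slice_rsnoc.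
by congr integral_RN; apply/funext => x; rewrite rsnocZ -{1}(rsnocK a) rsnocD.
Qed.

Lemma integral_shift n (f : 'rV[R]_n -> R) a : Cc f ->
  integral_RN (fun x => f (x + a)) = integral_RN f.
Proof.
move=> fc; have := integral_affine a ltr01 fc; rewrite expr1n invr1 mul1r => <-.
by congr integral_RN; apply/funext => x; rewrite scale1r.
Qed.

Lemma integral_gt0 n (f : 'rV[R]_n -> R) x0 : Cc f -> (forall x, 0 <= f x) ->
  0 < f x0 -> 0 < integral_RN f.
Proof.
elim: n f x0 => [|n ih] f x0 fc f0 fx0.
  by rewrite integral_RN0; rewrite (_ : x0 = 0) in fx0 => //; apply/rowP => -[].
rewrite integral_RNS; apply: (@int1_gt0 _ _ (x0 ord0 ord_max)).
- exact: Cc_integral_rsnoc.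
- by move=> t; apply: (posfun_ge0 (posfun_integral n)) => //; exact: Cc_slice_rsnoc.
- apply: (ih _ (rbelast x0)) => //; first exact: Cc_slice_rsnoc.
  by rewrite rsnocK.
Qed.

End SpaceIntegral.

(** * Functions of class C^1 *)

Section Gradient.
Context {R : realType}.

Lemma is_deriveP (V : normedModType R) (f : V -> R) x v (d : R) :
  is_derive x v f d <-> forall e : R, 0 < e -> exists2 r : R, 0 < r &
    forall h : R, h != 0 -> `|h| < r -> `|h^-1 * (f (x + h *: v) - f x) - d| < e.
Proof.
have step : ((fun h => h^-1 *: ((f \o shift x) (h *: v) - f x)) @ 0^' --> d) <->
    forall e : R, 0 < e -> exists2 r : R, 0 < r &
    forall h : R, h != 0 -> `|h| < r -> `|h^-1 * (f (x + h *: v) - f x) - d| < e.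
  split=> [/cvgrPdist_lt H e e0|H].
    have /nbhs_ballP[r r0 rP] := H e e0; exists r => // h h0 hr.
    have := rP h; rewrite -ball_normE /= sub0r normrN => /(_ hr h0).
    by rewrite distrC [h *: v + x]addrC.
  apply/cvgrPdist_lt => e e0; have [r r0 rP] := H e e0.
  apply/nbhs_ballP; exists r => // h; rewrite -ball_normE /= sub0r normrN => hr h0.
  by have := rP h h0 hr; rewrite distrC /= [h *: v + x]addrC.
split=> [[dx dd]|/step h]; first by apply/step; rewrite -dd; exact: dx.
by split; [apply/cvg_ex; exists d|apply: cvg_lim].
Qed.

Lemma cont_lipschitz (V W : normedModType R) (h : V -> W) (C : R) (g : W -> R) :
  (forall x y, `|h x - h y| <= C * `|x - y|) -> continuous g -> continuous (fun x => g (h x)).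
Proof.
move=> hC cg; apply/continuousP_norm => x e e0.
have [d d0 dP] := (continuousP_norm g).1 cg (h x) e e0.
have C1 : 0 < `|C| + 1 by rewrite ltr_wpDl.
exists (d / (`|C| + 1)); first by rewrite divr_gt0.
move=> y; rewrite ltr_pdivlMr// => xy; apply: dP; apply: (le_lt_trans (hC x y)).
apply: le_lt_trans xy; rewrite mulrC ler_wpM2l//.
by rewrite (le_trans (ler_norm C))// lerDl.
Qed.

Lemma is_derive_line (V : normedModType R) (f : V -> R) x v t (d : R) :
  is_derive (x + t *: v) v f d <-> is_derive t (1 : R) (fun s : R => f (x + s *: v)) d.
Proof.
have eh (h : R) : h *: (1 : R) = h by exact: mulr1.
split=> /is_deriveP H; apply/is_deriveP => e e0; have [r r0 rP] := H e e0;
  exists r => // h h0 hr; have := rP h h0 hr; by rewrite eh scalerDl addrA.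
Qed.

Variable N : nat.
Implicit Types (f g : 'rV[R]_N -> R) (df dg : 'I_N -> 'rV[R]_N -> R).
Local Notation e_ := (@ebasis R N).

(** Carrying the gradient along with the function lets the rules of calculus be composed as terms;
    [pderiv] is recovered at the end by [has_grad_pderiv]. *)
Definition has_grad f df :=
  (forall i x, is_derive x (e_ i) f (df i x)) /\ forall i, continuous (df i).

Definition C1 f := (forall i x, derivable f x (e_ i)) /\ forall i, continuous (pderiv f i).

Lemma C1_has_grad f : C1 f -> has_grad f (pderiv f).
Proof. by case=> h1 h2; split=> // i x; apply: derivableP. Qed.

Lemma has_grad_pderiv f df : has_grad f df -> pderiv f = df.
Proof. by case=> h _; apply/funext => i; apply/funext => x; have := h i x; case. Qed.

Lemma has_grad_C1 f df : has_grad f df -> C1 f.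
Proof.
move=> h; split; last by rewrite (has_grad_pderiv h); case: h.
by case: h => h _ i x; have := h i x; case.
Qed.

Lemma norm_ebasis i t : `|t *: e_ i| = `|t|.
Proof.
apply/eqP; rewrite eq_le; apply/andP; split.
  apply: norm_le_coord => // j; rewrite !mxE eqxx /=.
  by case: (j == i); rewrite ?mulr1 ?mulr0 ?normr0.
by have := coord_le_norm (t *: e_ i) i; rewrite !mxE !eqxx mulr1.
Qed.

Lemma has_grad_MVT f df i x t : has_grad f df ->
  exists2 s, `|s| <= `|t| & f (x + t *: e_ i) - f x = t * df i (x + s *: e_ i).
Proof.
move=> [h _]; pose phi (s : R) := f (x + s *: e_ i).
have dphi s : is_derive s (1 : R) phi (df i (x + s *: e_ i)).
  exact: (is_derive_line f x (e_ i) s _).1 (h i _).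
have cphi : continuous phi.
  by move=> s; apply: differentiable_continuous; apply/derivable1_diffP; have := dphi s; case.
have p0 : phi 0 = f x by rewrite /phi scale0r addr0.
have [t0|t0] := leP 0 t.
  have [c] := @MVT_segment R phi (fun s => df i (x + s *: e_ i)) 0 t t0
    (fun s _ => dphi s) (continuous_subspaceT cphi).
  rewrite in_itv /= => /andP[c0 ct] H; exists c; first by rewrite !ger0_norm.
  by rewrite -p0 H subr0 mulrC.
have [c] := @MVT_segment R phi (fun s => df i (x + s *: e_ i)) t 0 (ltW t0)
    (fun s _ => dphi s) (continuous_subspaceT cphi).
rewrite in_itv /= => /andP[c0 ct] H; exists c; first by rewrite !ler0_norm ?lerN2// ltW.
by rewrite -p0 -opprB H sub0r mulrN opprK mulrC.
Qed.

(* Telescoping along the coordinates one at a time. *)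
Lemma has_grad_taylor f df x : has_grad f df -> forall e : R, 0 < e ->
  exists2 r : R, 0 < r & forall v, `|v| < r ->
  `|f (x + v) - f x - \sum_i v ord0 i * df i x| <= \sum_i `|v ord0 i| * e.
Proof.
move=> hf e e0; have [_ cdf] := hf.
have [r r0 rP] : exists2 r : R, 0 < r & forall i y, `|x - y| < r -> `|df i x - df i y| < e.
  have /choice[r rP] : forall i, exists r : R, 0 < r /\
      forall y, `|x - y| < r -> `|df i x - df i y| < e.
    by move=> i; have [r r0 rP] := (continuousP_norm (df i)).1 (cdf i) x e e0; exists r.
  exists (\big[Num.min/1]_i r i).
    by apply: lt_bigmin => // i _; have [] := rP i.
  move=> i y xy; have [_] := rP i; apply; apply: (lt_le_trans xy).
  exact: bigmin_le_cond.
exists r => // v vr.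
pose w k : 'rV[R]_N := \row_i (if (i < k)%N then v ord0 i else 0).
have w0 : w 0%N = 0 by apply/rowP => i; rewrite !mxE.
have wN : w N = v by apply/rowP => i; rewrite !mxE ltn_ord.
have wS (k : 'I_N) : w k.+1 = w k + v ord0 k *: e_ k.
  apply/rowP => i; rewrite !mxE eqxx /= ltnS leq_eqVlt.
  have [->|ik] := eqVneq i k; first by rewrite eqxx ltnn mulr1 add0r.
  by rewrite (negbTE (ik : (i : nat) != k)) mulr0 addr0.
have -> : f (x + v) - f x = \sum_(k < N) (f (x + w k.+1) - f (x + w k)).
  rewrite -(big_mkord xpredT (fun k => f (x + w k.+1) - f (x + w k))).
  by rewrite (telescope_sumr (fun k => f (x + w k)))// w0 wN addr0.
rewrite -sumrB; apply: le_trans (ler_norm_sum _ _ _) _; apply: ler_sum => k _.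
rewrite wS addrA; have [s sv ->] := has_grad_MVT k (x + w k) (v ord0 k) hf.
rewrite -mulrBr normrM; apply: ler_wpM2l => //.
rewrite distrC; apply/ltW/rP; apply: le_lt_trans vr.
rewrite -addrA opprD addrA subrr add0r normrN.
apply: norm_le_coord => // i; rewrite !mxE eqxx /=.
have [->|ik] := eqVneq i k; first by rewrite ltnn mulr1 add0r (le_trans sv)// coord_le_norm.
rewrite mulr0 addr0; case: ifP => _; first exact: coord_le_norm.
by rewrite normr0.
Qed.

(** [C1c_annulus] speaks of partial derivatives and their continuity only; continuity of the
    function itself comes from the first-order expansion. *)
Lemma has_grad_cont f df : has_grad f df -> continuous f.
Proof.
move=> hf; apply/continuousP_norm => x e e0.
have [r r0 rP] := has_grad_taylor x hf ltr01.
pose C := \sum_i (`|df i x| + 1) + 1.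
have C0 : 0 < C by rewrite ltr_wpDl// sumr_ge0// => i _; rewrite addr_ge0.
exists (Num.min r (e / C)); first by rewrite lt_min r0 divr_gt0.
move=> y; rewrite lt_min distrC => /andP[xr xe].
have := rP (y - x) xr; rewrite addrCA subrr addr0; set v := y - x => H.
rewrite distrC -(subrK (\sum_i v ord0 i * df i x) (f y - f x)).
apply: le_lt_trans (ler_normD _ _) _.
apply: (@le_lt_trans _ _ (`|v| * (C - 1))).
  rewrite /C addrK mulr_sumr; apply: (le_trans (lerD H (ler_norm_sum _ _ _))).
  rewrite -big_split /=; apply: ler_sum => i _; rewrite mulr1 normrM mulrDr mulr1 addrC.
  have := coord_le_norm v i => h; rewrite lerD// ler_wpM2r//.
rewrite ltr_pdivlMr// in xe; apply: le_lt_trans xe; rewrite ler_wpM2l//.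
by rewrite gerBl.
Qed.

(** Composition with a matrix turns coordinate directions into arbitrary ones, so derivatives along
    every vector are required. *)
Lemma has_grad_dir f df x v : has_grad f df ->
  is_derive x v f (\sum_i v ord0 i * df i x).
Proof.
move=> hf; apply/is_deriveP => e e0.
pose C := \sum_i `|v ord0 i| + 1.
have C0 : 0 < C by rewrite ltr_wpDl// sumr_ge0.
have eC : 0 < e / C by rewrite divr_gt0.
have [r r0 rP] := has_grad_taylor x hf eC.
exists (r / (`|v| + 1)); first by rewrite divr_gt0// ltr_wpDl.
move=> h h0; rewrite ltr_pdivlMr ?ltr_wpDl// => hr.
have /rP H : `|h *: v| < r.
  by rewrite normrZ (le_lt_trans _ hr)// ler_wpM2l// lerDl.
have e1 : \sum_i (h *: v) ord0 i * df i x = h * \sum_i v ord0 i * df i x.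
  by rewrite mulr_sumr; apply: eq_bigr => i _; rewrite mxE mulrA.
have e2 : \sum_i `|(h *: v) ord0 i| * (e / C) = `|h| * ((C - 1) * (e / C)).
  rewrite /C addrK mulr_suml mulr_sumr; apply: eq_bigr => i _.
  by rewrite mxE normrM -mulrA.
rewrite e1 e2 in H.
have -> : h^-1 * (f (x + h *: v) - f x) - \sum_i v ord0 i * df i x =
    h^-1 * (f (x + h *: v) - f x - h * \sum_i v ord0 i * df i x).
  by rewrite [RHS]mulrBr mulKf.
rewrite normrM normfV ltr_pdivrMl ?normr_gt0//; apply: (le_lt_trans H).
rewrite ltr_pM2l ?normr_gt0// mulrCA gtr_pMr// ltr_pdivrMr// mul1r.
by rewrite ltrBlDr ltrDl.
Qed.

Lemma has_grad_cst (c : R) : has_grad (fun=> c) (fun _ _ => 0).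
Proof. by split=> [i x|i]; [exact: is_derive_cst|exact: cont_cst]. Qed.

Lemma coord_cont j : continuous (fun x : 'rV[R]_N => x ord0 j).
Proof.
apply/continuousP_norm => x e e0; exists e => // y; apply: le_lt_trans.
by have := coord_le_norm (x - y) j; rewrite !mxE.
Qed.

Lemma has_grad_coord j : has_grad (fun x => x ord0 j) (fun i _ => (i == j)%:R).
Proof.
split=> [i x|i]; last exact: cont_cst.
apply/is_deriveP => e e0; exists 1 => // h h0 _.
by rewrite !mxE eqxx /= [j == i]eq_sym addrAC subrr add0r mulKf// subrr normr0.
Qed.

Lemma has_gradD f df g dg : has_grad f df -> has_grad g dg ->
  has_grad (fun x => f x + g x) (fun i x => df i x + dg i x).
Proof.
move=> [f1 f2] [g1 g2]; split=> [i x|i]; last by apply: cont_add.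
exact: (is_deriveD (f1 i x) (g1 i x)).
Qed.

Lemma has_gradM f df g dg : has_grad f df -> has_grad g dg ->
  has_grad (fun x => f x * g x) (fun i x => df i x * g x + f x * dg i x).
Proof.
move=> hf hg; have cf := has_grad_cont hf; have cg := has_grad_cont hg.
case: hf hg => [f1 f2] [g1 g2]; split=> [i x|i]; last first.
  by apply: cont_add; apply: cont_mul.
apply: (is_derive_eq (is_deriveM (f1 i x) (g1 i x))).
by rewrite /GRing.scale /= addrC mulrC [_ * dg i x]mulrC.
Qed.

Lemma has_gradZ (c : R) f df : has_grad f df ->
  has_grad (fun x => c * f x) (fun i x => c * df i x).
Proof.
move=> [f1 f2]; split=> [i x|i]; first exact: (is_deriveZ c (f1 i x)).
by apply: cont_mul => //; exact: cont_cst.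
Qed.

Lemma has_gradB f df g dg : has_grad f df -> has_grad g dg ->
  has_grad (fun x => f x - g x) (fun i x => df i x - dg i x).
Proof.
move=> hf hg; have := has_gradD hf (has_gradZ (-1) hg).
under [X in has_grad X]eq_fun do rewrite mulN1r.
by congr has_grad; apply/funext => i; apply/funext => x; rewrite mulN1r.
Qed.

Lemma has_grad_sum (I : Type) (r : seq I) (F : I -> 'rV[R]_N -> R) dF :
  (forall j, has_grad (F j) (dF j)) ->
  has_grad (fun x => \sum_(j <- r) F j x) (fun i x => \sum_(j <- r) dF j i x).
Proof.
move=> H; elim: r => [|j r ih].
  have := has_grad_cst 0; congr has_grad; first by apply/funext => x; rewrite big_nil.
  by apply/funext => i; apply/funext => x; rewrite big_nil.
have := has_gradD (H j) ih; congr has_grad; first by apply/funext => x; rewrite big_cons.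
by apply/funext => i; apply/funext => x; rewrite big_cons.
Qed.

Lemma has_grad_comp (h dh : R -> R) f df :
  (forall y : R, is_derive y (1 : R) h (dh y)) -> continuous dh -> has_grad f df ->
  has_grad (fun x => h (f x)) (fun i x => dh (f x) * df i x).
Proof.
move=> h1 h2 hf; have cf := has_grad_cont hf; case: hf => f1 f2; split=> [i x|i]; last first.
  by apply: cont_mul => //; apply: cont_comp.
rewrite -[x]addr0 -[0](scale0r (e_ i)); apply/is_derive_line.
have l := (is_derive_line f x (e_ i) 0 (df i x)).1.
rewrite scale0r addr0 in l; have {}l := l (f1 i x).
have := h1 (f (x + 0 *: e_ i)) => l2.
have := is_derive1_comp l2 l; by rewrite scale0r addr0.
Qed.

Lemma has_grad_affine f df (l : R) a : has_grad f df ->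
  has_grad (fun x => f (l *: x + a)) (fun i x => l * df i (l *: x + a)).
Proof.
move=> hf; split=> [i x|i].
  apply/is_deriveP => e e0.
  have := (is_deriveP _ _ _ _).1 (has_grad_dir (l *: x + a) (l *: e_ i) hf) e e0.
  case=> r r0 rP; exists r => // h h0 hr; have := rP h h0 hr.
  have -> : \sum_j (l *: e_ i) ord0 j * df j (l *: x + a) = l * df i (l *: x + a).
    rewrite (bigD1 i)//= !mxE !eqxx mulr1 big1 ?addr0// => j ji.
    by rewrite !mxE eqxx (negbTE ji) mulr0 mul0r.
  by rewrite scalerDr addrAC !scalerA [l * h]mulrC.
case: hf => _ f2; apply: cont_mul; first exact: cont_cst.
apply: (@cont_lipschitz _ _ (fun x : 'rV[R]_N => l *: x + a) `|l|) => // x y.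
by rewrite opprD addrACA subrr addr0 -scalerBr normrZ.
Qed.

Lemma mulmx_lipschitz (A : 'M[R]_N) (x y : 'rV[R]_N) :
  `|x *m A - y *m A| <= (\sum_i \sum_j `|A i j|) * `|x - y|.
Proof.
have C0 : 0 <= \sum_i \sum_j `|A i j| by rewrite sumr_ge0// => i _; rewrite sumr_ge0.
rewrite -mulmxBl; apply: norm_le_coord; first by rewrite mulr_ge0.
move=> j; rewrite mxE; apply: le_trans (ler_norm_sum _ _ _) _.
rewrite mulrC mulr_sumr; apply: ler_sum => i _; rewrite normrM.
apply: ler_pM => //; first exact: coord_le_norm.
by rewrite (bigD1 j)//= lerDl sumr_ge0.
Qed.

Lemma has_grad_mulmx f df (A : 'M[R]_N) : has_grad f df ->
  has_grad (fun x => f (x *m A)) (fun i x => \sum_j A i j * df j (x *m A)).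
Proof.
move=> hf; split=> [i x|i].
  apply/is_deriveP => e e0.
  have := (is_deriveP _ _ _ _).1 (has_grad_dir (x *m A) (e_ i *m A) hf) e e0.
  case=> r r0 rP; exists r => // h h0 hr; have := rP h h0 hr.
  have -> : \sum_j (e_ i *m A) ord0 j * df j (x *m A) = \sum_j A i j * df j (x *m A).
    by apply: eq_bigr => j _; rewrite /ebasis -rowE mxE.
  by rewrite mulmxDl scalemxAl.
case: hf => _ f2; apply: cont_sum => j; apply: cont_mul; first exact: cont_cst.
exact: (cont_lipschitz (@mulmx_lipschitz A) (f2 j)).
Qed.

Lemma has_grad_sqnorm :
  has_grad (fun x => \sum_j x ord0 j ^+ 2) (fun i x => 2 * x ord0 i).
Proof.
have H := has_grad_sum (index_enum 'I_N)
  (fun j => has_gradM (has_grad_coord j) (has_grad_coord j)).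
have -> : (fun x : 'rV[R]_N => \sum_j x ord0 j ^+ 2) =
    (fun x : 'rV[R]_N => \sum_j x ord0 j * x ord0 j).
  by apply/funext => x; apply: eq_bigr => j _; rewrite expr2.
rewrite (_ : (fun (i : 'I_N) (x : 'rV[R]_N) => 2 * x ord0 i) = (fun (i : 'I_N) (x : 'rV[R]_N) =>
   \sum_j ((i == j)%:R * x ord0 j + x ord0 j * (i == j)%:R))) //.
apply/funext => i; apply/funext => x; rewrite (bigD1 i)//= eqxx big1 ?addr0.
  by rewrite mul1r mulr1 mulr_natl.
by move=> j ji; rewrite eq_sym (negbTE ji) mul0r mulr0 addr0.
Qed.

End Gradient.

(** * C^1 functions of one real variable *)

Section RealC1.
Context {R : realType}.

(** A C^1 function vanishing on a half-line, from which bumps and cutoffs are assembled. *)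
Definition sqpos (y : R) : R := Num.max 0 y ^+ 2.

Lemma is_derive_sqpos (y : R) : is_derive y (1 : R) sqpos (2 * Num.max 0 y).
Proof.
apply/is_deriveP => e e0; exists e => // h h0 he.
rewrite /GRing.scale /= mulr1; apply: le_lt_trans he.
have -> : h^-1 * (sqpos (y + h) - sqpos y) - 2 * Num.max 0 y =
  h^-1 * (sqpos (y + h) - sqpos y - h * (2 * Num.max 0 y)) by rewrite [RHS]mulrBr mulKf.
rewrite normrM normfV ler_pdivrMl ?normr_gt0// -normrM -expr2 [leRHS]ger0_norm ?sqr_ge0//.
rewrite /sqpos ler_norml /Num.max /Order.max; apply/andP.
by case: ifPn; case: ifPn => h1 h2; split; nra.
Qed.

Lemma sqpos_cont : continuous (fun y : R => 2 * Num.max 0 y).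
Proof.
apply: cont_mul; first exact: cont_cst.
by apply: (@cont_max R R); [exact: cont_cst|move=> x; exact: cvg_id].
Qed.

Lemma is_derive_powR_norm (p y : R) : 1 < p ->
  is_derive y (1 : R) (fun z => powR `|z| p) (p * (powR `|y| (p - 2) * y)).
Proof.
move=> p1; have p0 : 0 < p by exact: lt_trans p1.
have pp (z : R) : 0 < z -> is_derive z (1 : R) (fun z => powR `|z| p) (p * (powR `|z| (p - 2) * z)).
  move=> z0; apply: (is_derive_eq (f' := p * powR z (p - 1))); last first.
    rewrite (gtr0_norm z0); congr (_ * _).
    rewrite mulrC -{2}[z]powRr1 ?ltW// -powRD; last by rewrite (gt_eqF z0) implybT.
    by congr powR; ring.
  apply: (near_eq_is_derive _ (@is_derive1_powR R p z z0)).
  near=> w; rewrite gtr0_norm//; near: w; exact: lt_nbhsr.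
have [y0|y0|y0] := ltgtP y 0; last first.
- rewrite y0 mulr0 mulr0; apply/is_deriveP => e e0.
  exists (powR e (p - 1)^-1); first by rewrite powR_gt0.
  move=> h h0 he; rewrite normr0 powR0 ?gt_eqF// !subr0 add0r /GRing.scale /= mulr1.
  rewrite normrM normfV ger0_norm ?powR_ge0//.
  have np : 0 < `|h| by rewrite normr_gt0.
  have -> : `|h|^-1 * powR `|h| p = powR `|h| (p - 1).
    by rewrite powRB ?powRr1 ?(gt_eqF np) ?implybT// mulrC.
  have -> : e = powR (powR e (p - 1)^-1) (p - 1).
    by rewrite -powRrM mulVf ?powRr1 ?ltW// subr_eq0 gt_eqF.
  by apply: gt0_ltr_powR; rewrite ?subr_gt0 ?nnegrE ?powR_ge0.
- exact: pp.
- have ny : 0 < - y by rewrite oppr_gt0.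
  have h1 := pp _ ny; have h2 : is_derive y (1 : R) -%R (- 1 : R) by exact: is_deriveNid.
  have := is_derive1_comp h1 h2.
  rewrite (_ : _ \o _ = fun z => powR `|z| p); last first.
    by apply/funext => z /=; rewrite normrN.
  by move/is_derive_eq; apply; rewrite normrN !mulrN mulr1 opprK.
Unshelve. all: by end_near. Qed.

(** For p < 2 the factor |y|^(p-2) is unbounded near 0; written as |y|^(p-1) times the sign of y,
    the product is seen to tend to 0. *)
Lemma dpowR_cont (p : R) : 1 < p ->
  continuous (fun y : R => p * (powR `|y| (p - 2) * y)).
Proof.
move=> p1; apply: cont_mul; first exact: cont_cst.
have E (y : R) : powR `|y| (p - 2) * y = powR `|y| (p - 1) * Num.sg y.
  have [->|y0] := eqVneq y 0; first by rewrite sgr0 !mulr0.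
  have np : `|y| != 0 by rewrite normr_eq0.
  rewrite {2}[y]numEsg mulrCA [RHS]mulrC; congr (_ * _).
  rewrite -{2}[`|y|]powRr1// -powRD; last by rewrite np implybT.
  by congr powR; ring.
have p10 : 0 < p - 1 by rewrite subr_gt0.
have cq := continuous_powR_norm p10.
move=> y; have [->|y0] := eqVneq y 0.
  apply/cvgrPdist_lt => e e0; rewrite mulr0.
  have [||r r0 rP] := (continuousP_norm (fun y : R => powR `|y| (p - 1))).1 _ 0 e; [exact: cq|exact: e0|].
  exists r => // z /= /rP.
  rewrite normr0 powR0 ?gt_eqF// !sub0r !normrN E normrM [`|powR _ _|]ger0_norm ?powR_ge0//.
  by apply: le_lt_trans; rewrite ler_piMr ?powR_ge0// normr_sg; case: (z != 0).
apply: cvgM; last exact: cvg_id.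
have -> : (fun y : R => powR `|y| (p - 2)) = (fun y => powR `|y| (p - 2)) by [].
rewrite /=; apply: (@cvg_trans _ (expR ((p - 2) * ln `|z|) @[z --> y])).
  apply: near_eq_cvg; near=> z; rewrite /powR normr_eq0 ifF//.
  by apply/negbTE; near: z; apply: open_neq.
have -> : powR `|y| (p - 2) = expR ((p - 2) * ln `|y|) by rewrite /powR normr_eq0 (negbTE y0).
apply: (@continuous_comp _ _ _ (fun z => (p - 2) * ln `|z|) expR); last exact: continuous_expR.
apply: cvgM; first exact: cvg_cst.
apply: (@cvg_comp _ _ _ (fun z : R => `|z|) (@ln R) _ (nbhs `|y|)).
  exact: norm_continuous.
by apply: continuous_ln; rewrite normr_gt0.
Unshelve. all: by end_near. Qed.

End RealC1.

(** * The Dirichlet energy and the Poincare inequality *)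

Section Euclid.
Context {R : realType} {n : nat}.
Implicit Types x y : 'rV[R]_n.

Lemma eucl_ge0 x : 0 <= eucl x.
Proof. exact: sqrtr_ge0. Qed.

Lemma eucl_sqr x : eucl x ^+ 2 = \sum_i x ord0 i ^+ 2.
Proof. by rewrite sqr_sqrtr// sumr_ge0// => i _; rewrite sqr_ge0. Qed.

Lemma coord_le_eucl x i : `|x ord0 i| <= eucl x.
Proof.
rewrite -(@ler_pXn2r _ 2) ?nnegrE ?eucl_ge0// eucl_sqr real_normK ?num_real//.
by rewrite (bigD1 i)//= lerDl sumr_ge0// => j _; rewrite sqr_ge0.
Qed.

Lemma norm_le_eucl x : `|x| <= eucl x.
Proof. by apply: norm_le_coord; [exact: eucl_ge0|exact: coord_le_eucl]. Qed.

Lemma eucl_le_norm x : eucl x <= n%:R * `|x|.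
Proof.
have H : 0 <= n%:R * `|x| by rewrite mulr_ge0.
rewrite -(@ler_pXn2r _ 2) ?nnegrE ?eucl_ge0// eucl_sqr.
apply: (@le_trans _ _ (\sum_(i < n) `|x| ^+ 2)).
  apply: ler_sum => i _; rewrite -[leLHS]real_normK ?num_real//.
  by rewrite ler_pXn2r ?nnegrE//; exact: coord_le_norm.
rewrite sumr_const card_ord exprMn -[leLHS]mulr_natl ler_wpM2r ?sqr_ge0//.
by rewrite -natrX ler_nat; case: n => // k; rewrite expnS expn1 leq_pmulr.
Qed.

Lemma eucl_mulmx (A : 'M[R]_n) x : orthogonal_mx A -> eucl (x *m A) = eucl x.
Proof.
have E y : \sum_i y ord0 i ^+ 2 = (y *m y^T) ord0 ord0.
  by rewrite mxE; apply: eq_bigr => i _; rewrite mxE expr2.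
move=> oA; rewrite /eucl !E; congr (Num.sqrt (_ ord0 ord0)).
by rewrite trmx_mul mulmxA -[x *m A *m A^T]mulmxA oA mulmx1.
Qed.

Lemma orthogonal_mxV (A : 'M[R]_n) : orthogonal_mx A -> A^T *m A = 1%:M.
Proof. exact: mulmx1C. Qed.

Lemma eucl_cont : continuous (@eucl R n).
Proof.
by apply: cont_sqrt; apply: cont_sum => i; apply: cont_exp; exact: coord_cont.
Qed.

Lemma euclN x : eucl (- x) = eucl x.
Proof. by rewrite /eucl; congr Num.sqrt; apply: eq_bigr => i _; rewrite mxE sqrrN. Qed.

End Euclid.

(** * Invariance of the integral under orthogonal maps *)

Section OrthogonalInvariance.
Context {R : realType} {n : nat}.

Lemma Cc_shift (f : 'rV[R]_n -> R) a : Cc f -> Cc (fun x => f (x + a)).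
Proof.
move=> fc; have [K K0 fK] := Cc_supp fc; split.
  apply: (@cont_lipschitz R _ _ (fun x : 'rV[R]_n => x + a) 1); last exact: Cc_cont.
  by move=> x y; rewrite opprD addrACA subrr addr0 mul1r.
exists (K + `|a|) => x h; apply: fK; have := ler_normB (x + a) a; rewrite addrK.
by move: h; lra.
Qed.

(* The uniqueness argument for Haar measure: comparing with a radial [g],
   [(\int f) (\int g \o A) = \int \int f (x + y A) g (y A) = (\int f \o A) (\int g)]. *)
Lemma integral_orthogonal (A : 'M[R]_n) (f : 'rV[R]_n -> R) : orthogonal_mx A ->
  Cc f -> integral_RN (fun x => f (x *m A)) = integral_RN f.
Proof.
move=> oA fc; have [K K0 fK] := Cc_supp fc; have cf := Cc_cont fc.
pose g (x : 'rV[R]_n) := Num.max 0 (1 - eucl x).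
have HI := @posfun_integral R n.
have cg : continuous g.
  apply: cont_max; first exact: cont_cst.
  by apply: cont_sub; [exact: cont_cst|exact: eucl_cont].
have g1 x : 1 < `|x| -> g x = 0.
  move=> x1; rewrite /g max_l// subr_le0 ltW// (lt_le_trans x1)//.
  exact: norm_le_eucl.
have gc : Cc g by split => //; exists 1.
have gA x : g (x *m A) = g x by rewrite /g eucl_mulmx.
have gN x : g (- x) = g x by rewrite /g euclN.
have Ig0 : 0 < integral_RN g.
  apply: (@integral_gt0 _ _ _ 0) => //; first by move=> x; rewrite le_max lexx.
  rewrite /g lt_max; apply/orP; right; rewrite subr_gt0 /eucl big1 ?sqrtr0//.
  by move=> i _; rewrite mxE expr0n.
have nA (x : 'rV[R]_n) : `|x *m A| <= n%:R * `|x|.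
  by rewrite (le_trans (norm_le_eucl _))// eucl_mulmx// eucl_le_norm.
have nA' (x : 'rV[R]_n) : `|x| <= n%:R * `|x *m A|.
  by rewrite (le_trans (norm_le_eucl _))// -(eucl_mulmx _ oA) eucl_le_norm.
have n1A (x : 'rV[R]_n) : `|x *m A| <= 1 \/ g (x *m A) = 0.
  by case: (leP `|x *m A| 1) => h; [left|right; exact: g1].
pose L := K * (1 + n%:R) + 1 + n%:R.
have lip1 : forall z w : 'rV[R]_n * 'rV[R]_n,
    `|(z.1 + z.2 *m A) - (w.1 + w.2 *m A)| <= (1 + n%:R) * `|z - w|.
  move=> [x y] [x' y'] /=; rewrite opprD addrACA -mulmxBl.
  apply: le_trans (ler_normD _ _) _; rewrite prod_normE mulrDl mul1r; apply: lerD.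
    by rewrite le_max lexx.
  by apply: le_trans (nA _) _; rewrite ler_wpM2l// le_max lexx orbT.
have lip2 : forall z w : 'rV[R]_n * 'rV[R]_n,
    `|z.2 *m A - w.2 *m A| <= n%:R * `|z - w|.
  move=> [x y] [x' y'] /=; rewrite -mulmxBl prod_normE.
  by apply: le_trans (nA _) _; rewrite ler_wpM2l// le_max lexx orbT.
have lip3 : forall z w : 'rV[R]_n * 'rV[R]_n,
    `|(z.1 - z.2 *m A) - (w.1 - w.2 *m A)| <= (1 + n%:R) * `|z - w|.
  move=> [x y] [x' y'] /=.
  have -> : x - y *m A - (x' - y' *m A) = (x - x') - (y - y') *m A.
    by rewrite mulmxBl !opprB addrACA [RHS]addrACA [- x' - _]addrC.
  apply: le_trans (ler_normB _ _) _; rewrite prod_normE mulrDl mul1r; apply: lerD.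
    by rewrite le_max lexx.
  by apply: le_trans (nA _) _; rewrite ler_wpM2l// le_max lexx orbT.
have nn : 0 <= n%:R :> R by [].
have c1 : Cc (fun z : 'rV[R]_n * 'rV[R]_n => f (z.1 + z.2 *m A) * g (z.2 *m A)).
  split; first by apply: cont_mul; [exact: (cont_lipschitz lip1)|exact: (cont_lipschitz lip2)].
  exists L => -[x y]; rewrite prod_normE /= => h.
  have [h1|->] := n1A y; last by rewrite mulr0.
  have h2 : `|y| <= n%:R by rewrite (le_trans (nA' y))// ler_piMr.
  rewrite fK ?mul0r//; move: h; rewrite lt_max => /orP[|] h.
    have := ler_normB (x + y *m A) (y *m A); rewrite addrK.
    by move: h; rewrite /L; nra.
  by exfalso; move: h; rewrite /L; nra.
have c2 : Cc (fun z : 'rV[R]_n * 'rV[R]_n => f (z.2 *m A) * g (z.1 - z.2 *m A)).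
  split; first by apply: cont_mul; [exact: (cont_lipschitz lip2)|exact: (cont_lipschitz lip3)].
  exists L => -[x y]; rewrite prod_normE /= => h.
  have [h1|h1] := leP `|y *m A| K; last by rewrite fK// mul0r.
  have h2 : `|y| <= n%:R * K by rewrite (le_trans (nA' y))// ler_wpM2l.
  rewrite g1 ?mulr0//; move: h; rewrite lt_max => /orP[|] h.
    have := ler_normD (x - y *m A) (y *m A); rewrite subrK.
    by move: h; rewrite /L; nra.
  by exfalso; move: h; rewrite /L; nra.
have gAc : Cc (fun y => g (y *m A)) by under eq_fun do rewrite gA.
have fAc : Cc (fun y => f (y *m A)).
  split; first exact: (cont_lipschitz (@mulmx_lipschitz R n A)).
  exists (n%:R * K) => y h; apply: fK; rewrite ltNge; apply/negP => h'.
  by have := lt_le_trans h (le_trans (nA' y) (ler_wpM2l nn h')); rewrite ltxx.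
have e1 : integral_RN f * integral_RN (fun y => g (y *m A)) =
    integral_RN (fun y => integral_RN (fun x => f (x + y *m A) * g (y *m A))).
  rewrite -(posfunZ HI)//; congr integral_RN; apply/funext => y.
  by rewrite (posfunZr HI) ?integral_shift//; exact: Cc_shift.
have e2 : integral_RN (fun y => integral_RN (fun x => f (y *m A) * g (x - y *m A))) =
    integral_RN (fun y => f (y *m A)) * integral_RN g.
  rewrite -(posfunZr HI)//; congr integral_RN; apply/funext => y.
  by rewrite (posfunZ HI) ?integral_shift//; exact: Cc_shift.
have Igg : integral_RN (fun y => g (y *m A)) = integral_RN g.
  by congr integral_RN; apply/funext => y.
rewrite Igg in e1; apply: (mulIf (lt0r_neq0 Ig0)); rewrite e1 -e2.
have s1 := @integral_swap R n _ _ _ (@proper_rV R n) HI c1.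
have s2 := @integral_swap R n _ _ _ (@proper_rV R n) HI c2.
rewrite /= in s1 s2; rewrite -s1 -s2; congr integral_RN; apply/funext => x.
(* The shift of y by - x A^T replaces y A by y A - x, which turns the integrand into f (y A) g (y A
   - x); g is even. *)
rewrite -(@integral_shift R n (fun y => f (x + y *m A) * g (y *m A)) (- x *m A^T)); last first.
  exact: (Cc_slice x c1).
congr integral_RN; apply/funext => y.
have -> : (y + - x *m A^T) *m A = y *m A - x.
  by rewrite mulmxDl -mulmxA orthogonal_mxV// mulmx1.
by rewrite addrCA subrr addr0 -(gN (x - _)) opprB.
Qed.

End OrthogonalInvariance.

(** * Annulus functions, translation differences, Poincare inequality *)

Section C1c.
Context {R : realType} {N : nat}.
Implicit Types (f g u : 'rV[R]_N -> R).
Local Notation e_ := (@ebasis R N).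

Definition C1c f := C1 f /\ exists K : R, forall x, K < `|x| -> f x = 0.

Lemma C1c_grad f : C1c f -> has_grad f (pderiv f).
Proof. by case=> /C1_has_grad. Qed.

Lemma C1c_Cc f : C1c f -> Cc f.
Proof. by move=> h; split; [exact: has_grad_cont (C1c_grad h)|case: h]. Qed.

Lemma pderiv_eq0 f i x : (exists2 r : R, 0 < r & forall y, `|y - x| < r -> f y = 0) ->
  pderiv f i x = 0.
Proof.
move=> [r r0 rP]; have : is_derive x (e_ i) f 0; last by case.
apply/is_deriveP => e e0; exists r => // h h0 hr.
rewrite !rP ?subrr ?normr0// ?mulr0 ?subrr ?normr0//.
by rewrite addrC addKr norm_ebasis.
Qed.

Lemma C1c_pderiv f i : C1c f -> Cc (pderiv f i).
Proof.
move=> [[_ h] [K fK]]; split=> //; exists K => x Kx; apply: pderiv_eq0.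
exists (`|x| - K); first by rewrite subr_gt0.
move=> y h1; apply: fK; have := ler_normB y (y - x); rewrite opprB addrCA subrr addr0.
by move: h1; lra.
Qed.

Lemma C1c_grad_sq f : C1c f -> Cc (grad_sq f).
Proof. by move=> h; apply: Cc_sum => i; apply: Cc_exp => //; exact: C1c_pderiv. Qed.

Lemma annulus_C1 f : C1c_annulus f -> C1 f.
Proof. by case=> h1 [h2 _]. Qed.

Lemma annulus_supp f : C1c_annulus f -> forall x, eucl x <= 1 \/ 3 <= eucl x -> f x = 0.
Proof.
move=> [_ [_ [r1 [r2 [h1 h2 h3 H]]]]] x hx; apply: H.
by case: hx => hx; [left|right]; move: hx h1 h2 h3; lra.
Qed.

Lemma annulus_norm f : C1c_annulus f -> forall x, 3 < `|x| -> f x = 0.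
Proof.
move=> h x hx; apply: (annulus_supp h); right.
by have := norm_le_eucl x; move: hx; lra.
Qed.

Lemma annulus_C1c f : C1c_annulus f -> C1c f.
Proof. by move=> h; split; [exact: annulus_C1|exists 3; exact: annulus_norm]. Qed.

Lemma annulusMl f g : C1 g -> C1c_annulus f -> C1c_annulus (fun x => g x * f x).
Proof.
move=> /C1_has_grad hg hf; have := has_gradM hg (C1_has_grad (annulus_C1 hf)).
move=> /has_grad_C1[h1 h2]; split=> //; split=> //.
case: hf => _ [_ [r1 [r2 [a1 a2 a3 H]]]]; exists r1, r2; split=> // x /H->.
by rewrite mulr0.
Qed.

Lemma annulusZ (c : R) f : C1c_annulus f -> C1c_annulus (fun x => c * f x).
Proof. by apply: annulusMl; exact: has_grad_C1 (has_grad_cst N c). Qed.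

Lemma annulusD f g : C1c_annulus f -> C1c_annulus g -> C1c_annulus (fun x => f x + g x).
Proof.
move=> hf hg; have := has_gradD (C1_has_grad (annulus_C1 hf)) (C1_has_grad (annulus_C1 hg)).
move=> /has_grad_C1[h1 h2]; split=> //; split=> //.
case: hf hg => _ [_ [r1 [r2 [a1 a2 a3 H]]]] [_ [_ [s1 [s2 [b1 b2 b3 G]]]]].
exists (Num.min r1 s1), (Num.max r2 s2); split.
- by rewrite lt_min a1.
- by rewrite gt_min !lt_max a2.
- by rewrite gt_max a3.
- move=> x hx; rewrite H ?G ?addr0//.
    by case: hx; [rewrite le_min => /andP[_ h]; left|rewrite ge_max => /andP[_ h]; right].
  by case: hx; [rewrite le_min => /andP[h _]; left|rewrite ge_max => /andP[h _]; right].
Qed.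

Lemma annulusB f g : C1c_annulus f -> C1c_annulus g -> C1c_annulus (fun x => f x - g x).
Proof.
move=> hf hg; have := annulusD hf (annulusZ (-1) hg).
by under eq_fun do rewrite mulN1r.
Qed.

Lemma annulus_mulmx (A : 'M[R]_N) f : orthogonal_mx A -> C1c_annulus f ->
  C1c_annulus (fun x => f (x *m A)).
Proof.
move=> oA hf; have := has_grad_mulmx A (C1_has_grad (annulus_C1 hf)).
move=> /has_grad_C1[h1 h2]; split=> //; split=> //.
case: hf => _ [_ [r1 [r2 [a1 a2 a3 H]]]]; exists r1, r2; split=> // x hx.
by apply: H; rewrite eucl_mulmx.
Qed.

Lemma grad_sq_mulmx (A : 'M[R]_N) f x : orthogonal_mx A -> C1 f ->
  grad_sq (fun x => f (x *m A)) x = grad_sq f (x *m A).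
Proof.
move=> oA /C1_has_grad hf; rewrite /grad_sq (has_grad_pderiv (has_grad_mulmx A hf)).
pose v : 'rV[R]_N := \row_j pderiv f j (x *m A).
transitivity (eucl (v *m A^T) ^+ 2).
  rewrite eucl_sqr; apply: eq_bigr => i _; congr (_ ^+ 2); rewrite mxE.
  by apply: eq_bigr => j _; rewrite !mxE mulrC.
rewrite eucl_mulmx; first by rewrite eucl_sqr; apply: eq_bigr => i _; rewrite mxE.
by rewrite /orthogonal_mx trmxK orthogonal_mxV.
Qed.

Lemma pderivB f g i x : C1 f -> C1 g ->
  pderiv (fun x => f x - g x) i x = pderiv f i x - pderiv g i x.
Proof.
by move=> /C1_has_grad hf /C1_has_grad hg; rewrite (has_grad_pderiv (has_gradB hf hg)).
Qed.

Lemma pderivD f g i x : C1 f -> C1 g ->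
  pderiv (fun x => f x + g x) i x = pderiv f i x + pderiv g i x.
Proof.
by move=> /C1_has_grad hf /C1_has_grad hg; rewrite (has_grad_pderiv (has_gradD hf hg)).
Qed.

Lemma pderivZ (c : R) f i x : C1 f -> pderiv (fun x => c * f x) i x = c * pderiv f i x.
Proof. by move=> /C1_has_grad hf; rewrite (has_grad_pderiv (has_gradZ c hf)). Qed.

Lemma grad_sqZ (c : R) f x : C1 f -> grad_sq (fun x => c * f x) x = c ^+ 2 * grad_sq f x.
Proof.
move=> hf; rewrite /grad_sq mulr_sumr; apply: eq_bigr => i _.
by rewrite pderivZ// exprMn.
Qed.

Lemma grad_sq_ge0 f x : 0 <= grad_sq f x.
Proof. by apply: sumr_ge0 => i _; rewrite sqr_ge0. Qed.

Let HI := @posfun_integral R N.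

Definition energy f := integral_RN (grad_sq f).

Lemma energy_ge0 f : C1c f -> 0 <= energy f.
Proof.
by move=> /C1c_grad_sq h; apply: (posfun_ge0 HI) => // x; exact: grad_sq_ge0.
Qed.

Lemma pderiv_le_energy f i : C1c f -> integral_RN (fun x => pderiv f i x ^+ 2) <= energy f.
Proof.
move=> hf; apply: (posfun_le HI); [by apply: Cc_exp => //; exact: C1c_pderiv|exact: C1c_grad_sq|].
by move=> x; rewrite /grad_sq (bigD1 i)//= lerDl sumr_ge0// => j _; rewrite sqr_ge0.
Qed.

(** The squared L^2 modulus of continuity, which yields both the Poincare inequality and the
    mollification error in the compactness theorem. *)
Definition sqdiff u (z : 'rV[R]_N) := integral_RN (fun x => (u (x + z) - u x) ^+ 2).

Lemma Cc_sqdiff u z : Cc u -> Cc (fun x => (u (x + z) - u x) ^+ 2).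
Proof. by move=> uc; apply: Cc_exp => //; apply: CcB => //; exact: Cc_shift. Qed.

(** Young's inequality with a free weight e stands in for Minkowski's; a suitable e recovers the
    sharp constant. *)
Lemma sqdiffD u z w (e : R) : 0 < e -> Cc u ->
  sqdiff u (z + w) <= (1 + e) * sqdiff u z + (1 + e^-1) * sqdiff u w.
Proof.
move=> e0 uc.
have -> : sqdiff u z = integral_RN (fun x => (u (x + w + z) - u (x + w)) ^+ 2).
  exact: esym (integral_shift w (Cc_sqdiff z uc)).
rewrite /sqdiff.
rewrite -!(posfunZ HI); [|exact: Cc_sqdiff|apply: (@Cc_shift _ _ (fun x => (u (x + z) - u x) ^+ 2)); exact: Cc_sqdiff].
rewrite -(posfunD HI); last first.
- by apply: CcZ; exact: Cc_sqdiff.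
- by apply: CcZ; apply: (@Cc_shift _ _ (fun x => (u (x + z) - u x) ^+ 2)); exact: Cc_sqdiff.
apply: (posfun_le HI).
- exact: Cc_sqdiff.
- apply: CcD; apply: CcZ; last exact: Cc_sqdiff.
  by apply: (@Cc_shift _ _ (fun x => (u (x + z) - u x) ^+ 2)); exact: Cc_sqdiff.
- move=> x; rewrite -addrA [w + z]addrC.
  set a := u (x + (z + w)); set b := u (x + w); set c := u x.
  have ei : e * e^-1 = 1 by rewrite divff// gt_eqF.
  rewrite -subr_ge0; set k := e^-1 in ei *.
  have -> : (1 + e) * (a - b) ^+ 2 + (1 + k) * (b - c) ^+ 2 - (a - c) ^+ 2 =
      e^-1 * (e * (a - b) - (b - c)) ^+ 2.
    by rewrite -/k; have -> : k = e^-1 by []; field; rewrite gt_eqF.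
  by rewrite mulr_ge0 ?sqr_ge0// invr_ge0 ltW.
Qed.

Lemma sqdiff_ge0 u z : Cc u -> 0 <= sqdiff u z.
Proof. by move=> uc; apply: (posfun_ge0 HI); [exact: Cc_sqdiff|move=> x; rewrite sqr_ge0]. Qed.

(** With m = k + 1 and weight 1/m, the induction step is the identity (1 + 1/m) m^2 + (1 + m) = (m +
    1)^2. *)
Lemma sqdiff_mul u z k : Cc u -> sqdiff u (k.+1%:R *: z) <= k.+1%:R ^+ 2 * sqdiff u z.
Proof.
move=> uc; elim: k => [|k ih]; first by rewrite scale1r expr1n mul1r.
have k0 : 0 < k.+1%:R :> R by rewrite ltr0n.
have -> : k.+2%:R *: z = k.+1%:R *: z + z by rewrite -[k.+2%:R]natr1 scalerDl scale1r.
have ki : 0 < (k.+1%:R : R)^-1 by rewrite invr_gt0.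
apply: le_trans (sqdiffD (k.+1%:R *: z) z ki uc) _; rewrite invrK.
have := sqdiff_ge0 z uc; set d := sqdiff u z in ih *; set D := sqdiff u _ in ih *.
rewrite -[k.+2%:R]natr1; set m := k.+1%:R in k0 ki ih * => d0.
have h : (1 + m^-1) * D <= (1 + m^-1) * (m ^+ 2 * d) by rewrite ler_wpM2l// addr_ge0// ltW.
apply: le_trans (lerD h (lexx _)) _; rewrite le_eqVlt; apply/orP; left; apply/eqP.
by field; rewrite gt_eqF.
Qed.

(** For short steps the mean value theorem and uniform continuity of the derivative give the bound
    up to an error eta. A step t is a sum of k short ones, and the factor k^2 of [sqdiff_mul]
    cancels the square of t/k, so eta can be sent to 0. *)
Lemma sqdiff_ebasis u i t : C1c u ->
  sqdiff u (t *: e_ i) <= t ^+ 2 * integral_RN (fun x => pderiv u i x ^+ 2).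
Proof.
move=> hu; have uc := C1c_Cc hu; have gc := C1c_pderiv i hu.
have [K K0 uK] := Cc_supp uc.
set G := integral_RN _; pose V := integral_RN (plateau (K + 1) : 'rV[R]_N -> R).
have V0 : 0 <= V by apply: (posfun_ge0 HI); [exact: Cc_plateau|exact: plateau_ge0].
have G0 : 0 <= G by apply: (posfun_ge0 HI); [exact: Cc_exp|move=> x; rewrite sqr_ge0].
have small (eta : R) : 0 < eta -> exists2 d : R, 0 < d & forall h, `|h| < d ->
    sqdiff u (h *: e_ i) <= h ^+ 2 * ((1 + eta) * G + (eta + eta ^+ 2) * V).
  move=> eta0; have [d d0 dP] := Cc_unif (@proper_rV R N) gc eta0.
  exists (Num.min d 1); first by rewrite lt_min d0 ltr01.
  move=> h; rewrite lt_min => /andP[hd h1].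
  have c1 : Cc (fun x => (1 + eta) * pderiv u i x ^+ 2) by apply: CcZ; exact: Cc_exp.
  have c2 : Cc (fun x : 'rV[R]_N => (eta + eta ^+ 2) * plateau (K + 1) x).
    by apply: CcZ; exact: Cc_plateau.
  rewrite -!(posfunZ HI) -?(posfunD HI)//; try exact: Cc_exp; try exact: Cc_plateau.
  rewrite -(posfunZ HI); last exact: CcD.
  apply: (posfun_le HI); [exact: Cc_sqdiff|by apply: CcZ; exact: CcD|move=> x].
  have [xK|Kx] := leP `|x| (K + 1); last first.
    rewrite !uK; last 2 first.
    - by move: Kx; lra.
    - have := ler_normB (x + h *: e_ i) (h *: e_ i); rewrite addrK norm_ebasis.
      by move: Kx h1; lra.
    rewrite subrr expr0n /= mulr_ge0 ?sqr_ge0// addr_ge0// mulr_ge0 ?sqr_ge0 ?plateau_ge0//.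
    - by rewrite addr_ge0// ltW.
    - by rewrite addr_ge0 ?sqr_ge0// ltW.
  rewrite plateau1// mulr1.
  have [s sh ->] := has_grad_MVT i x h (C1c_grad hu).
  rewrite exprMn; apply: ler_wpM2l; first exact: sqr_ge0.
  have : `|pderiv u i x - pderiv u i (x + s *: e_ i)| < eta.
    apply: dP; rewrite opprD addrA subrr add0r normrN norm_ebasis.
    exact: le_lt_trans hd.
  set a := pderiv u i x; set b := pderiv u i _; rewrite ltr_norml => /andP[b1 b2].
  set D := a - b in b1 b2.
  have -> : b = a - D by rewrite /D opprB addrCA subrr addr0.
  (* Since |D| < eta, (a - D)^2 <= a^2 + 2 eta |a| + eta^2 <= (1 + eta) a^2 + eta + eta^2; the sign
     of a decides which bound on D enters. *)
  have d1 : 0 <= (eta - D) * (eta + D) by apply: mulr_ge0; lra.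
  have d2 : 0 <= eta * (a - 1) ^+ 2 by rewrite mulr_ge0 ?sqr_ge0// ltW.
  have d3 : 0 <= eta * (a + 1) ^+ 2 by rewrite mulr_ge0 ?sqr_ge0// ltW.
  have [a0|a0] := leP 0 a.
    have d4 : 0 <= a * (eta + D) by apply: mulr_ge0; lra.
    nra.
  have d4 : 0 <= (- a) * (eta - D) by apply: mulr_ge0; lra.
  nra.
have any (eta : R) : 0 < eta ->
    sqdiff u (t *: e_ i) <= t ^+ 2 * ((1 + eta) * G + (eta + eta ^+ 2) * V).
  move=> /small[d d0 dP].
  pose k := Num.bound (`|t| / d).
  have kt : `|t| / d < k.+1%:R.
    apply: lt_trans (archi_boundP _) _; first by rewrite divr_ge0// ltW.
    by rewrite ltr_nat.
  have k0 : 0 < k.+1%:R :> R by rewrite ltr0n.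
  have -> : t *: e_ i = k.+1%:R *: ((t / k.+1%:R) *: e_ i).
    by rewrite scalerA mulrCA divff ?mulr1// gt_eqF.
  apply: le_trans (sqdiff_mul _ _ uc) _.
  have := dP (t / k.+1%:R); rewrite normrM normfV (gtr0_norm k0) ltr_pdivrMr//.
  rewrite mulrC -ltr_pdivrMr// => /(_ kt) h.
  apply: le_trans (ler_wpM2l (sqr_ge0 _) h) _.
  by rewrite mulrA -exprMn mulrCA divff ?mulr1// gt_eqF.
apply/ler_addgt0Pr => e e0.
pose B := t ^+ 2 * (G + 2 * V) + 1.
have B1 : 0 <= t ^+ 2 * (G + 2 * V).
  by rewrite mulr_ge0 ?sqr_ge0// addr_ge0// mulr_ge0.
have B0 : 0 < B by rewrite /B ltr_wpDl.
pose eta := Num.min 1 (e / B).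
have eta0 : 0 < eta by rewrite lt_min ltr01 divr_gt0.
have eta1 : eta <= 1 by rewrite ge_min lexx.
have etaB : eta * B <= e by rewrite -ler_pdivlMr// ge_min lexx orbT.
apply: le_trans (any _ eta0) _.
have h : eta ^+ 2 <= eta by rewrite expr2 ger_pMl.
apply: (@le_trans _ _ (t ^+ 2 * G + eta * (t ^+ 2 * (G + 2 * V)))).
  have -> : t ^+ 2 * G + eta * (t ^+ 2 * (G + 2 * V)) =
    t ^+ 2 * ((1 + eta) * G + (eta + eta) * V) by ring.
  by rewrite ler_wpM2l ?sqr_ge0// lerD2l ler_wpM2r// lerD2l.
rewrite lerD2l; apply: le_trans etaB; rewrite ler_wpM2l ?(ltW eta0)//.
by rewrite /B lerDl.
Qed.

(** Coordinates are added one at a time with weight 1 in Young's inequality, so the constant evolves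
    by 2 * 4^k + 2 <= 4^(k+1). *)
Lemma sqdiff_le u z : C1c u -> sqdiff u z <= (4 ^ N)%:R * `|z| ^+ 2 * energy u.
Proof.
move=> hu; have uc := C1c_Cc hu; have E0 := energy_ge0 hu.
pose w k : 'rV[R]_N := \row_i (if (i < k)%N then z ord0 i else 0).
have w0 : w 0%N = 0 by apply/rowP => i; rewrite !mxE.
have wN : w N = z by apply/rowP => i; rewrite !mxE ltn_ord.
have wS (k : 'I_N) : w k.+1 = w k + z ord0 k *: e_ k.
  apply/rowP => i; rewrite !mxE eqxx /= ltnS leq_eqVlt.
  have [->|ik] := eqVneq i k; first by rewrite eqxx ltnn mulr1 add0r.
  by rewrite (negbTE (ik : (i : nat) != k)) mulr0 addr0.
have zE : 0 <= `|z| ^+ 2 * energy u by rewrite mulr_ge0 ?sqr_ge0.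
suff H k : (k <= N)%N -> sqdiff u (w k) <= (4 ^ k)%:R * (`|z| ^+ 2 * energy u).
  by rewrite -mulrA -{1}wN; exact: H.
elim: k => [_|k ih kN].
  rewrite w0 expn0 mul1r; apply: le_trans zE.
  rewrite /sqdiff (_ : (fun x => _) = fun=> 0) ?(posfun0 HI)//.
  by apply/funext => x; rewrite addr0 subrr expr0n.
rewrite (wS (Ordinal kN)); apply: le_trans (sqdiffD _ _ ltr01 uc) _ => /=.
rewrite invr1 expnS natrM.
have h1 := ih (ltnW kN).
have h2 : sqdiff u (z ord0 (Ordinal kN) *: e_ (Ordinal kN)) <= `|z| ^+ 2 * energy u.
  apply: le_trans (sqdiff_ebasis _ _ hu) _; apply: ler_pM; rewrite ?sqr_ge0//.
  - by apply: (posfun_ge0 HI) => [|x]; rewrite ?sqr_ge0//; apply: Cc_exp => //; exact: C1c_pderiv.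
  - rewrite -[leLHS]real_normK ?num_real// ler_pXn2r ?nnegrE//; exact: coord_le_norm.
  - exact: pderiv_le_energy.
have h3 : `|z| ^+ 2 * energy u <= (4 ^ k)%:R * (`|z| ^+ 2 * energy u).
  by rewrite ler_peMl// ler1n expn_gt0.
by rewrite -mulrA; set c := (4 ^ k)%:R * _ in h1 h3 *; lra.
Qed.

(** A translation by 2 K + 1 along one axis makes the supports of u and its translate disjoint, so
    the translation difference is twice the integral of u^2. *)
Lemma poincare u (K : R) (i : 'I_N) : C1c u -> 0 < K -> (forall x, K < `|x| -> u x = 0) ->
  integral_RN (fun x => u x ^+ 2) <= (2 * K + 1) ^+ 2 * energy u.
Proof.
move=> hu K0 uK; have uc := C1c_Cc hu; pose t := 2 * K + 1.
have u2c : Cc (fun x => u x ^+ 2) by exact: Cc_exp.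
have u2c' : Cc (fun x => u (x + t *: e_ i) ^+ 2) by exact: (Cc_shift (t *: e_ i) u2c).
have U0 : 0 <= integral_RN (fun x => u x ^+ 2).
  by apply: (posfun_ge0 HI) => // x; rewrite sqr_ge0.
have e1 : sqdiff u (t *: e_ i) = integral_RN (fun x => u x ^+ 2) + integral_RN (fun x => u x ^+ 2).
  rewrite -{1}(integral_shift (t *: e_ i) u2c) -(posfunD HI)//.
  congr integral_RN; apply/funext => x.
  have [xK|Kx] := leP `|x| K; last by rewrite [u x]uK// subr0 expr0n addr0.
  rewrite [u (x + _)]uK; first by rewrite sub0r sqrrN expr0n add0r.
  have := ler_normB (x + t *: e_ i) x; rewrite addrC addKr norm_ebasis /t.
  rewrite gtr0_norm; last by lra.
  by move: xK; lra.
have := sqdiff_ebasis i t hu; rewrite e1 => h.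
have h2 : t ^+ 2 * integral_RN (fun x => pderiv u i x ^+ 2) <= t ^+ 2 * energy u.
  by apply: ler_wpM2l; [exact: sqr_ge0|exact: pderiv_le_energy].
by rewrite -/t; lra.
Qed.

End C1c.

(** * Inequalities for real powers *)

Section RealPowers.
Context {R : realType}.

Lemma weighted_amgm (a b t : R) : 0 < t -> t < 1 -> 0 <= a -> 0 <= b ->
  powR a (1 - t) * powR b t <= (1 - t) * a + t * b.
Proof.
move=> t0 t1 a0 b0; have t1' : 0 < 1 - t by rewrite subr_gt0.
have := @conjugate_powR R (powR a (1 - t)) (powR b t) (1 - t)^-1 t^-1
  (powR_ge0 _ _) (powR_ge0 _ _).
rewrite !invr_gt0 !invrK subrK -!powRrM !divff ?gt_eqF// !powRr1// [_ * (1 - t)]mulrC.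
by rewrite [b * t]mulrC; apply.
Qed.

(** Weighted arithmetic-geometric mean applied to 1 and y^q with weight 1/q on the latter. *)
Lemma bernoulli (y q : R) : 1 < q -> 0 <= y -> 1 + q * (y - 1) <= powR y q.
Proof.
move=> q1 y0; have q0 : 0 < q by exact: lt_trans q1.
have qi0 : 0 < q^-1 by rewrite invr_gt0.
have qi1 : q^-1 < 1 by rewrite invf_lt1.
have := @weighted_amgm 1 (powR y q) q^-1 qi0 qi1 ler01 (powR_ge0 _ _).
rewrite powR1 mul1r -powRrM divff ?gt_eqF// powRr1// mulr1 => h.
have := ler_wpM2l (ltW q0) h; rewrite mulrDr mulrBr mulr1 mulrA divff ?gt_eqF// mul1r.
by lra.
Qed.

(** Convexity of the power: the tangent inequality is applied to 2 x and 2 y, whose linear terms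
    cancel. *)
Lemma powR_sum_ge (x y q : R) : 1 < q -> 0 <= x -> 0 <= y -> x + y = 1 ->
  powR 2 (1 - q) <= powR x q + powR y q.
Proof.
move=> q1 x0 y0 xy.
have h1 := @bernoulli (2 * x) q q1; have h2 := @bernoulli (2 * y) q q1.
have {}h1 := h1 (mulr_ge0 (ler0n R 2) x0); have {}h2 := h2 (mulr_ge0 (ler0n R 2) y0).
rewrite !powRM// in h1 h2.
have p2 : 0 < powR 2 q :> R by rewrite powR_gt0.
rewrite powRB ?pnatr_eq0 ?implybT// powRr1// ler_pdivrMr// mulrC mulrDr.
have : 2 * x + 2 * y = 2 by rewrite -mulrDr xy mulr1.
by move: h1 h2; set u := 2 * x; set v := 2 * y; nra.
Qed.

(** Let (1 + t)^p = 1 + e. Either |a - b| <= t |b| and the first term suffices, or |b| < |a - b| / t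
    and the second does. *)
Lemma powR_perturb (p e : R) : 0 < p -> 0 < e -> exists2 C : R, 0 < C &
  forall a b : R, powR `|a| p <= (1 + e) * powR `|b| p + C * powR `|a - b| p.
Proof.
move=> p0 e0; pose k := powR (1 + e) p^-1.
have e1 : 1 < 1 + e by rewrite ltrDl.
have kp : powR k p = 1 + e.
  by rewrite /k -powRrM mulVf ?gt_eqF// powRr1// addr_ge0// ltW.
have k1 : 1 < k.
  rewrite ltNge; apply/negP => k1; have : powR k p <= powR 1 p.
    by apply: ge0_ler_powR; rewrite ?nnegrE ?powR_ge0// ltW.
  by rewrite kp powR1; move: e1; lra.
pose t := k - 1; have t0 : 0 < t by rewrite subr_gt0.
exists (powR (1 + t^-1) p).
  by rewrite powR_gt0// addr_gt0// invr_gt0.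
move=> a b; have ab : `|a| <= `|b| + `|a - b|.
  by rewrite -{1}(subrK b a) addrC; exact: ler_normD.
have [h|h] := leP `|a - b| (t * `|b|).
  apply: (@le_trans _ _ ((1 + e) * powR `|b| p)); last first.
    by rewrite lerDl mulr_ge0 ?powR_ge0.
  rewrite -kp -powRM ?(ltW (lt_trans ltr01 k1))//; apply: ge0_ler_powR; rewrite ?nnegrE ?(ltW p0)//.
    by rewrite mulr_ge0// (ltW (lt_trans ltr01 k1)).
  by apply: (le_trans ab); move: h; rewrite /t; lra.
apply: (@le_trans _ _ (powR (1 + t^-1) p * powR `|a - b| p)); last first.
  by rewrite lerDr mulr_ge0 ?powR_ge0// addr_ge0// ltW.
have ti : 0 < 1 + t^-1 by rewrite addr_gt0// invr_gt0.
rewrite -powRM ?(ltW ti)//; apply: ge0_ler_powR; rewrite ?nnegrE ?(ltW p0)//.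
  by rewrite mulr_ge0// ltW.
apply: (le_trans ab); rewrite mulrDl mul1r addrC lerD2l.
by rewrite mulrC ler_pdivlMr// mulrC ltW.
Qed.

(** A strict inequality at the critical exponent is turned by continuity into one for all p slightly
    below it. *)
Lemma near_left (phi : R -> R) (s c : R) : {for s, continuous phi} -> phi s < c ->
  exists2 p1, p1 < s & forall p, p1 < p -> p < s -> phi p < c.
Proof.
move=> /cvgrPdist_lt H hc; have d0 : 0 < c - phi s by rewrite subr_gt0.
have /nbhs_ballP[r r0 rP] := H _ d0.
exists (s - r); first by rewrite gtrDl oppr_lt0.
move=> p p1 p2; have := rP p; rewrite -ball_normE /= => /(_ _)h.
have : `|phi s - phi p| < c - phi s by apply: h; rewrite ltr_norml; lra.
by rewrite ltr_norml; lra.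
Qed.

Lemma cont_powR_exp (x s : R) (g : R -> R) : 0 < x -> {for s, continuous g} ->
  {for s, continuous (fun p => powR x (g p))}.
Proof.
move=> x0 cg.
have -> : (fun p => powR x (g p)) = (fun p => expR (g p * ln x)).
  by apply/funext => p; rewrite /powR gt_eqF.
apply: (@continuous_comp _ _ _ (fun p => g p * ln x) expR); last exact: continuous_expR.
by apply: cvgM => //; exact: cvg_cst.
Qed.

Lemma cvg_div2 (s : R) : s != 0 -> {for s, continuous (fun p : R => 2 / p)}.
Proof. by move=> s0; apply: cvgM; [exact: cvg_cst|apply: cvgV => //; exact: cvg_id]. Qed.

Lemma powR_le_exp (a x y : R) : 0 <= a -> a <= 1 -> 0 < x -> x <= y -> powR a y <= powR a x.
Proof.
rewrite le_eqVlt => /orP[/eqP<- _ x0 xy|a0 a1 x0 xy].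
  by rewrite !powR0 ?gt_eqF// (lt_le_trans x0 xy).
by apply: ger_powR; rewrite ?a0.
Qed.

End RealPowers.

#[local] Opaque integral_RN powR pderiv int1.

(** * The Sobolev inequality *)

Section Sobolev.
Context {R : realType}.

Lemma Cc_flip (T U : normedModType R) (f : T * U -> R) : Cc f ->
  Cc (fun z : U * T => f (z.2, z.1)).
Proof.
move=> [cf [K fK]]; split; last first.
  by exists K => -[x y]; rewrite prod_normE /= => h; apply: fK; rewrite prod_normE /= maxC.
apply: (@cont_lipschitz R _ _ (fun z : U * T => (z.2, z.1)) 1) => // -[x y] [x' y'].
by rewrite mul1r !prod_normE /= maxC.
Qed.

Lemma Cc_line n (F : 'rV[R]_n -> R) x i : Cc F -> Cc (fun t : R => F (x + t *: ebasis R i)).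
Proof.
move=> Fc; have [K K0 FK] := Cc_supp Fc; split.
  apply: (@cont_lipschitz R _ _ (fun t : R => x + t *: ebasis R i) 1); last exact: Cc_cont.
  by move=> s t; rewrite opprD addrACA subrr add0r -scalerBl norm_ebasis mul1r.
exists (K + `|x|) => t h; apply: FK.
have := ler_normB (x + t *: ebasis R i) x; rewrite addrC addKr norm_ebasis.
by move: h; lra.
Qed.

Lemma Cc_powR_ge0 (T : normedModType R) (f : T -> R) p : 0 < p -> Cc f ->
  (forall x, 0 <= f x) -> Cc (fun x => powR (f x) p).
Proof.
by move=> p0 fc f0; have := Cc_powR p0 fc; under eq_fun do rewrite ger0_norm//.
Qed.

Lemma rsnoc_line n (x : 'rV[R]_n) t s j :
  rsnoc x t + s *: ebasis R (lift ord_max j) = rsnoc (x + s *: ebasis R j) t.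
Proof.
apply/rowP => i; rewrite !mxE eqxx /=; case: (unliftP ord_max i) => [k|] -> /=.
  by rewrite !mxE (inj_eq lift_inj).
by rewrite (negbTE (neq_lift _ _)) mulr0 addr0.
Qed.

Lemma rsnoc_line_max n (x : 'rV[R]_n) t s :
  rsnoc x t + s *: ebasis R ord_max = rsnoc x (t + s).
Proof.
apply/rowP => i; rewrite !mxE eqxx /=; case: (unliftP ord_max i) => [k|] -> /=.
  by rewrite eq_sym (negbTE (neq_lift _ _)) mulr0 addr0.
by rewrite eqxx mulr1.
Qed.

Lemma int1_shift (f : R -> R) a : Cc f -> int1 (fun t => f (a + t)) = int1 f.
Proof.
move=> fc; have := int1_affine a ltr01 fc; rewrite invr1 mul1r => <-.
by congr int1; apply/funext => t; rewrite mul1r addrC.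
Qed.

(** The bound by a line integral in the last direction does not depend on the height t, so it can be
    integrated over the other coordinates. *)
Lemma slice_le n (F G : 'rV[R]_n.+1 -> R) t : Cc F -> Cc G ->
  (forall x, F x <= int1 (fun s => G (x + s *: ebasis R ord_max))) ->
  integral_RN (fun x => F (rsnoc x t)) <= integral_RN G.
Proof.
move=> Fc Gc FG.
have c2 := Cc_flip (Cc_rsnoc Gc).
have pR := @proper_R R.
have E := @integral_swap R n _ _ _ pR posfun_int1 c2.
rewrite integral_RNS -E; apply: (posfun_le (posfun_integral n)).
- exact: Cc_slice_rsnoc.
- exact: (Cc_posfun (@proper_rV R n) pR posfun_int1 c2).
- move=> x; apply: le_trans (FG _) _ => /=.
  under eq_fun do rewrite rsnoc_line_max.
  by rewrite (@int1_shift (fun s => G (rsnoc x s)))//; exact: (Cc_slice x c2).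
Qed.

(* Induction on the dimension: on each slice interpolate between the bound
   by [\int G_last] in L^1 and the induction hypothesis. *)
Lemma gagliardo_nirenberg m (F : 'rV[R]_m.+2 -> R) (G : 'I_m.+2 -> 'rV[R]_m.+2 -> R) :
  Cc F -> (forall i, Cc (G i)) -> (forall x, 0 <= F x) -> (forall i x, 0 <= G i x) ->
  (forall i x, F x <= int1 (fun s => G i (x + s *: ebasis R i))) ->
  integral_RN (fun x => powR (F x) (m.+2%:R / m.+1%:R)) <=
  powR (\sum_i integral_RN (G i)) (m.+2%:R / m.+1%:R).
Proof.
elim: m F G => [|m ih] F G Fc Gc F0 G0 FG.
  pose a := integral_RN (G ord_max).
  pose g t := integral_RN (fun x => G (lift ord_max ord0) (rsnoc x t)).
  have HI := @posfun_integral R 1.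
  have a0 : 0 <= a by apply: (posfun_ge0 (posfun_integral _)).
  have g0 t : 0 <= g t.
    by apply: (posfun_ge0 HI) => //; exact: Cc_slice_rsnoc.
  have gc : Cc g by exact: Cc_integral_rsnoc.
  have e2 y : 0 <= y -> powR y (2%:R / 1%:R) = y ^+ 2 :> R.
    by move=> y0; rewrite divr1 powR_mulrn.
  have -> : (fun x => powR (F x) (2%:R / 1%:R)) = (fun x => F x ^+ 2).
    by apply/funext => x; rewrite e2.
  rewrite e2; last by apply: sumr_ge0 => i _; exact: (posfun_ge0 (posfun_integral _)).
  rewrite integral_RNS big_ord_recr big_ord1 /=.
  have -> : widen_ord (leqnSn 1) ord0 = lift ord_max ord0 by apply: val_inj.
  rewrite -/a; set b := integral_RN (G (lift _ _)).
  have bE : b = int1 g by rewrite /b integral_RNS.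
  have b0 : 0 <= b by apply: (posfun_ge0 (posfun_integral _)).
  (* In the plane the line integral along the first coordinate at height t is g t. With the slice
     bound a this gives int F^2 <= a * int g = a b <= (a + b)^2. *)
  have sup x t : F (rsnoc x t) <= g t.
    apply: le_trans (FG (lift ord_max ord0) _) _.
    under eq_fun do rewrite rsnoc_line.
    rewrite /g integral_RNS.
    have Gs : Cc (fun y : 'rV[R]_1 => G (lift ord_max ord0) (rsnoc y t)).
      exact: Cc_slice_rsnoc.
    have h : Cc (fun s : R => G (lift ord_max ord0) (rsnoc (rsnoc (0 : 'rV[R]_0) s) t)).
      exact: (Cc_slice2 0 (Cc_rsnoc Gs)).
    under [X in _ <= int1 X]eq_fun do rewrite integral_RN0.
    rewrite -(@int1_shift _ (x ord0 ord_max) h) le_eqVlt; apply/orP; left; apply/eqP.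
    congr int1; apply/funext => s; congr (G _ (rsnoc _ _)).
    apply/rowP => i; have -> : i = ord_max by apply: val_inj; case: i => -[].
    have eo : (ord_max == ord0 :> 'I_1) by [].
    by rewrite rsnoc_max !mxE eqxx eo mulr1.
  have st t : integral_RN (fun x => F (rsnoc x t) ^+ 2) <= a * g t.
    have h1 := slice_le t Fc (Gc ord_max) (FG ord_max).
    have Fs : Cc (fun x => F (rsnoc x t)) by exact: Cc_slice_rsnoc.
    apply: (@le_trans _ _ (integral_RN (fun x => g t * F (rsnoc x t)))).
      apply: (posfun_le HI); [exact: Cc_exp|exact: CcZ|move=> x].
      by rewrite expr2 ler_wpM2r.
    by rewrite (posfunZ HI)// mulrC ler_wpM2r.
  apply: (@le_trans _ _ (a * b)).
    rewrite bE -(posfunZ posfun_int1)//; apply: (posfun_le posfun_int1) => //.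
    - by apply: (@Cc_integral_rsnoc _ _ (fun x => F x ^+ 2)); exact: Cc_exp.
    - exact: CcZ.
  by rewrite sqrrD; nra.
have n0 : 0 < m.+2%:R :> R by rewrite ltr0n.
have n1 : 0 < m.+1%:R :> R by rewrite ltr0n.
have n3 : 0 < m.+3%:R :> R by rewrite ltr0n.
(* q is the exponent of the induction hypothesis and q (1 - l) = 1, so F^(1+l) = (F^q)^(1-l) F^l;
   moreover 1 + l is the exponent of the new dimension. *)
pose q : R := m.+2%:R / m.+1%:R; pose l : R := m.+2%:R^-1.
have q0 : 0 < q by rewrite divr_gt0.
have l0 : 0 < l by rewrite invr_gt0.
have l1 : l < 1 by rewrite invf_lt1// ltr1n.
have ql : q * (1 - l) = 1.
  rewrite /q /l; have -> : m.+2%:R = m.+1%:R + 1 :> R by rewrite natr1.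
  by field; rewrite !gt_eqF// natr1.
have ql2 : m.+3%:R / m.+2%:R = 1 + l.
  by rewrite /l -[m.+3%:R]natr1 mulrDl divff ?gt_eqF// mul1r.
rewrite ql2.
pose a := integral_RN (G ord_max).
pose H t := \sum_(i < m.+2) integral_RN (fun x => G (lift ord_max i) (rsnoc x t)).
have HI := @posfun_integral R m.+2.
have a0 : 0 <= a by apply: (posfun_ge0 (posfun_integral _)).
have H0 t : 0 <= H t.
  apply: sumr_ge0 => i _; apply: (posfun_ge0 HI) => //; exact: Cc_slice_rsnoc.
have Hc : Cc H by apply: Cc_sum => i; exact: Cc_integral_rsnoc.
have IG : \sum_i integral_RN (G i) = int1 H + a.
  rewrite big_ord_recr /= -/a; congr (_ + _).
  rewrite (posfun_sum posfun_int1); last by move=> i; exact: Cc_integral_rsnoc.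
  apply: eq_bigr => i _; rewrite integral_RNS.
  by have -> : widen_ord (leqnSn m.+2) i = lift ord_max i by apply: val_inj; rewrite /= /bump leqNgt ltn_ord.
have st t : integral_RN (fun x => powR (F (rsnoc x t)) (1 + l)) <= powR a l * H t.
  have Fs : Cc (fun x => F (rsnoc x t)) by exact: Cc_slice_rsnoc.
  have h1 : integral_RN (fun x => F (rsnoc x t)) <= a := slice_le t Fc (Gc ord_max) (FG ord_max).
  have h2 : integral_RN (fun x => powR (F (rsnoc x t)) q) <= powR (H t) q.
    apply: ih => //; first by move=> i; exact: Cc_slice_rsnoc.
    by move=> i x; apply: le_trans (FG (lift ord_max i) _) _; under eq_fun do rewrite rsnoc_line.
  have Fq := Cc_powR_ge0 q0 Fs (fun x => F0 (rsnoc x t)).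
  have := posfun_hoelder HI l0 l1 Fq Fs (fun x => powR_ge0 _ _) (fun x => F0 _).
  have -> : (fun x => powR (powR (F (rsnoc x t)) q) (1 - l) * powR (F (rsnoc x t)) l) =
     (fun x => powR (F (rsnoc x t)) (1 + l)).
    apply/funext => x; rewrite -powRrM ql -powRD//.
    by apply/implyP => /eqP h; exfalso; move: h l0; lra.
  move=> hh; apply: (le_trans hh); rewrite [leLHS]mulrC; apply: ler_pM; [exact: powR_ge0|exact: powR_ge0| |].
    apply: ge0_ler_powR; rewrite ?nnegrE; [exact: ltW|exact: (posfun_ge0 HI)|exact: a0|exact: h1].
  have -> : H t = powR (powR (H t) q) (1 - l) by rewrite -powRrM ql powRr1// H0.
  have l1' : 0 <= 1 - l by rewrite subr_ge0 ltW.
  apply: ge0_ler_powR; rewrite ?nnegrE; [exact: l1'| |exact: powR_ge0|exact: h2].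
  by apply: (posfun_ge0 HI Fq) => x; exact: powR_ge0.
have l10 : 0 < 1 + l by rewrite addr_gt0.
have IH0 : 0 <= int1 H by exact: (posfun_ge0 posfun_int1).
rewrite IG integral_RNS; apply: (@le_trans _ _ (powR a l * int1 H)).
  rewrite -(posfunZ posfun_int1)//; apply: (posfun_le posfun_int1) => //.
  - by apply: (@Cc_integral_rsnoc _ _ (fun x => powR (F x) (1 + l))); exact: Cc_powR_ge0.
  - exact: CcZ.
rewrite powRD; last by apply/implyP => /eqP h; exfalso; move: h l10; lra.
rewrite powRr1 ?addr_ge0// mulrC; apply: ler_pM => //; rewrite ?powR_ge0 ?lerDl//.
by apply: ge0_ler_powR; rewrite ?nnegrE ?lerDr ?addr_ge0// ltW.
Qed.

(** The power of X on the right is absorbed, since (N - 1)/N = 1/s + 1/2; what remains is X^(1/s) <=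
    C0 sqrt E. *)
Lemma sobolev_arith (N s C0 X E : R) : 3 <= N -> s = 2 * N / (N - 2) -> 0 < C0 ->
  0 < X -> 0 <= E ->
  X <= powR (C0 * (Num.sqrt X * Num.sqrt E)) (N / (N - 1)) ->
  powR X (2 / s) <= C0 ^+ 2 * E.
Proof.
move=> N3 sE C00 Xp E0; set r := N / (N - 1).
have r0 : 0 < r by rewrite divr_gt0//; lra.
set Y := Num.sqrt X; set Z := Num.sqrt E => GN2.
have Y0 : 0 < Y by rewrite sqrtr_gt0.
have Z0 : 0 <= Z by rewrite sqrtr_ge0.
have CYZ : 0 <= C0 * (Y * Z) := mulr_ge0 (ltW C00) (mulr_ge0 (ltW Y0) Z0).
have XY : X = powR Y 2 by rewrite powR_mulrn ?(ltW Y0)// sqr_sqrtr// ltW.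
have key : powR X s^-1 <= C0 * Z.
  have h1 : powR X r^-1 <= C0 * (Y * Z).
    have -> : C0 * (Y * Z) = powR (powR (C0 * (Y * Z)) r) r^-1.
      by rewrite -powRrM divff ?gt_eqF// powRr1.
    apply: ge0_ler_powR; rewrite ?nnegrE ?powR_ge0 ?(ltW Xp)//.
    by rewrite invr_ge0 ltW.
  have h2 : powR X r^-1 = powR X s^-1 * Y.
    rewrite XY -{3}[Y]powRr1 ?(ltW Y0)// -!powRrM -powRD; last by rewrite (gt_eqF Y0) implybT.
    congr powR; rewrite sE /r.
    by field; rewrite !gt_eqF//; lra.
  by move: h1; rewrite h2 [Y * Z]mulrC mulrA (ler_pM2r Y0).
have -> : powR X (2 / s) = powR X s^-1 ^+ 2.
  by rewrite -powR_mulrn ?powR_ge0// -powRrM mulrC.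
have -> : E = Z ^+ 2 by rewrite sqr_sqrtr.
rewrite -exprMn ler_pXn2r ?nnegrE; [exact: key|by []|exact: powR_ge0|].
by rewrite mulr_ge0// ltW.
Qed.

Theorem sobolev m : exists2 C : R, 0 < C & forall f : 'rV[R]_m.+3 -> R, C1c f ->
  powR (integral_RN (fun x => powR `|f x| (crit_exp m.+3))) (2 / crit_exp m.+3) <= C * energy f.
Proof.
set s : R := crit_exp m.+3; pose N : R := m.+3%:R.
have N3 : 3 <= N by rewrite ler_nat.
have sE : s = 2 * N / (N - 2) by [].
have rN : 0 <= N / (N - 1) by rewrite divr_ge0//; lra.
have s0 : 0 < s by rewrite sE divr_gt0//; lra.
(* Gagliardo-Nirenberg is applied to |f|^gam: gam N/(N-1) = s on the left, while the gradient
   carries |f|^(gam-1) = |f|^(s/2), to which Cauchy-Schwarz applies. *)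
pose gam : R := s / 2 + 1.
have g1 : 1 < gam by rewrite /gam ltr_pwDl// divr_gt0.
pose C0 : R := N * gam.
have C00 : 0 < C0 by rewrite mulr_gt0//; lra.
exists (C0 ^+ 2); first by rewrite exprn_gt0.
move=> f hf; have fc := C1c_Cc hf; have HI := @posfun_integral R m.+3.
set X := integral_RN _.
have fs : Cc (fun x => powR `|f x| s) by exact: Cc_powR.
have X0 : 0 <= X by apply: (posfun_ge0 HI) => // x; rewrite powR_ge0.
have E0 := energy_ge0 hf.
have [->|Xn0] := eqVneq X 0.
  rewrite powR0; first by rewrite mulr_ge0 ?sqr_ge0.
  by rewrite gt_eqF// divr_gt0.
have Xp : 0 < X by rewrite lt0r Xn0 X0.
pose F x := powR `|f x| gam.
pose dF i x := gam * (powR `|f x| (gam - 2) * f x) * pderiv f i x.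
have hF : has_grad F dF.
  exact: (has_grad_comp (fun y => is_derive_powR_norm y g1) (dpowR_cont g1) (C1c_grad hf)).
have gp : 0 < gam by exact: lt_trans g1.
have Fc : Cc F by exact: Cc_powR.
have dFc i : Cc (dF i).
  apply: CcMl; last exact: C1c_pderiv.
  exact: (cont_comp (dpowR_cont g1) (Cc_cont fc)).
have dFn i x : `|dF i x| = gam * (powR `|f x| (s / 2) * `|pderiv f i x|).
  rewrite /dF !normrM (gtr0_norm gp) -mulrA; congr (_ * (_ * _)).
  rewrite ger0_norm ?powR_ge0//; have [->|fx] := eqVneq (f x) 0.
    by rewrite normr0 mulr0 powR0// gt_eqF// divr_gt0.
  rewrite mulrC -{1}[`|f x|]powRr1// -powRD; last by rewrite normr_eq0 fx implybT.
  by congr powR; rewrite /gam; ring.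
have GN : X <= powR (\sum_i integral_RN (fun x => `|dF i x|)) (m.+3%:R / m.+2%:R).
  have -> : X = integral_RN (fun x => powR (F x) (m.+3%:R / m.+2%:R)).
    congr integral_RN; apply/funext => x; rewrite /F -powRrM; congr powR.
    rewrite /gam sE -/N; have -> : m.+2%:R = N - 1 by rewrite /N -[m.+3%:R]natr1 addrK.
    by field; apply/andP; split; rewrite gt_eqF//; lra.
  apply: gagliardo_nirenberg => //.
  - by move=> i; exact: Cc_norm.
  - by move=> x; rewrite powR_ge0.
  - move=> i x; have := @norm_le_int1 R (fun t => F (x + t *: ebasis R i))
      (fun t => dF i (x + t *: ebasis R i)) 0.
    rewrite scale0r addr0 ger0_norm ?powR_ge0//; apply.
    + by move=> t; exact: (is_derive_line F x (ebasis R i) t _).1 (hF.1 i _).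
    + exact: Cc_line.
    + exact: Cc_line.
have cs i : integral_RN (fun x => `|dF i x|) <= gam * (Num.sqrt X * Num.sqrt (energy f)).
  have pc := C1c_pderiv i hf; have p2c : Cc (fun x => pderiv f i x ^+ 2) by exact: Cc_exp.
  have hc : Cc (fun x => powR `|f x| (s / 2)) by apply: Cc_powR => //; rewrite divr_gt0.
  have := posfun_CS HI hc pc.
  rewrite (_ : (fun x => powR `|f x| (s / 2) ^+ 2) = fun x => powR `|f x| s); last first.
    by apply/funext => x; rewrite -powR_mulrn ?powR_ge0// -powRrM; congr powR; field.
  rewrite (_ : (fun x => `|powR `|f x| (s / 2)| * `|pderiv f i x|) =
      fun x => powR `|f x| (s / 2) * `|pderiv f i x|); last first.
    by apply/funext => x; rewrite ger0_norm// powR_ge0.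
  rewrite -/X => h.
  have -> : (fun x => `|dF i x|) = (fun x => gam * (powR `|f x| (s / 2) * `|pderiv f i x|)).
    by apply/funext => x.
  rewrite (posfunZ HI); last first.
    apply: CcMl; last exact: Cc_norm.
    by apply: cont_powR; [rewrite divr_gt0|exact: Cc_cont].
  apply: ler_wpM2l; first exact: ltW.
  apply: (le_trans h); apply: ler_wpM2l; first exact: sqrtr_ge0.
  by apply: ler_wsqrtr; exact: pderiv_le_energy.
have B : \sum_i integral_RN (fun x => `|dF i x|) <= C0 * (Num.sqrt X * Num.sqrt (energy f)).
  apply: (@le_trans _ _ (\sum_(i < m.+3) gam * (Num.sqrt X * Num.sqrt (energy f)))).
    by apply: ler_sum => i _; exact: cs.
  by rewrite sumr_const card_ord -[leLHS]mulr_natl mulrA.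
have S0 : 0 <= \sum_i integral_RN (fun x => `|dF i x|).
  by apply: sumr_ge0 => i _; apply: (posfun_ge0 HI (Cc_norm (dFc i))).
apply: (sobolev_arith N3 sE C00 Xp E0); apply: (le_trans GN).
have -> : m.+3%:R / m.+2%:R = N / (N - 1) :> R by rewrite /N -[m.+3%:R]natr1 addrK.
apply: ge0_ler_powR; rewrite ?nnegrE; [exact: rN|exact: S0|exact: le_trans S0 B|exact: B].
Qed.

End Sobolev.

(** * The Rellich compactness theorem *)

Section Rellich.
Context {R : realType} {N : nat}.
Implicit Types (u w f g : 'rV[R]_N -> R).
Let HI := @posfun_integral R N.
Let pV := @proper_rV R N.

(** Along an ultrafilter every bounded real sequence settles down, at all points simultaneously.
    This replaces the diagonal extraction in the Arzela-Ascoli argument. *)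
Lemma ultra_bounded_lim (U : set_system nat) (a : nat -> R) (C d : R) :
  UltraFilter U -> (forall n, `|a n| <= C) -> 0 < d ->
  exists l, U [set n | `|l - a n| < d].
Proof.
move=> UU aC d0.
have [l [_ lc]] : `[- C, C]%classic `&` cluster (a @ U) !=set0.
  apply: (@segment_compact R (- C) C (a @ U)).
  by apply: (@filterS _ U _ setT); [move=> n _ /=; rewrite in_itv/= -ler_norml|exact: filterT].
exists l; have [//|h] := in_ultra_setVsetC [set n | `|l - a n| < d] UU.
have Ub : U (a @^-1` (~` ball l d)).
  apply: (@filterS _ U _ _ _ _ h) => n hn hb; apply: hn.
  by move: hb; rewrite /= -ball_normE.
by have [y []] := lc _ _ Ub (nbhsx_ballx l d d0).
Qed.

Lemma sqr_integral_le2 f g : Cc f -> Cc g ->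
  integral_RN (fun x => (f x + g x) ^+ 2) <=
  2 * integral_RN (fun x => f x ^+ 2) + 2 * integral_RN (fun x => g x ^+ 2).
Proof.
move=> fc gc; have f2 : Cc (fun x => f x ^+ 2) by exact: Cc_exp.
have g2 : Cc (fun x => g x ^+ 2) by exact: Cc_exp.
rewrite -!(posfunZ HI)// -(posfunD HI); try exact: CcZ.
apply: (posfun_le HI).
- by apply: Cc_exp => //; exact: CcD.
- by apply: CcD; exact: CcZ.
- by move=> x; have := sqr_ge0 (f x - g x); lra.
Qed.

(** * Mollification *)

Section Mollifier.
Variables (rho : 'rV[R]_N -> R) (h : R).
Hypotheses (rc : Cc rho) (r0 : forall z, 0 <= rho z) (r1 : integral_RN rho = 1).
Hypothesis rh : forall z, h < `|z| -> rho z = 0.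

Definition mollify w x := integral_RN (fun z => rho z * w (x + z)).

(** The function g covers in one stroke the kernels with w (x + z), with w (x + z) - w x, and with
    the square of that difference. *)
Lemma Cc_mollify_kernel (g : R -> R -> R) w :
  (forall a b : 'rV[R]_N * 'rV[R]_N -> R, continuous a -> continuous b ->
    continuous (fun z => g (a z) (b z))) -> g 0 0 = 0 -> Cc w ->
  Cc (fun z : 'rV[R]_N * 'rV[R]_N => rho z.2 * g (w (z.1 + z.2)) (w z.1)).
Proof.
move=> cg g0 wc; have [K K0 wK] := Cc_supp wc.
have c1 : continuous (fun z : 'rV[R]_N * 'rV[R]_N => w (z.1 + z.2)).
  apply: (@cont_lipschitz R _ _ (fun z : 'rV[R]_N * 'rV[R]_N => z.1 + z.2) 2 w); last exact: Cc_cont.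
  move=> [x z] [x' z'] /=; rewrite opprD addrACA prod_normE /=.
  apply: le_trans (ler_normD _ _) _; rewrite mulr_natl mulr2n.
  by apply: lerD; rewrite le_max lexx ?orbT.
have c2 : continuous (fun z : 'rV[R]_N * 'rV[R]_N => w z.1).
  apply: (@cont_lipschitz R _ _ (fun z : 'rV[R]_N * 'rV[R]_N => z.1) 1 w); last exact: Cc_cont.
  by move=> [x z] [x' z'] /=; rewrite mul1r prod_normE le_max lexx.
have c3 : continuous (fun z : 'rV[R]_N * 'rV[R]_N => rho z.2).
  apply: (@cont_lipschitz R _ _ (fun z : 'rV[R]_N * 'rV[R]_N => z.2) 1 rho); last exact: Cc_cont.
  by move=> [x z] [x' z'] /=; rewrite mul1r prod_normE le_max lexx orbT.
split.
  by apply: cont_mul => //; exact: cg.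
exists (K + `|h|) => -[x z]; rewrite prod_normE /= => H.
have [zh|hz] := leP `|z| h; last by rewrite rh// mul0r.
have hh := ler_norm h.
move: H; rewrite lt_max => /orP[|] H; last by exfalso; move: H; lra.
rewrite !wK ?g0 ?mulr0//; first by move: H; have := normr_ge0 h; lra.
have := ler_normB (x + z) z; rewrite addrK.
by move: H; lra.
Qed.

Let k0 w : Cc w -> Cc (fun z : 'rV[R]_N * 'rV[R]_N => rho z.2 * w (z.1 + z.2)).
Proof. exact: (@Cc_mollify_kernel (fun a _ => a)). Qed.

Lemma Cc_mollify w : Cc w -> Cc (mollify w).
Proof.
by move=> wc; exact: (Cc_posfun pV pV HI (k0 wc)).
Qed.

(* Jensen's inequality for the probability density [rho]. *)
Lemma mollify_error w (D : R) : C1c w -> 0 <= h ->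
  (forall z, `|z| <= h -> sqdiff w z <= D) ->
  integral_RN (fun x => (mollify w x - w x) ^+ 2) <= D.
Proof.
move=> hw h0 wD; have wc := C1c_Cc hw.
have k1 : Cc (fun z : 'rV[R]_N * 'rV[R]_N => rho z.2 * (w (z.1 + z.2) - w z.1)).
  by apply: (@Cc_mollify_kernel (fun a b => a - b)) => //; [exact: cont_sub|rewrite subr0].
have k2 : Cc (fun z : 'rV[R]_N * 'rV[R]_N => rho z.2 * (w (z.1 + z.2) - w z.1) ^+ 2).
  apply: (@Cc_mollify_kernel (fun a b => (a - b) ^+ 2)) => //; last by rewrite subr0 expr0n.
  by move=> a b ca cb; apply: cont_exp; exact: cont_sub.
have dE x : mollify w x - w x = integral_RN (fun z => rho z * (w (x + z) - w x)).
  have wE : integral_RN (fun z => rho z * w x) = w x by rewrite (posfunZr HI)// r1 mul1r.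
  rewrite -[in LHS]wE /mollify -(posfunB HI); last 2 first.
  - exact: (Cc_slice x (k0 wc)).
  - by apply: CcMr => //; exact: cont_cst.
  by congr integral_RN; apply/funext => z; rewrite mulrBr.
have jensen x : (mollify w x - w x) ^+ 2 <= integral_RN (fun z => rho z * (w (x + z) - w x) ^+ 2).
  have s1 := Cc_slice x k1; have s2 := Cc_slice x k2; rewrite /= in s1 s2.
  have e0 := dE x; set d := mollify w x - w x in e0 *.
  have c3 : Cc (fun z => d ^+ 2 * rho z) by exact: CcZ.
  have c4 : Cc (fun z => 2 * d * (rho z * (w (x + z) - w x))) by exact: CcZ.
  have : 0 <= integral_RN (fun z => rho z * (w (x + z) - w x) ^+ 2 +
      d ^+ 2 * rho z - 2 * d * (rho z * (w (x + z) - w x))).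
    apply: (posfun_ge0 HI); first by apply: CcB => //; exact: CcD.
    move=> z; have -> : rho z * (w (x + z) - w x) ^+ 2 + d ^+ 2 * rho z -
       2 * d * (rho z * (w (x + z) - w x)) = rho z * (w (x + z) - w x - d) ^+ 2 by ring.
    by rewrite mulr_ge0 ?sqr_ge0.
  rewrite (posfunB HI)//; last exact: CcD.
  by rewrite (posfunD HI)// !(posfunZ HI)// -e0 r1; lra.
have mc := Cc_mollify wc.
have swp := @integral_swap R N _ _ _ pV HI k2; rewrite /= in swp.
apply: (@le_trans _ _ (integral_RN (fun x => integral_RN (fun z => rho z * (w (x + z) - w x) ^+ 2)))).
  apply: (posfun_le HI) => //; first by apply: Cc_exp => //; exact: CcB.
  exact: (Cc_posfun pV pV HI k2).
rewrite swp -[leRHS]mulr1 -r1 -(posfunZ HI)//; apply: (posfun_le HI).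
- exact: (Cc_posfun pV pV HI (Cc_flip k2)).
- exact: CcZ.
- move=> z; rewrite (posfunZ HI); last exact: Cc_sqdiff.
  have [zh|hz] := leP `|z| h; last by rewrite rh// mul0r mulr0.
  by rewrite mulrC ler_wpM2r//; exact: wD.
Qed.

(** In this form x occurs in [rho] only, so the mollified functions inherit a modulus of continuity
    from [rho] and an L^1 bound on w. *)
Lemma mollifyE w x : Cc w -> mollify w x = integral_RN (fun y => rho (y - x) * w y).
Proof.
move=> wc; rewrite /mollify -(integral_shift (- x) (Cc_slice x (k0 wc))) /=.
by congr integral_RN; apply/funext => y; rewrite addrCA subrr addr0.
Qed.

End Mollifier.

Lemma bump_exists (h : R) : 0 < h -> exists rho : 'rV[R]_N -> R,
  [/\ Cc rho, forall z, 0 <= rho z, integral_RN rho = 1 & forall z, h < `|z| -> rho z = 0].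
Proof.
move=> h0; pose g (z : 'rV[R]_N) := Num.max 0 (h - `|z|).
have g0 z : 0 <= g z by rewrite le_max lexx.
have gh z : h < `|z| -> g z = 0 by move=> hz; rewrite /g max_l// subr_le0 ltW.
have gc : Cc g.
  split; last by exists h.
  apply: cont_max; first exact: cont_cst.
  by apply: cont_sub; [exact: cont_cst|exact: norm_continuous].
have c0 : 0 < integral_RN g.
  by apply: (@integral_gt0 _ _ _ 0) => //; rewrite /g normr0 subr0 lt_max h0 orbT.
exists (fun z => (integral_RN g)^-1 * g z); split.
- exact: CcZ.
- by move=> z; rewrite mulr_ge0// invr_ge0 ltW.
- by rewrite (posfunZ HI)// mulVf// gt_eqF.
- by move=> z /gh->; rewrite mulr0.
Qed.

Lemma energyB_le f g : C1c f -> C1c g ->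
  C1c (fun x => f x - g x) /\
  energy (fun x => f x - g x) <= 2 * energy f + 2 * energy g.
Proof.
move=> hf hg; have h : C1c (fun x => f x - g x).
  split; first exact: has_grad_C1 (has_gradB (C1c_grad hf) (C1c_grad hg)).
  by have [_] := CcB (C1c_Cc hf) (C1c_Cc hg).
split=> //; rewrite /energy -!(posfunZ HI); try exact: C1c_grad_sq.
rewrite -(posfunD HI); try by apply: CcZ; exact: C1c_grad_sq.
apply: (posfun_le HI); first exact: C1c_grad_sq.
  by apply: CcD; apply: CcZ; exact: C1c_grad_sq.
move=> x; rewrite /grad_sq !mulr_sumr -big_split /=; apply: ler_sum => i _.
rewrite pderivB; [|by case: hf|by case: hg].
by have := sqr_ge0 (pderiv f i x + pderiv g i x); lra.
Qed.

(** At a fixed scale h the mollified functions are bounded and equicontinuous, hence uniformly close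
    for indices in a set of U; the energy bound controls their L^2 distance to the original
    functions. *)
Lemma ultra_cauchy (U : set_system nat) (u : nat -> 'rV[R]_N -> R) (K M : R) :
  UltraFilter U -> 0 < K -> (forall n, C1c (u n)) ->
  (forall n x, K < `|x| -> u n x = 0) ->
  (forall n, energy (u n) <= M) ->
  (forall n, integral_RN (fun x => u n x ^+ 2) <= M) ->
  forall e : R, 0 < e -> exists2 A, U A & forall m n, A m -> A n ->
    integral_RN (fun x => (u m x - u n x) ^+ 2) <= e.
Proof.
move=> UU K0 hu uK uE uM e e0.
have M0 : 0 <= M by apply: le_trans (uE 0%N); exact: energy_ge0.
(* A difference of two members has energy at most 4 M, so c h^2 bounds its translation differences
   up to length h and thus its mollification error. *)
pose c := (4 ^ N)%:R * (4 * M) + 1 : R.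
have c0 : 0 < c by rewrite ltr_wpDl// mulr_ge0// mulr_ge0.
pose h := Num.min 1 (e / (4 * c)).
have h0 : 0 < h by rewrite lt_min ltr01 divr_gt0// mulr_gt0.
have h1 : h <= 1 by rewrite ge_min lexx.
have hc : c * h ^+ 2 <= e / 4.
  have hc1 : h * (4 * c) <= e by rewrite -ler_pdivlMr ?mulr_gt0// ge_min lexx orbT.
  have : h ^+ 2 <= h by rewrite expr2 ger_pMl.
  move=> hh; have : c * h ^+ 2 <= c * h by rewrite ler_pM2l.
  by move: hc1; lra.
have [rho [rc r0 r1 rh]] := bump_exists h0.
pose V := integral_RN (plateau (K + 1) : 'rV[R]_N -> R).
pose V3 := integral_RN (plateau K : 'rV[R]_N -> R).
have V0 : 0 <= V by apply: (posfun_ge0 HI); [exact: Cc_plateau|exact: plateau_ge0].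
have V30 : 0 <= V3 by apply: (posfun_ge0 HI); [exact: Cc_plateau|exact: plateau_ge0].
(* Uniform closeness 4 d gives an L^2 error of at most 16 d^2 V <= e/4. The other error is c h^2 <=
   e/4, and the squared sum doubles each. *)
pose d := Num.min 1 (e / (64 * (V + 1))).
have d0 : 0 < d by rewrite lt_min ltr01 divr_gt0// mulr_gt0// ltr_wpDl.
have dV : 16 * d ^+ 2 * V <= e / 4.
  have hh : d * (64 * (V + 1)) <= e.
    by rewrite -ler_pdivlMr ?mulr_gt0 ?ltr_wpDl// ge_min lexx orbT.
  have d1 : d <= 1 by rewrite ge_min lexx.
  have : d ^+ 2 <= d by rewrite expr2 ger_pMl.
  move=> dd; have : d ^+ 2 * V <= d * V by rewrite ler_wpM2r.
  by move: hh d0; lra.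
have uc n := C1c_Cc (hu n).
have phi x n : mollify rho (u n) x = integral_RN (fun y => rho (y - x) * u n y).
  exact: (mollifyE rc rh x (uc n)).
have L1 n : integral_RN (fun y => `|u n y|) <= M + V3.
  apply: (@le_trans _ _ (integral_RN (fun y => u n y ^+ 2 + plateau K y))).
    apply: (posfun_le HI); [exact: Cc_norm| |].
      by apply: CcD; [exact: Cc_exp|exact: Cc_plateau].
    move=> x; have [xK|/uK->] := leP `|x| K; last first.
      by rewrite normr0 addr_ge0 ?sqr_ge0 ?plateau_ge0.
    rewrite plateau1// -[u n x ^+ 2]real_normK ?num_real//.
    by have := sqr_ge0 (`|u n x| - 1); have := normr_ge0 (u n x); nra.
  by rewrite (posfunD HI) ?lerD2r//; [exact: Cc_exp|exact: Cc_plateau].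
have rx x : Cc (fun y => rho (y - x)) by exact: (Cc_shift (- x) rc).
have ru x n : Cc (fun y => rho (y - x) * u n y).
  by apply: CcMl => //; exact: Cc_cont (rx x).
have [Mr Mr0 rM] := Cc_bounded pV rc.
have bnd x n : `|mollify rho (u n) x| <= Mr * (M + V3).
  rewrite phi; apply: le_trans (posfun_norm HI (ru x n)) _.
  apply: (@le_trans _ _ (Mr * integral_RN (fun y => `|u n y|))); last first.
    by rewrite ler_pM2l.
  rewrite -(posfunZ HI); last exact: Cc_norm.
  apply: (posfun_le HI); [exact: Cc_norm|by apply: CcZ; exact: Cc_norm|].
  by move=> y; rewrite normrM ler_wpM2r.
have MV : 0 <= M + V3 by rewrite addr_ge0.
have eq0 : 0 < d / (M + V3 + 1) by rewrite divr_gt0// ltr_wpDl.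
have [dl dl0 equi] := Cc_unif pV rc eq0.
have eqc x x' n : `|x - x'| < dl -> `|mollify rho (u n) x - mollify rho (u n) x'| <= d.
  move=> xx'; rewrite !phi -(posfunB HI)//.
  apply: le_trans (posfun_norm HI (CcB (ru x n) (ru x' n))) _.
  apply: (@le_trans _ _ (d / (M + V3 + 1) * integral_RN (fun y => `|u n y|))).
    rewrite -(posfunZ HI); last exact: Cc_norm.
    apply: (posfun_le HI); [by apply: Cc_norm; exact: CcB|by apply: CcZ; exact: Cc_norm|].
    move=> y; rewrite -mulrBl normrM ler_wpM2r//; apply/ltW/equi.
    by rewrite opprB addrCA addrAC subrr add0r -normrN opprB in xx' *.
  rewrite -mulrA ler_piMr ?(ltW d0)// mulrC ler_pdivrMr ?ltr_wpDl// mul1r.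
  by apply: le_trans (L1 n) _; rewrite lerDl.
have cK : compact [set x : 'rV[R]_N | `|x| <= K + 1] := @proper_rV R N (K + 1).
have /compact_near_coveringP cov := cK.
(* Of the 4 d, two come from moving to the centre of the ball for either index and two from the
   distance to the common value l there. *)
have := cov _ (filter_prod U U) (fun mn x =>
  `|mollify rho (u mn.1) x - mollify rho (u mn.2) x| <= 4 * d) _.
case=> [x _|[A1 A2] [/= UA1 UA2] AP].
  have [l lU] := ultra_bounded_lim UU (bnd x) d0.
  exists (ball x dl, [set n | `|l - mollify rho (u n) x| < d] `*` [set n | `|l - mollify rho (u n) x| < d]).
    split; first exact: nbhsx_ballx.
    by exists ([set n | `|l - mollify rho (u n) x| < d], [set n | `|l - mollify rho (u n) x| < d]).
  move=> [x' [m n]] /= [xx' [hm hn]].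
  rewrite -ball_normE /= in xx'.
  have a1 := eqc _ _ m xx'; have a2 := eqc _ _ n xx'.
  move: a1 a2 hm hn; rewrite !ler_norml !ltr_norml => /andP[? ?] /andP[? ?] /andP[? ?] /andP[? ?].
  by apply/andP; split; lra.
exists (A1 `&` A2); first exact: filterI.
move=> m n [m1 m2] [n1 n2].
have [hw Ew] := energyB_le (hu m) (hu n).
set w := (fun x => u m x - u n x) in hw Ew.
have wc := C1c_Cc hw.
have Ew4 : energy w <= 4 * M by have := uE m; have := uE n; move: Ew; lra.
have err : integral_RN (fun x => (mollify rho w x - w x) ^+ 2) <= c * h ^+ 2.
  apply: (mollify_error rc r0 r1 rh hw (ltW h0)) => z zh.
  apply: le_trans (sqdiff_le z hw) _.
  have zz : `|z| ^+ 2 <= h ^+ 2 by rewrite ler_pXn2r ?nnegrE ?(ltW h0).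
  rewrite mulrAC; apply: ler_pM; rewrite ?mulr_ge0 ?energy_ge0 ?sqr_ge0//.
  apply: (@le_trans _ _ ((4 ^ N)%:R * (4 * M))); last by rewrite /c lerDl.
  by rewrite ler_wpM2l.
have mE x : mollify rho w x = mollify rho (u m) x - mollify rho (u n) x.
  rewrite (mollifyE rc rh x wc) !phi -(posfunB HI)//; congr integral_RN.
  by apply/funext => y; rewrite mulrBr.
have msmall : integral_RN (fun x => mollify rho w x ^+ 2) <= 16 * d ^+ 2 * V.
  have mc := Cc_mollify rc rh wc.
  rewrite -(posfunZ HI); last exact: Cc_plateau.
  apply: (posfun_le HI); [exact: Cc_exp|by apply: CcZ; exact: Cc_plateau|move=> x].
  have [xK|Kx] := leP `|x| (K + 1).
    rewrite plateau1// mulr1 mE -[leLHS]real_normK ?num_real//.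
    have -> : 16 * d ^+ 2 = (4 * d) ^+ 2 by ring.
    rewrite ler_pXn2r ?nnegrE ?mulr_ge0 ?(ltW d0)//.
    exact: (AP (m, n)).
  rewrite /mollify (_ : (fun z => _) = fun=> 0).
    by rewrite (posfun0 HI) expr0n mulr_ge0 ?plateau_ge0// mulr_ge0 ?sqr_ge0.
  apply/funext => z; have [zh|hz] := leP `|z| h; last by rewrite rh// mul0r.
  rewrite /w !uK ?subrr ?mulr0//;
    by have := ler_normB (x + z) z; rewrite addrK; move: Kx zh h1; lra.
have mc := Cc_mollify rc rh wc.
have -> : (fun x => (u m x - u n x) ^+ 2) =
    (fun x => (mollify rho w x + (- (mollify rho w x - w x))) ^+ 2).
  by apply/funext => x; rewrite opprB addrCA subrr addr0.
apply: le_trans (sqr_integral_le2 mc _) _; first by apply: CcN; exact: CcB.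
under [X in _ + 2 * integral_RN X]eq_fun do rewrite sqrrN.
by move: err msmall hc dV; lra.
Qed.

Lemma rellich (u : nat -> 'rV[R]_N -> R) (K M : R) : 0 < K -> (forall n, C1c (u n)) ->
  (forall n x, K < `|x| -> u n x = 0) ->
  (forall n, energy (u n) <= M) ->
  (forall n, integral_RN (fun x => u n x ^+ 2) <= M) ->
  exists phi : nat -> nat, (forall k, (k <= phi k)%N) /\
    forall e : R, 0 < e -> exists k0, forall k l, (k0 <= k)%N -> (k0 <= l)%N ->
      integral_RN (fun x => (u (phi k) x - u (phi l) x) ^+ 2) <= e.
Proof.
move=> K0 hu uK uE uM.
have [U [UU sU]] := ultraFilterLemma (eventually_filter : ProperFilter \oo).
have e0 k : 0 < k.+1%:R^-1 :> R by rewrite invr_gt0 ltr0n.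
have /choice[A AP] : forall k : nat, exists A, U A /\ forall m n, A m -> A n ->
    integral_RN (fun x => (u m x - u n x) ^+ 2) <= k.+1%:R^-1 :> R.
  by move=> k; have [A UA AP] := ultra_cauchy UU K0 hu uK uE uM (e0 k); exists A.
have UP : ProperFilter U := ultra_proper.
have /choice[phi phiP] : forall k : nat, exists n, A k n /\ (k <= n)%N.
  move=> k; have : U (A k `&` [set n | (k <= n)%N]).
    by apply: filterI; [have [] := AP k|apply: sU; exists k].
  by move=> /filter_ex[n [h1 h2]]; exists n.
exists phi; split=> [k|e e1]; first by have [] := phiP k.
pose k0 := Num.bound (4 / e).
have hk k : (k0 <= k)%N -> k.+1%:R^-1 <= e / 4.
  move=> kk; rewrite -[e / 4]invrK lef_pV2 ?posrE ?ltr0n ?invr_gt0 ?divr_gt0//.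
  rewrite invf_div ltW// (lt_trans (archi_boundP _))//; first by rewrite divr_ge0// ltW.
  by rewrite ltr_nat ltnS.
exists k0 => k l kk ll.
have [UAk Akp] := AP k; have [UAl Alp] := AP l.
(* The sets A k need not be nested, but any two of them meet; a common index j links the two chosen
   members. *)
have /filter_ex[j [jk jl]] : U (A k `&` A l) by exact: filterI.
have [pk _] := phiP k; have [pl _] := phiP l.
have q1 := Akp _ _ pk jk; have q2 := Alp _ _ jl pl.
have uc n := C1c_Cc (hu n).
have -> : (fun x => (u (phi k) x - u (phi l) x) ^+ 2) =
    (fun x => ((u (phi k) x - u j x) + (u j x - u (phi l) x)) ^+ 2).
  by apply/funext => x; rewrite addrA subrK.
apply: le_trans (sqr_integral_le2 _ _) _; try exact: CcB.
by move: (le_trans q1 (hk k kk)) (le_trans q2 (hk l ll)); lra.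
Qed.

End Rellich.

(** * Sobolev quotients near the critical exponent *)

Lemma sobolev_ineq {R : realType} (N : nat) : (3 <= N)%N -> exists2 C : R, 0 < C &
  forall f : 'rV[R]_N -> R, C1c f ->
  powR (integral_RN (fun x => powR `|f x| (crit_exp N))) (2 / crit_exp N) <= C * energy f.
Proof. by case: N => [|[|[|m]]]// _; exact: sobolev. Qed.

Section Variational.
Context {R : realType} {N : nat}.
Hypothesis N3 : (3 <= N)%N.
Implicit Types (f g u : 'rV[R]_N -> R) (W : 'rV[R]_N -> R).
Let HI := @posfun_integral R N.
Let s : R := crit_exp N.

Definition Lp p f := integral_RN (fun x => powR `|f x| p).
(** The mass of f for the weight W. The outer root is left out so that masses add when weights
    do. *)
Definition Wp W p f := integral_RN (fun x => W x * powR `|f x| p).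

Lemma crit_exp_gt2 : 2 < s.
Proof.
have N2 : 3 <= N%:R :> R by rewrite ler_nat.
rewrite /s /crit_exp ltr_pdivlMr; last by move: N2; lra.
by move: N2; lra.
Qed.

Let s0 : 0 < s. Proof. exact: lt_trans crit_exp_gt2. Qed.

Lemma Lp_ge0 p f : 0 < p -> Cc f -> 0 <= Lp p f.
Proof. by move=> p0 fc; apply: (posfun_ge0 HI (Cc_powR p0 fc)) => x; exact: powR_ge0. Qed.

Lemma LpZ p c f : 0 < p -> Cc f -> Lp p (fun x => c * f x) = powR `|c| p * Lp p f.
Proof.
move=> p0 fc; rewrite /Lp -(posfunZ HI); last exact: Cc_powR.
by congr integral_RN; apply/funext => x; rewrite normrM powRM.
Qed.

Lemma energyZ c f : C1c f -> energy (fun x => c * f x) = c ^+ 2 * energy f.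
Proof.
move=> hf; rewrite /energy -(posfunZ HI); last exact: C1c_grad_sq.
by congr integral_RN; apply/funext => x; rewrite grad_sqZ//; case: hf.
Qed.

(** The infimum of the critical quotients, positive by the Sobolev inequality. Its near-optimisers
    are taken on the whole space, so that they can be rescaled freely. *)
Lemma best_constant : exists S : R, [/\ 0 < S,
  forall f, C1c f -> S * powR (Lp s f) (2 / s) <= energy f &
  forall e, 0 < e -> exists f, [/\ C1c f, 0 < Lp s f &
    energy f < (S + e) * powR (Lp s f) (2 / s)]].
Proof.
have [C C0 sob] := @sobolev_ineq R N N3.
pose Q := [set r | exists f, [/\ C1c f, 0 < Lp s f & r = energy f / powR (Lp s f) (2 / s)]].
have Q0 : Q !=set0.
  pose f0 (x : 'rV[R]_N) := sqpos (1 - \sum_j x ord0 j ^+ 2).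
  have h1 : has_grad (fun x : 'rV[R]_N => 1 - \sum_j x ord0 j ^+ 2)
      (fun i x => 0 - 2 * x ord0 i).
    exact: has_gradB (has_grad_cst N 1) (@has_grad_sqnorm R N).
  have h2 := has_grad_comp (@is_derive_sqpos R) (@sqpos_cont R) h1.
  have hf : C1c f0.
    split; first exact: has_grad_C1 h2.
    exists 1 => x x1; rewrite /f0 /sqpos max_l ?expr0n//.
    rewrite subr_le0 -eucl_sqr; have := norm_le_eucl x.
    by move: x1; set a := `|x|; set b := eucl x => h3 h4; nra.
  exists (energy f0 / powR (Lp s f0) (2 / s)); exists f0; split=> //.
  apply: (@integral_gt0 _ _ _ 0); first by apply: Cc_powR => //; exact: C1c_Cc.
    by move=> x; exact: powR_ge0.
  rewrite powR_gt0// normr_gt0 /f0 /sqpos big1 ?subr0; last by move=> i _; rewrite mxE expr0n.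
  by rewrite max_r// expr1n oner_eq0.
have Qlb : lbound Q C^-1.
  move=> r [f [hf Lf ->]].
  have p0 : 0 < powR (Lp s f) (2 / s) by rewrite powR_gt0.
  by rewrite ler_pdivlMr// ler_pdivrMl//; exact: sob.
have Qinf : has_inf Q by split=> //; exists C^-1.
exists (inf Q); split.
- by apply: (@lt_le_trans _ _ C^-1); [rewrite invr_gt0|exact: lb_le_inf].
- move=> f hf; have L0 := Lp_ge0 s0 (C1c_Cc hf).
  move: L0; rewrite le_eqVlt => /orP[/eqP<-|L0].
    rewrite powR0; first by rewrite mulr0; exact: energy_ge0.
    by rewrite gt_eqF// divr_gt0.
  have p0 : 0 < powR (Lp s f) (2 / s) by rewrite powR_gt0.
  rewrite -ler_pdivlMr//; apply: inf_lbound; first by exists C^-1.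
  by exists f.
- move=> e e0; have [r [f [hf Lf ->]] h] := inf_adherent e0 Qinf.
  exists f; split=> //.
  have p0 : 0 < powR (Lp s f) (2 / s) by rewrite powR_gt0.
  by rewrite -ltr_pdivrMr.
Qed.

Variable S : R.
Hypotheses (S0 : 0 < S)
  (Ssob : forall f, C1c f -> S * powR (Lp s f) (2 / s) <= energy f).

(** A bound for the volume of the annulus, kept at least 1 so that its powers are positive. *)
Let B : R := Num.max 1 (integral_RN (plateau 3 : 'rV[R]_N -> R)).
Let B1 : 1 <= B. Proof. by rewrite le_max lexx. Qed.
Let B0 : 0 < B. Proof. exact: lt_le_trans B1. Qed.
Let IB : integral_RN (plateau 3 : 'rV[R]_N -> R) <= B.
Proof. by rewrite le_max lexx orbT. Qed.
Let IB0 : 0 <= integral_RN (plateau 3 : 'rV[R]_N -> R).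
Proof. by apply: (posfun_ge0 HI); [exact: Cc_plateau|exact: plateau_ge0]. Qed.

Lemma holder_box (t : R) g h : 0 < t -> t < 1 -> Cc h -> (forall x, 0 <= h x) ->
  Cc g -> (forall x, g x <= powR (h x) t) -> (forall x, 3 < `|x| -> g x = 0) ->
  integral_RN g <= powR (integral_RN h) t * powR B (1 - t).
Proof.
move=> t0 t1 hc h0 gc gh g3.
have pc := @Cc_plateau R 'rV[R]_N 3; have p0 := @plateau_ge0 R 'rV[R]_N 3.
have t1' : 0 < 1 - t by rewrite subr_gt0.
have H := posfun_hoelder HI t0 t1 pc hc p0 h0.
apply: (@le_trans _ _ (integral_RN (fun x => powR (plateau 3 x) (1 - t) * powR (h x) t))).
  apply: (posfun_le HI) => //.
    apply: CcMl; last exact: Cc_powR_ge0.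
    by apply: Cc_cont; exact: Cc_powR_ge0.
  move=> x; have [x3|x3] := leP `|x| 3; first by rewrite plateau1// powR1 mul1r.
  by rewrite g3// mulr_ge0 ?powR_ge0.
apply: (le_trans H); rewrite mulrC; apply: ler_wpM2l; first exact: powR_ge0.
apply: ge0_ler_powR; rewrite ?nnegrE; [exact: ltW|exact: IB0|exact: ltW|exact: IB].
Qed.

(** Hoelder on a bounded region passes from s to p. The extra factor B^(2/p - 2/s) tends to 1 as p
    tends to s, so S stays asymptotically the right constant. *)
Lemma sobolev_p p f : 0 < p -> p < s -> C1c_annulus f ->
  S * powR (Lp p f) (2 / p) <= powR B (2 / p - 2 / s) * energy f.
Proof.
move=> p0 ps hf; have hc := annulus_C1c hf; have fc := C1c_Cc hc.
have t0 : 0 < p / s by rewrite divr_gt0.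
have t1 : p / s < 1 by rewrite ltr_pdivrMr// mul1r.
have H : Lp p f <= powR (Lp s f) (p / s) * powR B (1 - p / s).
  apply: (holder_box t0 t1 (Cc_powR s0 fc)).
  - by move=> x; exact: powR_ge0.
  - exact: Cc_powR.
  - by move=> x; rewrite -powRrM mulrC divfK// gt_eqF.
  - by move=> x x3; rewrite (annulus_norm hf)// normr0 powR0// gt_eqF.
have Ls0 := Lp_ge0 s0 fc; have Lp0 := Lp_ge0 p0 fc.
have H2 : powR (Lp p f) (2 / p) <= powR (Lp s f) (2 / s) * powR B (2 / p - 2 / s).
  have -> : powR (Lp s f) (2 / s) * powR B (2 / p - 2 / s) =
     powR (powR (Lp s f) (p / s) * powR B (1 - p / s)) (2 / p).
    rewrite powRM ?powR_ge0// -!powRrM; congr (powR _ _ * powR _ _).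
      by field; rewrite !gt_eqF.
    by field; rewrite !gt_eqF.
  apply: ge0_ler_powR; rewrite ?nnegrE; [by rewrite divr_ge0// ltW|exact: Lp0| |exact: H].
  by rewrite mulr_ge0// powR_ge0.
apply: (le_trans (ler_wpM2l (ltW S0) H2)).
rewrite mulrA [leRHS]mulrC; apply: ler_wpM2r; first exact: powR_ge0.
exact: Ssob.
Qed.

Lemma sobolev_near e : 0 < e -> exists p1, [/\ 2 < p1, p1 < s &
  forall p f, p1 < p -> p < s -> C1c_annulus f ->
    S * powR (Lp p f) (2 / p) <= (1 + e) * energy f].
Proof.
move=> e0.
have c : {for s, continuous (fun p : R => powR B (2 / p - 2 / s))}.
  apply: cont_powR_exp => //; apply: cvgB; last exact: cvg_cst.
  by apply: cvg_div2; rewrite gt_eqF.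
have [|p1 p1s H] := near_left (c := 1 + e) c.
  by rewrite subrr powRr0 ltrDl.
pose p2 := Num.max p1 ((2 + s) / 2).
have s2 := crit_exp_gt2.
exists p2; split.
- by rewrite lt_max; apply/orP; right; lra.
- by rewrite gt_max p1s /=; lra.
- move=> p f; rewrite gt_max => /andP[h1 h2] ps hf.
  have p0 : 0 < p by move: h2; lra.
  apply: (le_trans (sobolev_p p0 ps hf)); apply: ler_wpM2r.
    by apply: energy_ge0; exact: annulus_C1c.
  by apply/ltW/H.
Qed.

(** The bound must not depend on p: S Lp^(2/p) <= 2 (S + 1) gives Lp <= k^(p/2), and k >= 1 allows p
    to be replaced by s in the exponent. *)
Lemma Lp_bounded : exists C p1 : R, [/\ 0 < C, 2 < p1, p1 < s &
  forall p f, p1 < p -> p < s -> C1c_annulus f -> energy f <= S + 1 -> Lp p f <= C].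
Proof.
have [p1 [h1 h2 H]] := sobolev_near ltr01.
pose k := 2 * (S + 1) / S.
have k1 : 1 <= k by rewrite /k ler_pdivlMr// mul1r; move: S0; lra.
exists (powR k (s / 2)), p1; split=> //; first by rewrite powR_gt0// (lt_le_trans ltr01).
move=> p f p1p ps hf Ef; have fc := C1c_Cc (annulus_C1c hf).
have p0 : 0 < p by apply: lt_trans p1p; apply: lt_trans h1.
have L0 := Lp_ge0 p0 fc.
have : powR (Lp p f) (2 / p) <= k.
  rewrite /k ler_pdivlMr// mulrC; apply: (le_trans (H p f p1p ps hf)); lra.
move=> h; have -> : Lp p f = powR (powR (Lp p f) (2 / p)) (p / 2).
  by rewrite -powRrM [2 / p * _](_ : _ = 1) ?powRr1//; field; rewrite gt_eqF.
apply: (@le_trans _ _ (powR k (p / 2))).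
  apply: ge0_ler_powR; rewrite ?nnegrE ?powR_ge0//; first by rewrite divr_ge0// ltW.
  exact: le_trans k1.
by apply: ler_powR => //; rewrite ler_pM2r ?ltW ?invr_gt0.
Qed.

Lemma Lp_le_energy p : 2 < p -> p < s -> exists2 C : R, 0 < C & forall f, C1c_annulus f ->
  Lp p f <= C * powR (energy f) (p / 2).
Proof.
move=> p2 ps; have p0 : 0 < p by exact: lt_trans p2.
pose k := powR B (2 / p - 2 / s) / S.
have k0 : 0 < k by rewrite divr_gt0// powR_gt0.
exists (powR k (p / 2)); first exact: powR_gt0.
move=> f hf; have fc := C1c_Cc (annulus_C1c hf); have L0 := Lp_ge0 p0 fc.
have E0 := energy_ge0 (annulus_C1c hf).
have h : powR (Lp p f) (2 / p) <= k * energy f.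
  by rewrite /k mulrAC ler_pdivlMr// mulrC; exact: sobolev_p.
have -> : Lp p f = powR (powR (Lp p f) (2 / p)) (p / 2).
  by rewrite -powRrM [2 / p * _](_ : _ = 1) ?powRr1//; field; rewrite gt_eqF.
rewrite -powRM ?(ltW k0)//; apply: ge0_ler_powR; rewrite ?nnegrE ?powR_ge0//.
  by rewrite divr_ge0// ltW.
by rewrite mulr_ge0// ltW.
Qed.

Lemma Lp_small_energy p e : 2 < p -> p < s -> 0 < e -> exists2 eta : R, 0 < eta &
  forall f, C1c_annulus f -> energy f <= eta -> Lp p f <= e.
Proof.
move=> p2 ps e0; have p0 : 0 < p by exact: lt_trans p2.
have [C C0 H] := Lp_le_energy p2 ps.
exists (powR (e / C) (2 / p)); first by rewrite powR_gt0// divr_gt0.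
move=> f hf Ef; apply: (le_trans (H f hf)).
rewrite mulrC -ler_pdivlMr//.
have -> : e / C = powR (powR (e / C) (2 / p)) (p / 2).
  rewrite -powRrM [2 / p * _](_ : _ = 1) ?powRr1//; first by rewrite divr_ge0// ltW.
  by field; rewrite gt_eqF.
apply: ge0_ler_powR; rewrite ?nnegrE ?powR_ge0//; first by rewrite divr_ge0// ltW.
by apply: energy_ge0; exact: annulus_C1c.
Qed.

(** Interpolation of L^p between L^2 and the critical space, p = 2 (1 - t) + s t with t < 1. This is
    where p < s turns L^2 compactness into L^p compactness. *)
Lemma Lp_small_L2 p M e : 2 < p -> p < s -> 0 < e -> exists2 eta : R, 0 < eta &
  forall f, C1c_annulus f -> energy f <= M ->
    integral_RN (fun x => f x ^+ 2) <= eta -> Lp p f <= e.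
Proof.
move=> p2 ps e0; have p0 : 0 < p by exact: lt_trans p2.
have s2 := crit_exp_gt2.
pose t := (p - 2) / (s - 2).
have sd : 0 < s - 2 by rewrite subr_gt0.
have t0 : 0 < t by rewrite divr_gt0// subr_gt0.
have t1 : t < 1 by rewrite ltr_pdivrMr// mul1r ltrD2r.
have t1' : 0 < 1 - t by rewrite subr_gt0.
pose C := powR (powR (Num.max 0 M / S) (s / 2)) t + 1.
have C0 : 0 < C by rewrite ltr_wpDl// powR_ge0.
exists (powR (e / C) (1 - t)^-1); first by rewrite powR_gt0// divr_gt0.
move=> f hf EM f2; have fc := C1c_Cc (annulus_C1c hf).
have E0 := energy_ge0 (annulus_C1c hf).
have f2c : Cc (fun x => f x ^+ 2) by exact: Cc_exp.
have H := posfun_hoelder HI t0 t1 f2c (Cc_powR s0 fc) (fun x => sqr_ge0 _) (fun x => powR_ge0 _ _).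
have L0 := Lp_ge0 s0 fc.
have Ls : Lp s f <= powR (Num.max 0 M / S) (s / 2).
  have h : powR (Lp s f) (2 / s) <= Num.max 0 M / S.
    rewrite ler_pdivlMr// mulrC; apply: (le_trans (Ssob (annulus_C1c hf))).
    by rewrite le_max EM orbT.
  have -> : Lp s f = powR (powR (Lp s f) (2 / s)) (s / 2).
    by rewrite -powRrM [2 / s * _](_ : _ = 1) ?powRr1//; field; rewrite gt_eqF.
  apply: ge0_ler_powR; rewrite ?nnegrE ?powR_ge0//; first by rewrite divr_ge0// ltW.
  by rewrite divr_ge0 ?(ltW S0)// le_max lexx.
have F0 : 0 <= integral_RN (fun x => f x ^+ 2).
  by apply: (posfun_ge0 HI f2c) => x; exact: sqr_ge0.
have -> : Lp p f = integral_RN (fun x => powR (f x ^+ 2) (1 - t) * powR (powR `|f x| s) t).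
  congr integral_RN; apply/funext => x.
  rewrite -[f x ^+ 2]real_normK ?num_real// -powR_mulrn// -!powRrM -powRD.
    by congr powR; rewrite /t; field; rewrite gt_eqF.
  apply/implyP => /eqP h; exfalso.
  have : 2 * (1 - t) + s * t = p by rewrite /t; field; rewrite gt_eqF.
  by move: h p0; lra.
apply: (le_trans H).
apply: (@le_trans _ _ (e / C * C)); last by rewrite divfK// gt_eqF.
apply: ler_pM; rewrite ?powR_ge0//.
  have -> : e / C = powR (powR (e / C) (1 - t)^-1) (1 - t).
    rewrite -powRrM mulVf ?powRr1 ?gt_eqF//; by rewrite divr_ge0// ltW.
  by apply: ge0_ler_powR; rewrite ?nnegrE ?powR_ge0 ?(ltW t1').
rewrite /C; apply: (@le_trans _ _ (powR (powR (Num.max 0 M / S) (s / 2)) t)); last by rewrite lerDl.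
by apply: ge0_ler_powR; rewrite ?nnegrE ?powR_ge0 ?(ltW t0).
Qed.

(** The bounds are imposed on the annulus only, since [Psi] exceeds 1 near the origin and far
    away. *)
Definition weight W := continuous W /\
  forall x, 1 < eucl x -> eucl x < 3 -> 0 <= W x <= 1.

Lemma annulus_cases f x : C1c_annulus f -> f x = 0 \/ 1 < eucl x < 3.
Proof.
move=> hf; have [h1|h1] := leP (eucl x) 1; first by left; apply: (annulus_supp hf); left.
have [h2|h2] := leP 3 (eucl x); first by left; apply: (annulus_supp hf); right.
by right.
Qed.

Lemma weight_bounds W p f x : 0 < p -> weight W -> C1c_annulus f ->
  0 <= W x * powR `|f x| p <= powR `|f x| p.
Proof.
move=> p0 [_ hW] hf; have [->|/andP[h1 h2]] := annulus_cases x hf.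
  by rewrite normr0 powR0 ?gt_eqF// mulr0 lexx.
have /andP[w0 w1] := hW x h1 h2.
by rewrite mulr_ge0 ?powR_ge0//= ler_piMl// powR_ge0.
Qed.

Lemma Cc_Wp W p f : 0 < p -> continuous W -> Cc f -> Cc (fun x => W x * powR `|f x| p).
Proof. by move=> p0 cW fc; apply: CcMl => //; exact: Cc_powR. Qed.

Lemma Wp_ge0 W p f : 0 < p -> weight W -> C1c_annulus f -> 0 <= Wp W p f.
Proof.
move=> p0 wW hf; have fc := C1c_Cc (annulus_C1c hf); have [cW _] := wW.
apply: (posfun_ge0 HI (Cc_Wp p0 cW fc)) => x.
by have /andP[] := weight_bounds x p0 wW hf.
Qed.

Lemma Wp_le_Lp W p f : 0 < p -> weight W -> C1c_annulus f -> Wp W p f <= Lp p f.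
Proof.
move=> p0 wW hf; have fc := C1c_Cc (annulus_C1c hf); have [cW _] := wW.
apply: (posfun_le HI (Cc_Wp p0 cW fc) (Cc_powR p0 fc)) => x.
by have /andP[] := weight_bounds x p0 wW hf.
Qed.

Lemma WpZ W p c f : 0 < p -> continuous W -> Cc f ->
  Wp W p (fun x => c * f x) = powR `|c| p * Wp W p f.
Proof.
move=> p0 cW fc; rewrite /Wp -(posfunZ HI); last exact: Cc_Wp.
by congr integral_RN; apply/funext => x; rewrite normrM powRM// mulrCA.
Qed.

Lemma WpD W W' p f : 0 < p -> continuous W -> continuous W' -> Cc f ->
  Wp (fun x => W x + W' x) p f = Wp W p f + Wp W' p f.
Proof.
move=> p0 cW cW' fc; rewrite /Wp -(posfunD HI); try exact: Cc_Wp.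
by congr integral_RN; apply/funext => x; rewrite mulrDl.
Qed.

(** One eta serves all weights at once, because a weighted mass of the difference is at most the
    unweighted one. *)
Lemma Wp_cont p M e : 0 < p -> 0 < e -> exists2 eta : R, 0 < eta &
  forall W f g, weight W -> C1c_annulus f -> C1c_annulus g ->
    Wp W p g <= M -> Lp p (fun x => f x - g x) <= eta -> Wp W p f <= Wp W p g + e.
Proof.
move=> p0 e0; pose M' := Num.max 0 M + 1.
have M'0 : 0 < M' by rewrite ltr_wpDl// le_max lexx.
have e1 : 0 < e / 2 / M' by rewrite divr_gt0// divr_gt0.
have [C C0 H] := powR_perturb p0 e1.
exists (e / 2 / C); first by rewrite divr_gt0// divr_gt0.
move=> W f g wW hf hg gM fg; have [cW _] := wW.
have fc := C1c_Cc (annulus_C1c hf); have gc := C1c_Cc (annulus_C1c hg).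
have hd := annulusB hf hg; have dc := C1c_Cc (annulus_C1c hd).
have g0 := Wp_ge0 p0 wW hg.
have c1 : Cc (fun x => (1 + e / 2 / M') * (W x * powR `|g x| p)).
  by apply: CcZ; exact: Cc_Wp.
have c2 : Cc (fun x => C * (W x * powR `|f x - g x| p)).
  by apply: CcZ; exact: (Cc_Wp p0 cW dc).
have step : Wp W p f <= (1 + e / 2 / M') * Wp W p g + C * Wp W p (fun x => f x - g x).
  have w1 := Cc_Wp p0 cW gc.
  have w2 : Cc (fun x => W x * powR `|f x - g x| p) := Cc_Wp p0 cW dc.
  rewrite /Wp -(posfunZ HI _ w1) -(posfunZ HI _ w2) -(posfunD HI c1 c2); apply: (posfun_le HI); [exact: Cc_Wp|exact: CcD|move=> x].
  have [f0|/andP[h1 h2]] := annulus_cases x hf; last first.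
    have [_ /(_ x h1 h2)/andP[w0 _]] := wW.
    by have := ler_wpM2l w0 (H (f x) (g x)); rewrite mulrDr mulrCA [W x * (C * _)]mulrCA.
  rewrite f0 normr0 powR0 ?gt_eqF// mulr0.
  have /andP[a1 _] := weight_bounds x p0 wW hg.
  have /andP[a2 _] := weight_bounds x p0 wW hd.
  by rewrite f0 in a2; apply: addr_ge0; apply: mulr_ge0 => //; rewrite ?(ltW C0)// addr_ge0// ltW.
have h1 : C * Wp W p (fun x => f x - g x) <= e / 2.
  rewrite mulrC -ler_pdivlMr//; apply: le_trans fg.
  exact: (Wp_le_Lp p0 wW hd).
have h2 : e / 2 / M' * Wp W p g <= e / 2.
  rewrite mulrAC ler_pdivrMr//; apply: ler_wpM2l; first by rewrite divr_ge0// ltW.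
  apply: (le_trans gM); rewrite /M'; apply: (@le_trans _ _ (Num.max 0 M)); last by rewrite lerDl.
  by rewrite le_max lexx orbT.
by move: step; rewrite mulrDl mul1r; move: h1 h2; lra.
Qed.

End Variational.

(** * Energy gaps *)

Section Weights.
Context {R : realType} {N : nat}.
Variable alpha : R.
Hypothesis alpha0 : 0 < alpha.
Implicit Types (f : 'rV[R]_N -> R) (x : 'rV[R]_N).

(** The parts of [Psi] inside and outside the sphere of radius 2. Since [Psi] vanishes on that
    sphere, both are continuous. *)
Definition Win x := powR `|Num.max 0 (2 - eucl x)| alpha.
Definition Wout x := powR `|Num.max 0 (eucl x - 2)| alpha.

Lemma PsiE x : Psi alpha x = Win x + Wout x.
Proof.
rewrite /Psi /Win /Wout; have [h|h] := leP (eucl x) 2.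
  rewrite [X in _ = _ + powR `|X| _]max_l; last by move: h; lra.
  rewrite max_r; last by move: h; lra.
  by rewrite normr0 powR0 ?gt_eqF// addr0 distrC.
rewrite max_l; last by move: h; lra.
rewrite max_r; last by move: h; lra.
by rewrite normr0 powR0 ?gt_eqF// add0r.
Qed.

Lemma Win_cont : continuous Win.
Proof.
apply: cont_powR => //; apply: cont_max; first exact: cont_cst.
by apply: cont_sub; [exact: cont_cst|exact: eucl_cont].
Qed.

Lemma Wout_cont : continuous Wout.
Proof.
apply: cont_powR => //; apply: cont_max; first exact: cont_cst.
by apply: cont_sub; [exact: eucl_cont|exact: cont_cst].
Qed.

Let pow01 (y : R) : `|y| <= 1 -> 0 <= powR `|y| alpha <= 1.
Proof.
move=> y1; rewrite powR_ge0 /= -[leRHS](_ : powR 1 alpha = 1); last by rewrite powR1.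
by apply: ge0_ler_powR; rewrite ?nnegrE ?(ltW alpha0).
Qed.

Lemma weight_Win : weight Win.
Proof.
split; first exact: Win_cont.
move=> x h1 h2; apply: pow01; rewrite ger0_norm ?le_max ?lexx//.
by rewrite ge_max ler01 /=; move: h1; lra.
Qed.

Lemma weight_Wout : weight Wout.
Proof.
split; first exact: Wout_cont.
move=> x h1 h2; apply: pow01; rewrite ger0_norm ?le_max ?lexx//.
by rewrite ge_max ler01 /=; move: h2; lra.
Qed.

Lemma weight_Psi : weight (Psi alpha : 'rV[R]_N -> R).
Proof.
split.
  apply: cont_powR => //; apply: cont_sub; [exact: eucl_cont|exact: cont_cst].
by move=> x h1 h2; apply: pow01; rewrite ler_norml; lra.
Qed.

Lemma Wp_Psi p f : 0 < p -> Cc f ->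
  Wp (Psi alpha) p f = Wp Win p f + Wp Wout p f.
Proof.
move=> p0 fc; rewrite -(WpD p0 Win_cont Wout_cont fc) /Wp; congr integral_RN.
by apply/funext => x; rewrite PsiE.
Qed.

(** On the annulus this is 1 - [Psi], the weight of the L^p mass that [Psi] loses; the truncation
    makes it nonnegative everywhere. *)
Definition Wrest x := Num.max 0 (1 - Psi alpha x).

Lemma Wrest_cont : continuous Wrest.
Proof.
apply: cont_max; first exact: cont_cst.
by apply: cont_sub; [exact: cont_cst|have [] := weight_Psi].
Qed.

Lemma weight_Wrest : weight Wrest.
Proof.
split; first exact: Wrest_cont.
move=> x h1 h2; have [_ /(_ x h1 h2)/andP[a b]] := weight_Psi.
by rewrite /Wrest le_max lexx /= ge_max ler01 /=; lra.
Qed.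

Lemma Lp_Psi_Wrest p f : 0 < p -> C1c_annulus f ->
  Lp p f = Wp (Psi alpha) p f + Wp Wrest p f.
Proof.
move=> p0 hf; have fc := C1c_Cc (annulus_C1c hf); have [cP wP] := weight_Psi.
rewrite -(WpD p0 cP Wrest_cont fc) /Wp /Lp; congr integral_RN; apply/funext => x.
have [->|/andP[h1 h2]] := annulus_cases x hf.
  by rewrite normr0 powR0 ?gt_eqF// mulr0.
have /andP[a b] := wP x h1 h2; rewrite /Wrest max_r; last by rewrite subr_ge0.
by rewrite addrCA subrr addr0 mul1r.
Qed.

Lemma eucl_shift x t i : eucl (x + t *: ebasis R i) ^+ 2 =
  eucl x ^+ 2 + 2 * t * x ord0 i + t ^+ 2.
Proof.
rewrite !eucl_sqr (bigD1 i)//= [\sum_i0 x ord0 i0 ^+ 2](bigD1 i)//=.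
rewrite !mxE !eqxx mulr1 (eq_bigr (fun j => x ord0 j ^+ 2)); first by ring.
by move=> j ji; rewrite !mxE (negbTE ji) andbF mulr0 addr0.
Qed.

(** The Euclidean norm is at most N times the largest coordinate; hence the scale 1/N in the later
    steps and cutoffs. *)
Lemma big_coord x : (0 < N)%N -> 1 < eucl x -> exists i, N%:R^-1 <= `|x ord0 i|.
Proof.
move=> N0 x1; have Nr : 0 < N%:R :> R by rewrite ltr0n.
apply/not_existsP => H.
have xn : `|x| <= N%:R^-1.
  apply: norm_le_coord; first by rewrite invr_ge0 ltW.
  by move=> i; rewrite leNgt; apply/negP => h; apply: (H i); exact: ltW.
have : eucl x <= 1.
  by rewrite (le_trans (eucl_le_norm x))// -ler_pdivlMl// mulr1.
by move: x1; lra.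
Qed.

(* If no coordinate step of length [tau] leaves the annulus, then [x] is at
   distance of order [tau ^+ 2] from its boundary. *)
Lemma annulus_exit f x tau : (0 < N)%N -> 0 < tau -> tau <= N%:R^-1 -> C1c_annulus f ->
  f x != 0 -> (forall i, f (x + tau *: ebasis R i) != 0) ->
  (forall i, f (x + (- tau) *: ebasis R i) != 0) ->
  Psi alpha x <= powR (1 - tau ^+ 2 / 6) alpha.
Proof.
move=> N0 t0 tN hf fx fp fm.
have Nr : 0 < N%:R :> R by rewrite ltr0n.
have N1 : N%:R^-1 <= 1 :> R by rewrite invf_le1// ler1n.
have t1 : tau <= 1 := le_trans tN N1.
have inn y : f y != 0 -> 1 < eucl y ^+ 2 /\ eucl y ^+ 2 < 9.
  move=> fy; have [fy0|/andP[h1 h2]] := annulus_cases y hf; first by rewrite fy0 eqxx in fy.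
  by split; nra.
have r0 := eucl_ge0 x.
have [r1 r9] := inn x fx.
have out : eucl x ^+ 2 < 9 - tau ^+ 2.
  pose i := Ordinal N0.
  have [_] := inn _ (fp i); have [_] := inn _ (fm i); rewrite !eucl_shift sqrrN.
  by have [h|h] := leP 0 (x ord0 i); nra.
(* Some |x_i| is at least 1/N >= tau. The step that decreases it lowers |x|^2 by 2 tau |x_i| - tau^2
   >= tau^2 and still lands in the annulus. *)
have inr : 1 + tau ^+ 2 < eucl x ^+ 2.
  have [|i hi] := @big_coord x N0; first by nra.
  have [h1 _] := inn _ (fp i); have [h2 _] := inn _ (fm i).
  rewrite !eucl_shift sqrrN in h1 h2.
  have ht : tau <= `|x ord0 i| := le_trans tN hi.
  move: ht; rewrite ler_normr => /orP[|] ht; nra.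
rewrite /Psi; apply: ge0_ler_powR; rewrite ?nnegrE ?(ltW alpha0)//; first by nra.
(* With tau^2 = 6 c and c <= 1, |x|^2 < 9 - 6 c <= (3 - c)^2 and |x|^2 > 1 + 6 c >= (1 + c)^2,
   whence | |x| - 2 | <= 1 - c. *)
set c := tau ^+ 2 / 6; have c0 : 0 < c by rewrite divr_gt0// exprn_gt0.
have tc : tau ^+ 2 = 6 * c by rewrite /c; field.
have c1 : c <= 1.
  have : tau ^+ 2 <= 1 by rewrite expr_le1// ltW.
  by rewrite tc; lra.
rewrite tc in out inr; rewrite ler_norml; apply/andP; split.
  by rewrite leNgt; apply/negP => h; nra.
by rewrite leNgt; apply/negP => h; nra.
Qed.

End Weights.

(** * Energy gap for functions with definite L^2 norm *)

Section Gap.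
Context {R : realType} {N : nat}.
Hypothesis N3 : (3 <= N)%N.
Variables (alpha S : R).
Hypothesis alpha0 : 0 < alpha.
Implicit Types (f g u : 'rV[R]_N -> R) (W : 'rV[R]_N -> R).
Let HI := @posfun_integral R N.
Notation s := (@crit_exp R N).
Hypotheses (S0 : 0 < S)
  (Ssob : forall f, C1c f -> S * powR (Lp s f) (2 / s) <= energy f).
Notation Psi := (@Psi R N alpha).

Let s2 : 2 < s. Proof. exact: crit_exp_gt2. Qed.
Let s0 : 0 < s. Proof. exact: lt_trans s2. Qed.
Let N0 : (0 < N)%N. Proof. exact: leq_trans N3. Qed.

(** Hoelder on a bounded region, where W <= W^(2/p) because W <= 1 on the annulus. The constant is
    the same for all p. *)
Lemma weighted_L2 : exists2 B : R, 1 <= B & forall W p f, weight W -> 2 < p ->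
  C1c_annulus f -> (forall x, 0 <= W x) ->
  integral_RN (fun x => W x * f x ^+ 2) <= powR (Wp W p f) (2 / p) * B.
Proof.
exists (Num.max 1 (integral_RN (plateau 3 : 'rV[R]_N -> R))); first by rewrite le_max lexx.
move=> W p f wW p2 hf W0; have p0 : 0 < p by exact: lt_trans p2.
have fc := C1c_Cc (annulus_C1c hf); have [cW hW] := wW.
have t0 : 0 < 2 / p by rewrite divr_gt0.
have t1 : 2 / p < 1 by rewrite ltr_pdivrMr// mul1r.
have H := @holder_box R N (2 / p) (fun x => W x * f x ^+ 2) (fun x => W x * powR `|f x| p)
  t0 t1 (Cc_Wp p0 cW fc).
apply: (le_trans (H _ _ _ _)).
- by move=> x; rewrite mulr_ge0 ?powR_ge0.
- by apply: CcMl => //; exact: Cc_exp.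
- move=> x; rewrite powRM ?powR_ge0// -powRrM [p * _]mulrC divfK ?gt_eqF//.
  rewrite powR_mulrn// real_normK ?num_real//.
  have [->|/andP[h1 h2]] := annulus_cases x hf; first by rewrite expr0n /= !mulr0.
  apply: ler_wpM2r; first exact: sqr_ge0.
  have /andP[w0 w1] := hW x h1 h2.
  rewrite -{1}[W x]powRr1//; apply: powR_le_exp => //; exact: ltW.
- by move=> x x3; rewrite (annulus_norm hf)// expr0n mulr0.
apply: ler_wpM2l; first exact: powR_ge0.
set B := Num.max 1 _; have B1 : 1 <= B by rewrite le_max lexx.
rewrite -[leRHS]powRr1; last exact: le_trans B1.
by apply: ler_powR => //; rewrite gerBl ltW.
Qed.

(* Points from which some step of length [tau] leaves the support carry little of
   [int f^2], since the difference quotients are bounded by the energy; at the others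
   [Psi] is bounded away from [1], so that [int |f|^p] exceeds [int Psi |f|^p]. *)
Lemma mass_gap e : 0 < e -> exists d p1 : R, [/\ 0 < d, 2 < p1, p1 < s &
  forall p f, p1 < p -> p < s -> C1c_annulus f -> Wp Psi p f = 1 ->
    e <= integral_RN (fun x => f x ^+ 2) -> S + d <= energy f].
Proof.
move=> e0; have [B B1 HB] := weighted_L2.
have Nr : 0 < N%:R :> R by rewrite ltr0n.
have B0 : 0 < B by exact: lt_le_trans B1.
(* The sum Q of the 2 N squared differences has integral at most 2 N tau^2 (S + 1) = K tau^2 / 2,
   and tau is chosen to make this at most e/2. *)
pose K : R := 4 * N%:R * (S + 1).
have K0 : 0 < K by rewrite mulr_gt0 ?mulr_gt0// addr_gt0.
pose tau := Num.min N%:R^-1 (e / (K + e)).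
have Ke : 0 < K + e by rewrite addr_gt0.
have t0 : 0 < tau by rewrite lt_min invr_gt0 Nr divr_gt0.
have tN : tau <= N%:R^-1 by rewrite ge_min lexx.
have tK : tau * (K + e) <= e by rewrite -ler_pdivlMr// ge_min lexx orbT.
have t1 : tau <= 1 by apply: (le_trans tN); rewrite invf_le1// ler1n.
have tK2 : K * tau ^+ 2 <= e.
  have : tau ^+ 2 <= tau by rewrite expr2 ger_pMl.
  by move: tK K0 e0 t0; nra.
(* A lower bound for 1 - [Psi] at the points of the support that no step of length tau leads out
   of. *)
pose c := 1 - powR (1 - tau ^+ 2 / 6) alpha.
have tt : 0 < 1 - tau ^+ 2 / 6 < 1.
  have : tau ^+ 2 <= 1 by rewrite expr_le1// ltW.
  have : 0 < tau ^+ 2 by rewrite exprn_gt0.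
  by move=> h1 h2; apply/andP; split; lra.
have c0 : 0 < c.
  rewrite subr_gt0 -[ltRHS](_ : powR 1 alpha = 1); last by rewrite powR1.
  by case/andP: tt => h1 h2; apply: gt0_ltr_powR; rewrite ?nnegrE// ltW.
have c1 : c <= 1 by rewrite gerBl powR_ge0.
(* The lost mass D satisfies D^(2/p) >= k; as k <= 1, the power m = k^(s/2) is a lower bound for D
   valid for all p < s. *)
pose k := Num.min 1 (c * e / (2 * B)).
have k0 : 0 < k by rewrite lt_min ltr01 divr_gt0 ?mulr_gt0.
have k1 : k <= 1 by rewrite ge_min lexx.
pose m := powR k (s / 2); have m0 : 0 < m by exact: powR_gt0.
pose q := powR (1 + m) (2 / s).
have q1 : 1 < q.
  rewrite -[ltLHS](_ : powR 1 (2 / s) = 1); last by rewrite powR1.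
  apply: gt0_ltr_powR; rewrite ?nnegrE ?ltrDl//; first by rewrite divr_gt0.
  by rewrite addr_ge0// ltW.
have e1 : 0 < (q - 1) / 2 by rewrite divr_gt0// subr_gt0.
have [p1 [p12 p1s H]] := sobolev_near N3 S0 Ssob e1.
(* S q <= (1 + (q - 1)/2) E is E >= S * 2 q / (1 + q). The cap at 1 covers energies above S + 1,
   which are set aside. *)
pose d := Num.min 1 (S * (2 * q / (1 + q) - 1)).
have qq : 1 < 2 * q / (1 + q) by rewrite ltr_pdivlMr; lra.
exists d, p1; split=> //.
  by rewrite lt_min ltr01 mulr_gt0// subr_gt0.
move=> p f p1p ps hf D1 fe; have p2 := lt_trans p12 p1p.
have p0 : 0 < p by exact: lt_trans p2.
have hc := annulus_C1c hf; have fc := C1c_Cc hc; have E0 := energy_ge0 hc.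
have [ES|ES] := leP (S + 1) (energy f).
  by apply: le_trans ES; rewrite lerD2l ge_min lexx.
have wR := @weight_Wrest R N alpha alpha0.
have R0 x : 0 <= @Wrest R N alpha x by rewrite le_max lexx.
have f2c : Cc (fun x => f x ^+ 2) by exact: Cc_exp.
have f0 : 0 <= integral_RN (fun x => f x ^+ 2).
  by apply: (posfun_ge0 HI f2c) => x; exact: sqr_ge0.
have Wf : Cc (fun x => @Wrest R N alpha x * f x ^+ 2).
  by apply: CcMl => //; exact: (Wrest_cont alpha0).
pose Q x := \sum_i ((f (x + tau *: ebasis R i) - f x) ^+ 2 +
                    (f (x + (- tau) *: ebasis R i) - f x) ^+ 2).
have Qi i : Cc (fun x => (f (x + tau *: ebasis R i) - f x) ^+ 2 +
                    (f (x + (- tau) *: ebasis R i) - f x) ^+ 2).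
  by apply: CcD; exact: Cc_sqdiff.
have Qc : Cc Q by apply: Cc_sum.
have QE : integral_RN Q <= N%:R * (2 * tau ^+ 2 * energy f).
  rewrite /Q (posfun_sum HI) //.
  apply: (@le_trans _ _ (\sum_(i < N) 2 * tau ^+ 2 * energy f)); last first.
    by rewrite sumr_const card_ord -[leLHS]mulr_natl.
  apply: ler_sum => i _; rewrite (posfunD HI); try exact: Cc_sqdiff.
  have h1 := sqdiff_ebasis i tau hc; have h2 := sqdiff_ebasis i (- tau) hc.
  rewrite sqrrN in h2; rewrite /sqdiff in h1 h2.
  have h3 := ler_wpM2l (sqr_ge0 tau) (pderiv_le_energy i hc).
  have h4 := le_trans h1 h3; have h5 := le_trans h2 h3.
  by have := lerD h4 h5; lra.
(* Pointwise: if some step leaves the support, one term of Q equals f^2; otherwise [Wrest] is at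
   least c. *)
have key : c * integral_RN (fun x => f x ^+ 2) <=
    c * integral_RN Q + integral_RN (fun x => @Wrest R N alpha x * f x ^+ 2).
  rewrite -(posfunZ HI _ f2c) -(posfunZ HI _ Qc) -(posfunD HI (CcZ c Qc) Wf).
  apply: (posfun_le HI (CcZ c f2c) (CcD (CcZ c Qc) Wf)) => x.
  have Q0 : 0 <= Q x by apply: sumr_ge0 => i _; rewrite addr_ge0 ?sqr_ge0.
  have wf0 : 0 <= @Wrest R N alpha x * f x ^+ 2 by rewrite mulr_ge0 ?sqr_ge0.
  have [fx|fx] := eqVneq (f x) 0.
    by rewrite fx expr0n mulr0 addr_ge0// ?mulr_ge0 ?(ltW c0)// lexx.
  have [[i /orP hi]|H0] := pselect (exists i, (f (x + tau *: ebasis R i) == 0) ||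
      (f (x + (- tau) *: ebasis R i) == 0)).
    have Qf : f x ^+ 2 <= Q x.
      rewrite /Q (bigD1 i)//=; apply: (@le_trans _ _
        ((f (x + tau *: ebasis R i) - f x) ^+ 2 + (f (x + (- tau) *: ebasis R i) - f x) ^+ 2)).
        case: hi => /eqP->; rewrite sub0r sqrrN ?lerDl ?lerDr sqr_ge0//.
      by rewrite lerDl; apply: sumr_ge0 => j _; rewrite addr_ge0 ?sqr_ge0.
    by apply: le_trans (ler_wpM2l (ltW c0) Qf) _; rewrite lerDl.
  have px := @annulus_exit R N alpha alpha0 f x tau N0 t0 tN hf fx _ _.
  have {}px : Psi x <= powR (1 - tau ^+ 2 / 6) alpha.
    apply: px => i; apply/negP => h; apply: H0; exists i; apply/orP; [by left|by right].
  have cW : c <= @Wrest R N alpha x.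
    by rewrite /Wrest le_max; apply/orP; right; rewrite /c; lra.
  apply: le_trans (ler_wpM2r (sqr_ge0 _) cW) _.
  by rewrite lerDr mulr_ge0// ltW.
set D := Wp (@Wrest R N alpha) p f.
have D0 : 0 <= D by exact: Wp_ge0.
have hB : integral_RN (fun x => @Wrest R N alpha x * f x ^+ 2) <= powR D (2 / p) * B.
  exact: HB.
have kD : k <= powR D (2 / p).
  apply: (@le_trans _ _ (c * e / (2 * B))); first by rewrite ge_min lexx orbT.
  rewrite ler_pdivrMr ?mulr_gt0//.
  have q1' : integral_RN Q <= e / 2.
    apply: (le_trans QE).
    have : N%:R * (2 * tau ^+ 2 * energy f) <= N%:R * (2 * tau ^+ 2 * (S + 1)).
      rewrite ler_pM2l// ler_wpM2l ?mulr_ge0 ?sqr_ge0//; exact: ltW.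
    move=> h; apply: (le_trans h); move: tK2; rewrite /K; lra.
  have h1 : c * integral_RN Q <= c * (e / 2) by rewrite ler_pM2l.
  have h2 : c * e <= c * integral_RN (fun x => f x ^+ 2) by rewrite ler_pM2l.
  by move: key hB h1 h2; set a := powR D _; lra.
have mD : m <= D.
  have -> : D = powR (powR D (2 / p)) (p / 2).
    by rewrite -powRrM [2 / p * _](_ : _ = 1) ?powRr1//; field; rewrite gt_eqF.
  apply: (@le_trans _ _ (powR k (p / 2))).
    apply: powR_le_exp => //; [exact: ltW|by rewrite divr_gt0|].
    by rewrite ler_pM2r ?invr_gt0// ltW.
  apply: ge0_ler_powR; rewrite ?nnegrE ?powR_ge0 ?(ltW k0)//.
  by rewrite divr_ge0// ltW.
have LD : 1 + m <= Lp p f by rewrite (Lp_Psi_Wrest alpha0 p0 hf) D1 lerD2l.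
have := H p f p1p ps hf.
have qL : q <= powR (Lp p f) (2 / p).
  apply: (@le_trans _ _ (powR (1 + m) (2 / p))).
    apply: ler_powR; first by rewrite lerDl ltW.
    by rewrite ler_pM2l// lef_pV2 ?posrE// ltW.
  apply: ge0_ler_powR; rewrite ?nnegrE//; first by rewrite divr_ge0// ltW.
    by rewrite addr_ge0// ltW.
  by rewrite (Lp_ge0 p0 fc).
have Sq := ler_wpM2l (ltW S0) qL.
move=> h; have {}h := le_trans Sq h.
apply: (@le_trans _ _ (S * (2 * q / (1 + q)))).
  rewrite /d; apply: (@le_trans _ _ (S + S * (2 * q / (1 + q) - 1))).
    by rewrite lerD2l ge_min lexx orbT.
  by lra.
have q2 : 0 < 1 + q by lra.
rewrite mulrA ler_pdivrMr//; move: h; rewrite (_ : 1 + (q - 1) / 2 = (1 + q) / 2); last by field.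
by lra.
Qed.

(** * IMS localization and splitting of the mass *)

Section Localization.
Variables (th : 'rV[R]_N -> R) (dth : 'I_N -> 'rV[R]_N -> R).
Hypothesis hth : has_grad th dth.

Lemma annulus_cos f : C1c_annulus f -> C1c_annulus (fun x => cos (th x) * f x).
Proof.
apply: annulusMl; apply: has_grad_C1.
exact: (has_grad_comp (@is_derive_cos R) (cont_opp (@continuous_sin R)) hth).
Qed.

Lemma annulus_sin f : C1c_annulus f -> C1c_annulus (fun x => sin (th x) * f x).
Proof.
apply: annulusMl; apply: has_grad_C1.
exact: (has_grad_comp (@is_derive_sin R) (@continuous_cos R) hth).
Qed.

(** Writing the quadratic partition of unity as cos and sin of one angle makes the cross terms
    cancel, leaving only f^2 times the squared gradient of the angle. *)
Lemma ims_localization f x : C1 f ->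
  grad_sq (fun x => cos (th x) * f x) x + grad_sq (fun x => sin (th x) * f x) x =
  grad_sq f x + f x ^+ 2 * \sum_i dth i x ^+ 2.
Proof.
move=> /C1_has_grad hf.
have hc := has_gradM (has_grad_comp (@is_derive_cos R) (cont_opp (@continuous_sin R)) hth) hf.
have hs := has_gradM (has_grad_comp (@is_derive_sin R) (@continuous_cos R) hth) hf.
rewrite /grad_sq (has_grad_pderiv hc) (has_grad_pderiv hs) -big_split /= mulr_sumr -big_split /=.
apply: eq_bigr => i _; have := cos2Dsin2 (th x).
set c := cos _; set t := sin _; set d := dth i x; set p := pderiv f i x; set y := f x => ct.
have -> : (- t * d * y + c * p) ^+ 2 + (c * d * y + t * p) ^+ 2 =
  (c ^+ 2 + t ^+ 2) * p ^+ 2 + (c ^+ 2 + t ^+ 2) * (y ^+ 2 * d ^+ 2) by ring.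
by rewrite ct !mul1r.
Qed.

Lemma ims_energy : exists2 C : R, 0 < C & forall f, C1c_annulus f ->
  energy (fun x => cos (th x) * f x) + energy (fun x => sin (th x) * f x) <=
  energy f + C * integral_RN (fun x => f x ^+ 2).
Proof.
have [_ cd] := hth.
have cg : continuous (fun x => \sum_i dth i x ^+ 2).
  by apply: cont_sum => i; apply: cont_exp; exact: cd.
have [C C0 CP] := Cc_bounded (@proper_rV R N) (CcMr (@Cc_plateau R 'rV[R]_N 3) cg).
exists C => // f hf; have hc := annulus_C1c hf; have fc := C1c_Cc hc.
have f2c : Cc (fun x => f x ^+ 2) by exact: Cc_exp.
have g1 := C1c_grad_sq (annulus_C1c (annulus_cos hf)).
have g2 := C1c_grad_sq (annulus_C1c (annulus_sin hf)).
have g3 := C1c_grad_sq hc.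
rewrite /energy -(posfunD HI g1 g2) -(posfunZ HI _ f2c) -(posfunD HI g3 (CcZ C f2c)).
apply: (posfun_le HI (CcD g1 g2) (CcD g3 (CcZ C f2c))) => x.
rewrite ims_localization ?lerD2l; last exact: annulus_C1.
rewrite mulrC; have [x3|x3] := leP `|x| 3; last by rewrite (annulus_norm hf)// expr0n !mulr0.
apply: ler_wpM2r; first exact: sqr_ge0.
by have := CP x; rewrite plateau1// mul1r; apply: le_trans; exact: ler_norm.
Qed.

Lemma Wp_cos_le1 p f : 0 < p -> C1c_annulus f -> Wp Psi p f = 1 ->
  0 <= Wp Psi p (fun x => cos (th x) * f x) <= 1.
Proof.
move=> p0 hf D1; have wP := @weight_Psi R N alpha alpha0; have [cP hP] := wP.
have hc := annulus_cos hf.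
rewrite (Wp_ge0 p0 wP hc) /= -D1; apply: (posfun_le HI).
- exact: (Cc_Wp p0 cP (C1c_Cc (annulus_C1c hc))).
- exact: (Cc_Wp p0 cP (C1c_Cc (annulus_C1c hf))).
- move=> x; apply: ler_wpM2l; first exact: powR_ge0.
  apply: ge0_ler_powR; rewrite ?nnegrE ?(ltW p0)// normrM ler_piMl//.
  by rewrite ler_norml cos_geN1 cos_le1.
Qed.

Lemma Wp_sin_le1 p f : 0 < p -> C1c_annulus f -> Wp Psi p f = 1 ->
  0 <= Wp Psi p (fun x => sin (th x) * f x) <= 1.
Proof.
move=> p0 hf D1; have wP := @weight_Psi R N alpha alpha0; have [cP hP] := wP.
have hc := annulus_sin hf.
rewrite (Wp_ge0 p0 wP hc) /= -D1; apply: (posfun_le HI).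
- exact: (Cc_Wp p0 cP (C1c_Cc (annulus_C1c hc))).
- exact: (Cc_Wp p0 cP (C1c_Cc (annulus_C1c hf))).
- move=> x; apply: ler_wpM2l; first exact: powR_ge0.
  apply: ge0_ler_powR; rewrite ?nnegrE ?(ltW p0)// normrM ler_piMl//.
  by rewrite ler_norml sin_geN1 sin_le1.
Qed.

Let half_absorb (a z b : R) : a + z <= b + z / 2 -> a + z / 2 <= b.
Proof. by lra. Qed.

(** The exponent lam is strictly above 2/s, so that 2/p <= lam for p near s; masses are at most 1,
    hence their powers 2/p dominate their powers lam and the hypothesis keeps a fixed exponent. If
    int f^2 is at least mu, [mass_gap] applies; otherwise the localization error is small. *)
Lemma split_gap (lam kap : R) : 2 / s < lam -> 0 < kap ->
  exists d p1 : R, [/\ 0 < d, 2 < p1, p1 < s &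
  forall p f, p1 < p -> p < s -> C1c_annulus f -> Wp Psi p f = 1 ->
    1 + kap <= powR (Wp Psi p (fun x => cos (th x) * f x)) lam +
               powR (Wp Psi p (fun x => sin (th x) * f x)) lam ->
    S + d <= energy f].
Proof.
move=> hl k0; have [C C0 HC] := ims_energy.
have lam0 : 0 < lam by apply: lt_trans hl; rewrite divr_gt0.
have e1 : 0 < kap / 4 by rewrite divr_gt0.
have [p1 [p12 p1s H]] := sobolev_near N3 S0 Ssob e1.
(* Defined by (1 + kap) = (1 + kap/4) (1 + k'): the gain left after the loss kap/4 in the
   subcritical Sobolev inequality. *)
pose k' := (3 * kap / 4) / (1 + kap / 4).
have k'0 : 0 < k' by rewrite divr_gt0 ?addr_gt0// divr_gt0// mulr_gt0.
(* The localization error C int f^2 then consumes at most half of the gain S k'. *)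
pose mu := S * k' / (2 * C).
have mu0 : 0 < mu by apply: divr_gt0; apply: mulr_gt0.
have [d2 [p2 [d20 p22 p2s H2]]] := mass_gap mu0.
pose d := Num.min d2 (S * k' / 2).
pose p3 := Num.max (Num.max p1 p2) (2 / lam).
exists d, p3; split.
- by rewrite lt_min d20 divr_gt0// mulr_gt0.
- by rewrite !lt_max p12.
- by rewrite !gt_max p1s p2s /= ltr_pdivrMr// mulrC -ltr_pdivrMr.
move=> p f; rewrite !gt_max => /andP[/andP[pp1 pp2] pl] ps hf D1 HA.
have p0 : 0 < p by apply: lt_trans pp1; apply: lt_trans p12.
have [mu_le|mu_le] := leP mu (integral_RN (fun x => f x ^+ 2)).
  by apply: le_trans (H2 p f pp2 ps hf D1 mu_le); rewrite lerD2l ge_min lexx.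
have wP := @weight_Psi R N alpha alpha0.
have hc := annulus_cos hf; have hs := annulus_sin hf.
have t0 : 0 < 2 / p by rewrite divr_gt0.
have tl : 2 / p <= lam by rewrite ler_pdivrMr// mulrC -ler_pdivrMr// ltW.
have step g : C1c_annulus g -> 0 <= Wp Psi p g <= 1 ->
    S * powR (Wp Psi p g) lam <= (1 + kap / 4) * energy g.
  move=> hg /andP[w0 w1]; apply: le_trans (H p g pp1 ps hg).
  apply: ler_wpM2l; first exact: ltW.
  apply: (@le_trans _ _ (powR (Wp Psi p g) (2 / p))).
    exact: powR_le_exp.
  apply: ge0_ler_powR; rewrite ?nnegrE ?(ltW t0)//.
    by rewrite (Lp_ge0 p0)//; exact: C1c_Cc (annulus_C1c hg).
  exact: Wp_le_Lp.
have h1 := step _ hc (Wp_cos_le1 p0 hf D1).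
have h2 := step _ hs (Wp_sin_le1 p0 hf D1).
have h3 := HC f hf.
have h4 : C * integral_RN (fun x => f x ^+ 2) <= S * k' / 2.
  apply: (@le_trans _ _ (C * mu)); first by rewrite ler_pM2l// ltW.
  by rewrite /mu le_eqVlt; apply/orP; left; apply/eqP; field; rewrite gt_eqF.
have h5 : S * (1 + kap) <= (1 + kap / 4) * (energy f + S * k' / 2).
  apply: (@le_trans _ _ (S * (powR (Wp Psi p (fun x => cos (th x) * f x)) lam +
     powR (Wp Psi p (fun x => sin (th x) * f x)) lam))); first by rewrite ler_pM2l.
  rewrite mulrDr; apply: (le_trans (lerD h1 h2)); rewrite -mulrDr.
  apply: ler_wpM2l; first by rewrite addr_ge0// ltW.
  by apply: (le_trans h3); rewrite lerD2l.
have kk : 0 < 1 + kap / 4 by rewrite addr_gt0.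
have h6 : S * (1 + kap) = (1 + kap / 4) * (S + S * k').
  by rewrite /k'; field; rewrite gt_eqF// addr_gt0.
rewrite h6 ler_pM2l// in h5.
apply: (@le_trans _ _ (S + S * k' / 2)); first by rewrite lerD2l ge_min lexx orbT.
exact: half_absorb.
Qed.

End Localization.
End Gap.

(** * A C^1 angle for the localization *)

Section Cutoff.
Context {R : realType}.

(* A C^1 step from [0] on [y <= -1] to [pi / 2] on [1 <= y]. *)
Definition hcut (y : R) : R := pi / 4 * (sqpos (y + 1) - 2 * sqpos y + sqpos (y - 1)).

Let sqposN (z : R) : sqpos z + sqpos (- z) = z ^+ 2.
Proof.
rewrite /sqpos; have [h|h] := leP 0 z.
  by rewrite max_l ?oppr_le0// expr0n addr0.
by rewrite max_r ?sqrrN ?oppr_ge0 1?ltW// expr0n add0r.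
Qed.

Let sqpos_le0 (z : R) : z <= 0 -> sqpos z = 0.
Proof. by move=> h; rewrite /sqpos max_l// expr0n. Qed.

Lemma hcut_lo y : y <= -1 -> hcut y = 0.
Proof. by move=> h; rewrite /hcut !sqpos_le0; [ring|lra|lra|lra]. Qed.

(** By this symmetry a reflection of the argument exchanges the cosine piece and the sine piece. *)
Lemma hcutN y : hcut (- y) = pi / 2 - hcut y.
Proof.
apply/eqP; rewrite eq_sym subr_eq eq_sym; apply/eqP; rewrite /hcut.
have h1 := sqposN (y + 1); have h2 := sqposN y; have h3 := sqposN (y - 1).
have -> : - y + 1 = - (y - 1) by ring.
have -> : - y - 1 = - (y + 1) by ring.
rewrite -mulrDr.
have -> : sqpos (- (y - 1)) - 2 * sqpos (- y) + sqpos (- (y + 1)) +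
  (sqpos (y + 1) - 2 * sqpos y + sqpos (y - 1)) =
  (sqpos (y + 1) + sqpos (- (y + 1))) - 2 * (sqpos y + sqpos (- y)) +
  (sqpos (y - 1) + sqpos (- (y - 1))) by ring.
by rewrite h1 h2 h3; field.
Qed.

Lemma hcut_hi y : 1 <= y -> hcut y = pi / 2.
Proof.
by move=> h; rewrite -[y]opprK hcutN hcut_lo ?subr0// lerN2.
Qed.

Lemma has_grad_hcut N (phi : 'rV[R]_N -> R) dphi : has_grad phi dphi ->
  exists dth, has_grad (fun x => hcut (phi x)) dth.
Proof.
move=> h; have c (k : R) := has_grad_cst N k.
have sq psi dpsi (hp : @has_grad R N psi dpsi) :=
  has_grad_comp (@is_derive_sqpos R) (@sqpos_cont R) hp.
have h1 := sq _ _ (has_gradD h (c 1)); have h2 := sq _ _ h.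
have h3 := sq _ _ (has_gradB h (c 1)).
have := has_gradZ (pi / 4) (has_gradD (has_gradB h1 (has_gradZ 2 h2)) h3).
by move=> H; eexists; exact: H.
Qed.

End Cutoff.

(** * Gaps for balanced and for symmetric mass *)

Section Gaps.
Context {R : realType} {N : nat}.
Hypothesis N3 : (3 <= N)%N.
Variables (alpha S : R).
Hypothesis alpha0 : 0 < alpha.
Implicit Types (f g u : 'rV[R]_N -> R) (W : 'rV[R]_N -> R).
Let HI := @posfun_integral R N.
Notation s := (@crit_exp R N).
Hypotheses (S0 : 0 < S)
  (Ssob : forall f, C1c f -> S * powR (Lp s f) (2 / s) <= energy f).
Notation Psi := (@Psi R N alpha).
Notation Win := (@Win R N alpha).
Notation Wout := (@Wout R N alpha).

Let s2 : 2 < s. Proof. exact: crit_exp_gt2. Qed.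
Let s0 : 0 < s. Proof. exact: lt_trans s2. Qed.
Let N0 : (0 < N)%N. Proof. exact: leq_trans N3. Qed.
Let ts0 : 0 < 2 / s. Proof. by rewrite divr_gt0. Qed.
Let ts1 : 2 / s < 1. Proof. by rewrite ltr_pdivrMr// mul1r. Qed.

(** Strict concavity made quantitative: x^l is x divided by x^(1-l), and x <= 3/4. *)
Let pow_lb (l x : R) : 0 < l -> l < 1 -> 0 <= x -> x <= 3 / 4 ->
  x * powR (4 / 3) (1 - l) <= powR x l.
Proof.
move=> l0 l1; rewrite le_eqVlt => /orP[/eqP<- _|x0 x1].
  by rewrite mul0r powR_ge0.
have X0 : 0 < powR x (1 - l) by exact: powR_gt0.
have -> : powR x l = x / powR x (1 - l).
  have -> : l = 1 - (1 - l) by ring.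
  rewrite powRB ?powRr1 ?(ltW x0)//; first by rewrite (_ : 1 - (1 - (1 - l)) = 1 - l)//; ring.
  by rewrite (gt_eqF x0) implybT.
rewrite ler_pdivlMr// -mulrA; apply: ler_piMr; first exact: ltW.
rewrite -powRM; [|by lra|exact: ltW].
rewrite -[leRHS](_ : powR 1 (1 - l) = 1); last by rewrite powR1.
by apply: ge0_ler_powR; rewrite ?nnegrE; lra.
Qed.

Let bal_arith (a b e q : R) : a + b = 1 -> e * (4 * q) = q - 1 ->
  1 + (q - 1) / 2 <= (a - e + (b - e)) * q.
Proof. move=> h1 h2; have -> : a - e + (b - e) = 1 - 2 * e by lra. nra. Qed.

(** The cut is made at the sphere of radius 2, where [Psi] vanishes, so a thin transition layer
    carries almost no mass. The pieces then keep essentially the masses of the two sides, neither of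
    which exceeds 3/4. *)
Lemma balance_gap : exists d p1 : R, [/\ 0 < d, 2 < p1, p1 < s &
  forall p f, p1 < p -> p < s -> C1c_annulus f -> Wp Psi p f = 1 ->
    1 / 4 <= Wp Wout p f -> Wp Wout p f <= 3 / 4 -> S + d <= energy f].
Proof.
pose l := (2 / s + 1) / 2.
have l1 : l < 1 by rewrite /l; move: ts1; lra.
have ls : 2 / s < l by rewrite /l; move: ts1; lra.
have l0 : 0 < l by exact: lt_trans ls.
pose q : R := powR (4 / 3) (1 - l).
have q1 : 1 < q.
  rewrite -[ltLHS](_ : powR 1 (1 - l) = 1); last by rewrite powR1.
  by apply: gt0_ltr_powR; rewrite ?nnegrE; lra.
have q0 : 0 < q by lra.
(* Each side may lose e1, and (1 - 2 e1) q = 1 + (q - 1)/2 = 1 + kap. Also e1 < 1/4 keeps the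
   reduced masses nonnegative. *)
pose e1 := (q - 1) / (4 * q).
have e10 : 0 < e1 by rewrite divr_gt0 ?mulr_gt0// subr_gt0.
have e1q : e1 * (4 * q) = q - 1 by rewrite /e1 divfK// gt_eqF// mulr_gt0.
have e14 : e1 < 1 / 4 by move: e1q q1 e10; nra.
pose kap := (q - 1) / 2; have kap0 : 0 < kap by rewrite divr_gt0// subr_gt0.
have [C [p1 [C0 p12 p1s HC]]] := Lp_bounded N3 S0 Ssob.
(* In the layer of half-width eta, [Psi] is at most eta^alpha = e1 / C, so its mass is at most
   e1. *)
pose eta := powR (e1 / C) alpha^-1.
have eta0 : 0 < eta by rewrite powR_gt0// divr_gt0.
have etaa : powR eta alpha = e1 / C.
  by rewrite /eta -powRrM mulVf ?gt_eqF// powRr1// divr_ge0// ltW.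
(* The square of the radius is smooth. Since phi = (r - 2)(r + 2)/eta and r + 2 >= 1, phi lies
   beyond -1 or 1 outside the layer. *)
pose phi x := eta^-1 * ((\sum_j (x : 'rV[R]_N) ord0 j ^+ 2) - 4).
have [dth hth] : exists dth, has_grad (fun x => hcut (phi x)) dth.
  apply: has_grad_hcut.
  exact: (has_gradZ eta^-1 (has_gradB (@has_grad_sqnorm R N) (has_grad_cst N 4))).
have [d [p2 [d0 p22 p2s Hd]]] := split_gap N3 alpha0 S0 Ssob hth ls kap0.
exists (Num.min d 1), (Num.max p1 p2); split.
- by rewrite lt_min d0 ltr01.
- by rewrite lt_max p12.
- by rewrite gt_max p1s.
move=> p f; rewrite gt_max => /andP[pp1 pp2] ps hf D1 o1 o2.
have p0 : 0 < p by apply: lt_trans pp1; apply: lt_trans p12.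
have [ES|ES] := leP (S + 1) (energy f).
  by apply: le_trans ES; rewrite lerD2l ge_min lexx orbT.
apply: (@le_trans _ _ (S + d)); first by rewrite lerD2l ge_min lexx.
apply: (Hd p f pp2 ps hf D1).
have fc := C1c_Cc (annulus_C1c hf).
have LC := HC p f pp1 ps hf (ltW ES).
have cPsi : continuous Psi by have [] := @weight_Psi R N alpha alpha0.
have wi := @weight_Win R N alpha alpha0; have wo := @weight_Wout R N alpha alpha0.
have hc := annulus_cos hth hf; have hs := annulus_sin hth hf.
have hcc := C1c_Cc (annulus_C1c hc); have hsc := C1c_Cc (annulus_C1c hs).
have io : Wp Win p f + Wp Wout p f = 1 by rewrite -(Wp_Psi alpha0 p0 fc).
have ph (r : R) x : eucl x = r -> phi x = (r - 2) * (r + 2) / eta.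
  by move=> <-; rewrite /phi -eucl_sqr mulrC; congr (_ / _); ring.
have Win0 x : 0 <= Win x by exact: powR_ge0.
have Wout0 x : 0 <= Wout x by exact: powR_ge0.
have eL : e1 / C * Lp p f <= e1.
  by rewrite mulrAC ler_pdivrMr// ler_pM2l.
have lowin : Wp Win p f - e1 <= Wp Psi p (fun x => cos (hcut (phi x)) * f x).
  apply: (@le_trans _ _ (Wp Win p f - e1 / C * Lp p f)); first by rewrite lerD2l lerN2.
  have c1 := Cc_Wp p0 (Win_cont alpha0) fc; have c2 := Cc_powR p0 fc.
  rewrite /Wp /Lp -(posfunZ HI _ c2) -(posfunB HI c1 (CcZ _ c2)).
  apply: (posfun_le HI (CcB c1 (CcZ _ c2)) (Cc_Wp p0 cPsi hcc)) => x.
  have a0 : 0 <= powR `|f x| p by exact: powR_ge0.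
  have [h|h] := leP (2 - eucl x) eta.
    apply: (@le_trans _ _ 0); last by rewrite mulr_ge0 ?powR_ge0.
    rewrite -mulrBl mulr_le0_ge0// subr_le0 -etaa /Win.
    apply: ge0_ler_powR; rewrite ?nnegrE ?(ltW alpha0) ?(ltW eta0)//.
    by rewrite ger0_norm ?le_max ?lexx// ge_max (ltW eta0).
  have r0 := eucl_ge0 x.
  rewrite hcut_lo ?cos0 ?mul1r; last first.
    rewrite (ph _ x erefl) ler_pdivrMr// mulN1r; nra.
  rewrite PsiE// mulrDl; apply: (@le_trans _ _ (Win x * powR `|f x| p)).
    by rewrite gerBl mulr_ge0// divr_ge0// ltW.
  by rewrite lerDl mulr_ge0.
have lowout : Wp Wout p f - e1 <= Wp Psi p (fun x => sin (hcut (phi x)) * f x).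
  apply: (@le_trans _ _ (Wp Wout p f - e1 / C * Lp p f)); first by rewrite lerD2l lerN2.
  have c1 := Cc_Wp p0 (Wout_cont alpha0) fc; have c2 := Cc_powR p0 fc.
  rewrite /Wp /Lp -(posfunZ HI _ c2) -(posfunB HI c1 (CcZ _ c2)).
  apply: (posfun_le HI (CcB c1 (CcZ _ c2)) (Cc_Wp p0 cPsi hsc)) => x.
  have a0 : 0 <= powR `|f x| p by exact: powR_ge0.
  have [h|h] := leP (eucl x - 2) eta.
    apply: (@le_trans _ _ 0); last by rewrite mulr_ge0 ?powR_ge0.
    rewrite -mulrBl mulr_le0_ge0// subr_le0 -etaa /Wout.
    apply: ge0_ler_powR; rewrite ?nnegrE ?(ltW alpha0) ?(ltW eta0)//.
    by rewrite ger0_norm ?le_max ?lexx// ge_max (ltW eta0).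
  have r0 := eucl_ge0 x.
  rewrite hcut_hi ?sin_pihalf ?mul1r; last first.
    rewrite (ph _ x erefl) ler_pdivlMr// mul1r; nra.
  rewrite PsiE// mulrDl; apply: (@le_trans _ _ (Wout x * powR `|f x| p)).
    by rewrite gerBl mulr_ge0// divr_ge0// ltW.
  by rewrite lerDr mulr_ge0.
have mono a b : 0 <= a -> a <= 3 / 4 -> a <= b -> a * q <= powR b l.
  move=> a0 a1 ab; apply: (le_trans (pow_lb l0 l1 a0 a1)).
  by apply: ge0_ler_powR; rewrite ?nnegrE ?(ltW l0)//; exact: le_trans ab.
have m1 := mono _ _ _ _ lowin; have m2 := mono _ _ _ _ lowout.
have M1 : (Wp Win p f - e1) * q <= powR (Wp Psi p (fun x => cos (hcut (phi x)) * f x)) l.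
  by apply: m1; move: io o1 o2 e14 e10; lra.
have M2 : (Wp Wout p f - e1) * q <= powR (Wp Psi p (fun x => sin (hcut (phi x)) * f x)) l.
  by apply: m2; move: io o1 o2 e14 e10; lra.
apply: le_trans (lerD M1 M2); rewrite -mulrDl.
exact: bal_arith io e1q.
Qed.

(** The mass of f for this weight is the [Psi]-mass of f times the cosine. The cutoff in x_i
    switches between -1/N and 1/N. *)
Definition Wcos p (i : 'I_N) (x : 'rV[R]_N) :=
  Psi x * powR `|cos (hcut (N%:R * x ord0 i))| p.
Definition Wsin p (i : 'I_N) (x : 'rV[R]_N) :=
  Psi x * powR `|sin (hcut (N%:R * x ord0 i))| p.

Let hth i : exists dth, has_grad (fun x : 'rV[R]_N => hcut (N%:R * x ord0 i)) dth.
Proof. by apply: has_grad_hcut; exact: (has_gradZ _ (has_grad_coord i)). Qed.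

Let weight_pow (p : R) (h : 'rV[R]_N -> R) : 0 < p -> continuous h -> (forall x, `|h x| <= 1) ->
  weight (fun x => Psi x * powR `|h x| p).
Proof.
move=> p0 ch h1; have [cP hP] := @weight_Psi R N alpha alpha0; split.
  by apply: cont_mul => //; exact: cont_powR.
move=> x x1 x2; have /andP[a b] := hP x x1 x2.
rewrite mulr_ge0 ?powR_ge0//=; apply: mulr_ile1 => //.
rewrite -[leRHS](_ : powR 1 p = 1); last by rewrite powR1.
by apply: ge0_ler_powR; rewrite ?nnegrE ?(ltW p0).
Qed.

Lemma weight_Wcos p i : 0 < p -> weight (Wcos p i).
Proof.
move=> p0; apply: weight_pow => //; last by move=> x; exact: cos_max.
have [dth h] := hth i; exact: (cont_comp (@continuous_cos R) (has_grad_cont h)).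
Qed.

Lemma weight_Wsin p i : 0 < p -> weight (Wsin p i).
Proof.
move=> p0; apply: weight_pow => //; last by move=> x; exact: sin_max.
have [dth h] := hth i; exact: (cont_comp (@continuous_sin R) (has_grad_cont h)).
Qed.

(** Some coordinate has |x_i| >= 1/N, where one of the two factors is 1 and the other 0; every other
    coordinate contributes at least 2^(1 - p/2) by convexity. *)
Let Wcos_sum (p : R) (x : 'rV[R]_N) : 2 < p -> 1 < eucl x ->
  1 + (N%:R - 1) * powR 2 (1 - p / 2) <=
  \sum_i (powR `|cos (hcut (N%:R * x ord0 i))| p + powR `|sin (hcut (N%:R * x ord0 i))| p).
Proof.
move=> p2 x1; have [i hi] := @big_coord R N x N0 x1.
have p0 : 0 < p by exact: lt_trans p2.
have Nr : 0 < N%:R :> R by rewrite ltr0n.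
have each t : powR 2 (1 - p / 2) <= powR `|cos t| p + powR `|sin t| p :> R.
  have e (y : R) : powR `|y| p = powR (y ^+ 2) (p / 2).
    rewrite -[y ^+ 2]real_normK ?num_real// -powR_mulrn// -powRrM; congr powR; by field.
  rewrite !e; apply: powR_sum_ge; rewrite ?sqr_ge0//; last exact: cos2Dsin2.
  by move: p2; lra.
rewrite (bigD1 i)//=; apply: lerD.
  have := hi; rewrite ler_normr => /orP[|] h.
    have h' : 1 <= N%:R * x ord0 i by rewrite -ler_pdivrMl// mulr1.
    by rewrite hcut_hi// cos_pihalf sin_pihalf normr0 normr1 powR0 ?gt_eqF// powR1 add0r.
  have h' : N%:R * x ord0 i <= -1 by rewrite -ler_pdivlMl// mulrN1 lerNr.
  by rewrite hcut_lo// cos0 sin0 normr0 normr1 powR0 ?gt_eqF// powR1 addr0.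
apply: (@le_trans _ _ (\sum_(j < N | j != i) powR 2 (1 - p / 2))); last by apply: ler_sum.
rewrite sumr_const -[leRHS]mulr_natl; apply: ler_wpM2r; first exact: powR_ge0.
rewrite (_ : #|[pred j | j != i]| = N.-1); last first.
  by rewrite cardC1 card_ord.
by rewrite -subn1 natrB.
Qed.

(** Summed over the coordinates, the pieces have mass at least 1 + (N - 1) cs with cs = 2^(1 - s/2)
    < 1. If they are nearly equal, each exceeds cs/2 = 2^(-s/2), whose power 2/s is exactly 1/2, so
    the two pieces for i0 together cost more than S. The hypotheses allow an error e2, as symmetry
    holds only in the limit. *)
Lemma symmetry_gap (i0 : 'I_N) : exists d p1 e2 : R, [/\ 0 < d, 2 < p1, p1 < s, 0 < e2 &
  forall p f, p1 < p -> p < s -> C1c_annulus f -> Wp Psi p f = 1 ->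
    Wp (Wcos p i0) p f <= Wp (Wsin p i0) p f + e2 ->
    Wp (Wsin p i0) p f <= Wp (Wcos p i0) p f + e2 ->
    (forall i, Wp (Wcos p i) p f <= Wp (Wcos p i0) p f + e2) ->
    (forall i, Wp (Wsin p i) p f <= Wp (Wsin p i0) p f + e2) ->
    S + d <= energy f].
Proof.
have Nr : 0 < N%:R :> R by rewrite ltr0n.
pose cs : R := powR 2 (1 - s / 2).
have cs0 : 0 < cs by exact: powR_gt0.
have cs1 : cs < 1.
  rewrite -[ltRHS](powRr0 2) /cs ltNge; apply/negP => h.
  have h2 : powR 2 (1 - s / 2) <= powR 2 ((1 - s / 2) / 2) :> R by apply: ler_powR; move: s2; lra.
  have h3 : powR 2 (1 - s / 2) * powR 2 (s / 2 - 1) = 1 :> R.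
    by rewrite -powRD ?pnatr_eq0 ?implybT// (_ : 1 - s / 2 + (s / 2 - 1) = 0) ?powRr0//; ring.
  have h4 := @bernoulli R 2 (s / 2).
  have {}h4 : 1 + s / 2 * (2 - 1) <= powR 2 (s / 2) by apply: h4; move: s2; lra.
  have h5 : powR 2 (1 - s / 2) * powR 2 (s / 2) = 2 :> R.
    by rewrite -powRD ?pnatr_eq0 ?implybT// (_ : 1 - s / 2 + s / 2 = 1) ?powRr1//; ring.
  by rewrite powRr0 in h; move: s2 h4 h5 h; nra.
(* The surplus of A + B over cs is (1 - cs)/N = 8 e2; the near equalities cost 2 e2 and then half of
   e2, which leaves A and B above cs/2 + 2 e2. *)
pose e2 := (1 - cs) / (8 * N%:R).
have e20 : 0 < e2 by rewrite divr_gt0 ?mulr_gt0// subr_gt0.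
pose a := cs / 2 + 2 * e2.
have a0 : 0 < a by apply: addr_gt0; [exact: divr_gt0|exact: mulr_gt0].
have [l ls al] : exists2 l, 2 / s < l & 1 / 2 < powR a l.
  have base : 1 / 2 < powR a (2 / s).
    have -> : 1 / 2 = powR (cs / 2) (2 / s) :> R.
      rewrite /cs powRB ?pnatr_eq0 ?implybT// powRr1// mulrAC divff ?mul1r//.
      rewrite -powRN -powRrM (_ : - (s / 2) * (2 / s) = -1); last by field; rewrite gt_eqF.
      by rewrite powR_inv1// div1r.
    have h0 : 0 < cs / 2 by exact: divr_gt0.
    apply: gt0_ltr_powR; [exact: ts0|by rewrite nnegrE; exact: ltW|by rewrite nnegrE; exact: ltW|].
    by rewrite ltrDl; exact: mulr_gt0.
  (* An exponent slightly above 2/s is wanted while [near_left] works from below, so the variable is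
     reflected at 2/s. *)
  have c : {for 2 / s, continuous (fun t : R => - powR a (2 / s + 2 / s - t))}.
    have cg : {for 2 / s, continuous (fun t : R => 2 / s + 2 / s - t)}.
      by apply: cvgB; [exact: cvg_cst|exact: cvg_id].
    exact: cvgN (cont_powR_exp a0 cg).
  have [|t1 t1s ht] := near_left (c := - (1 / 2)) c; first by rewrite addrK ltrN2.
  pose t := (t1 + 2 / s) / 2.
  exists (2 / s + 2 / s - t); first by rewrite /t; move: t1s; lra.
  by rewrite -ltrN2; apply: ht; rewrite /t; move: t1s; lra.
pose kap := 2 * powR a l - 1; have kap0 : 0 < kap by rewrite /kap; move: al; lra.
have [dth h] := hth i0.
have [d [p1 [d0 p12 p1s Hd]]] := split_gap N3 alpha0 S0 Ssob h ls kap0.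
exists d, p1, e2; split=> // p f pp1 ps hf D1 h1 h2 h3 h4.
apply: (Hd p f pp1 ps hf D1).
have p2 := lt_trans p12 pp1; have p0 : 0 < p by exact: lt_trans p2.
have fc := C1c_Cc (annulus_C1c hf).
have cE : Wp Psi p (fun x => cos (hcut (N%:R * x ord0 i0)) * f x) = Wp (Wcos p i0) p f.
  by congr integral_RN; apply/funext => x; rewrite normrM powRM// mulrA.
have sE : Wp Psi p (fun x => sin (hcut (N%:R * x ord0 i0)) * f x) = Wp (Wsin p i0) p f.
  by congr integral_RN; apply/funext => x; rewrite normrM powRM// mulrA.
rewrite cE sE; set A := Wp (Wcos p i0) p f in h1 h2 h3 *; set B := Wp (Wsin p i0) p f in h1 h2 h4 *.
pose cp : R := powR 2 (1 - p / 2).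
have cps : cs <= cp by apply: ler_powR; [rewrite ler1n|move: ps; lra].
have total : 1 + (N%:R - 1) * cp <= \sum_i (Wp (Wcos p i) p f + Wp (Wsin p i) p f).
  have cPsi : continuous Psi by have [] := @weight_Psi R N alpha alpha0.
  have wPsi : forall x, 0 <= Psi x by move=> x; exact: powR_ge0.
  have cc i : Cc (fun x => Wcos p i x * powR `|f x| p).
    by apply: Cc_Wp => //; have [] := weight_Wcos i p0.
  have cs' i : Cc (fun x => Wsin p i x * powR `|f x| p).
    by apply: Cc_Wp => //; have [] := weight_Wsin i p0.
  have -> : 1 + (N%:R - 1) * cp = (1 + (N%:R - 1) * cp) * Wp Psi p f by rewrite D1 mulr1.
  have -> : \sum_i (Wp (Wcos p i) p f + Wp (Wsin p i) p f) =
     integral_RN (fun x => \sum_i (Wcos p i x * powR `|f x| p + Wsin p i x * powR `|f x| p)).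
    rewrite (posfun_sum HI); last by move=> i; exact: CcD.
    by apply: eq_bigr => i _; rewrite (posfunD HI (cc i) (cs' i)).
  have c1 := Cc_Wp p0 cPsi fc.
  rewrite /Wp -(posfunZ HI _ c1); apply: (posfun_le HI (CcZ _ c1)).
    by apply: Cc_sum => i; exact: CcD.
  move=> x; have [->|/andP[x1 x2]] := annulus_cases x hf.
    by rewrite normr0 powR0 ?gt_eqF// !mulr0; apply: sumr_ge0 => i _; rewrite !mulr0 addr0.
  have := Wcos_sum p2 x1; set T := \sum_i _ => hT.
  rewrite (_ : \sum_i _ = T * (Psi x * powR `|f x| p)).
    by apply: ler_wpM2r => //; rewrite mulr_ge0 ?powR_ge0.
  rewrite /T mulr_suml; apply: eq_bigr => i _; rewrite /Wcos /Wsin; ring.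
have tot2 : \sum_i (Wp (Wcos p i) p f + Wp (Wsin p i) p f) <= N%:R * (A + B + 2 * e2).
  apply: (@le_trans _ _ (\sum_(i < N) (A + B + 2 * e2))); last first.
    by rewrite sumr_const card_ord -[leLHS]mulr_natl.
  by apply: ler_sum => i _; have := h3 i; have := h4 i; lra.
have e2N : 8 * N%:R * e2 = 1 - cs by rewrite /e2; field; rewrite gt_eqF.
have sumAB : cs + 6 * e2 <= A + B.
  have := le_trans total tot2; set n := N%:R in Nr e2N *.
  have n1 : 1 <= n by rewrite /n ler1n.
  have : 0 <= (n - 1) * (cp - cs) by rewrite mulr_ge0// subr_ge0.
  move=> k1 k2; have : n * (cs + 6 * e2) <= n * (A + B) by move: k1 k2 e2N; nra.
  by rewrite ler_pM2l.
have aA : a <= A by rewrite /a; move: sumAB h2 h1 e20; lra.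
have aB : a <= B by rewrite /a; move: sumAB h2 h1 e20; lra.
have l0 : 0 < l by exact: lt_trans ls.
have mono b : a <= b -> powR a l <= powR b l.
  move=> ab; apply: ge0_ler_powR; rewrite ?nnegrE ?(ltW l0) ?(ltW a0)//.
  by apply: le_trans ab; exact: ltW.
rewrite /kap addrC subrK mulr_natl mulr2n; exact: lerD (mono _ aA) (mono _ aB).
Qed.

End Gaps.

(** * Concentrating test functions *)

Section TestFunctions.
Context {R : realType} {N : nat}.
Hypothesis N3 : (3 <= N)%N.
Variables (alpha S : R).
Hypothesis alpha0 : 0 < alpha.
Implicit Types (f g u : 'rV[R]_N -> R).
Let HI := @posfun_integral R N.
Notation s := (@crit_exp R N).
Notation Psi := (@Psi R N alpha).

Let s2 : 2 < s. Proof. exact: crit_exp_gt2. Qed.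
Let s0 : 0 < s. Proof. exact: lt_trans s2. Qed.
Let N0 : (0 < N)%N. Proof. exact: leq_trans N3. Qed.
Let Nr : 0 < N%:R :> R. Proof. by rewrite ltr0n. Qed.

Let shell (rho t r y : R) : 0 <= t -> 0 <= r -> 0 <= rho -> `|y| <= t ->
  r ^+ 2 = t ^+ 2 + 2 * rho * y + rho ^+ 2 -> `|r - rho| <= t.
Proof.
move=> t0 r0 q0; rewrite !ler_norml => /andP[y1 y2] h; apply/andP; split.
  have k : 0 <= rho * (y + t) by rewrite mulr_ge0//; lra.
  rewrite lerBrDl -subr_ge0; case: (ltP (r - (rho - t)) 0) => // k2; nra.
have k : 0 <= rho * (t - y) by rewrite mulr_ge0//; lra.
by case: (leP (r - rho) t) => // k2; nra.
Qed.

(** 2/s = (N - 2)/N: under dilation the energy and the critical norm squared scale alike. *)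
Let scale_pow (l : R) : 0 < l -> powR (l ^+ N)^-1 (2 / s) = l ^+ 2 * (l ^+ N)^-1.
Proof.
move=> l0; have N2 : 0 < N%:R - 2 :> R by rewrite subr_gt0 (ltr_nat _ 2).
rewrite -!powR_mulrn ?(ltW l0)// -!powRN -powRrM -powRD ?(gt_eqF l0) ?implybT//.
by congr powR; rewrite /crit_exp; field; rewrite !gt_eqF.
Qed.

(** The function is moved to the point at distance rho on an axis and shrunk by l = N K / eta; the
    factor N turns the bound on coordinates into a Euclidean one. The critical quotient does not
    change. *)
Lemma concentrate f (C rho eta : R) : C1c f -> 0 < Lp s f -> 0 < rho -> 0 < eta ->
  energy f < C * powR (Lp s f) (2 / s) ->
  exists g, [/\ C1c g, 0 < Lp s g, energy g < C * powR (Lp s g) (2 / s) &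
    forall x, g x != 0 -> `|eucl x - rho| <= eta].
Proof.
move=> hf L0 rho0 eta0 hE; have fc := C1c_Cc hf.
have [K K0 fK] := Cc_supp fc.
pose i0 := Ordinal N0.
pose l := N%:R * K / eta; have l0 : 0 < l by apply: divr_gt0 => //; apply: mulr_gt0.
pose a := - ((l * rho) *: ebasis R i0).
pose g x := f (l *: x + a).
have hg := has_grad_affine l a (C1c_grad hf).
have axE x : l *: x + a = l *: (x - rho *: ebasis R i0).
  by rewrite /a scalerBr scalerA.
have gsupp x : g x != 0 -> `|eucl x - rho| <= eta.
  move=> gx; pose y := x - rho *: ebasis R i0.
  have yl : `|l *: y| <= K.
    by rewrite leNgt; apply/negP => /fK; rewrite /y -axE => /eqP; rewrite -[_ == 0]negbK gx.
  have ty : eucl y <= eta.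
    apply: (le_trans (eucl_le_norm y)); rewrite -ler_pdivlMl//.
    rewrite normrZ gtr0_norm// /l in yl.
    rewrite -(ler_pM2l K0) -(ler_pM2r Nr) -(ler_pM2r (_ : 0 < eta^-1)) ?invr_gt0//.
    have -> : K * `|y| * N%:R / eta = N%:R * K / eta * `|y| by ring.
    apply: (le_trans yl); rewrite le_eqVlt; apply/orP; left; apply/eqP.
    by field; rewrite !gt_eqF.
  have sh := eucl_shift y rho i0; rewrite /y subrK -/y in sh.
  apply: le_trans ty; apply: (shell (eucl_ge0 _) (eucl_ge0 _) (ltW rho0) _ sh).
  exact: coord_le_eucl.
have hg1 : C1c g.
  split; first exact: has_grad_C1 hg.
  exists (rho + eta) => x hx; apply/eqP; apply: contraT => /gsupp.
  by rewrite ler_norml => /andP[_]; have := norm_le_eucl x; move: hx; lra.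
have eE : energy g = l ^+ 2 * (l ^+ N)^-1 * energy f.
  have c := C1c_grad_sq hf.
  have := integral_affine a l0 (CcZ (l ^+ 2) c); rewrite (posfunZ HI _ c) => h.
  rewrite -mulrA mulrCA -h; congr integral_RN; apply/funext => x.
  rewrite /grad_sq (has_grad_pderiv hg) mulr_sumr; apply: eq_bigr => i _.
  by rewrite exprMn.
have LE : Lp s g = (l ^+ N)^-1 * Lp s f by exact: integral_affine (Cc_powR s0 fc).
have lN : 0 < (l ^+ N)^-1 by rewrite invr_gt0 exprn_gt0.
exists g; split; [exact: hg1|by rewrite LE; exact: mulr_gt0| |exact: gsupp].
rewrite eE LE (powRM _ (ltW lN) (ltW L0)) (scale_pow l0) mulrCA ltr_pM2l; first exact: hE.
by apply: mulr_gt0 => //; exact: exprn_gt0.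
Qed.

Hypotheses (S0 : 0 < S)
  (Sopt : forall e, 0 < e -> exists f, [/\ C1c f, 0 < Lp s f &
    energy f < (S + e) * powR (Lp s f) (2 / s)]).

(** One function g, nearly optimal at p = s, serves all p near s: with |g| <= M one has |g|^p >=
    M^(p-s) |g|^s, so its mass has a lower bound continuous in p and no limit under the integral is
    taken. *)
Lemma shell_test (e b rho eta : R) : 0 < e -> 0 < b -> 0 < eta ->
  1 < rho - eta -> rho + eta < 3 ->
  (forall r, `|r - rho| <= eta -> b <= `|r - 2|) ->
  S + e / 2 <= (S + e) * powR (powR b alpha) (2 / s) ->
  exists p1, [/\ 2 < p1, p1 < s & forall p, p1 < p -> p < s ->
    exists f, [/\ C1c_annulus f, Wp Psi p f = 1, energy f < S + e &
      forall x, f x != 0 -> `|eucl x - rho| <= eta]].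
Proof.
move=> e0 b0 eta0 r1 r2 hb hS.
have rho0 : 0 < rho by move: r1; lra.
have [f [hf L0 hE]] := Sopt (divr_gt0 e0 (ltr0n _ 2)).
have [g [hg Lg Eg gs]] := concentrate hf L0 rho0 eta0 hE.
move=> {f hf L0 hE}.
have gc := C1c_Cc hg; have [M1 M10 gM1] := Cc_bounded (@proper_rV R N) gc.
pose M := Num.max 1 M1; have M0 : 0 < M by rewrite lt_max ltr01.
have gM x : `|g x| <= M by rewrite le_max gM1 orbT.
have ba0 : 0 < powR b alpha by exact: powR_gt0.
pose D := powR b alpha * Lp s g; have D0 : 0 < D by exact: mulr_gt0.
pose phi p := - ((S + e) * (powR D (2 / p) * powR M ((p - s) * (2 / p)))).
have cdiv : {for s, continuous (fun p : R => 2 / p)} by apply: cvg_div2; rewrite gt_eqF.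
have cphi : {for s, continuous phi}.
  have cexp : {for s, continuous (fun p : R => (p - s) * (2 / p))}.
    by apply: cvgM => //; apply: cvgB; [exact: cvg_id|exact: cvg_cst].
  apply: cvgN; apply: cvgM; first exact: cvg_cst.
  exact: cvgM (cont_powR_exp D0 cdiv) (cont_powR_exp M0 cexp).
have phis : phi s < - energy g.
  rewrite /phi ltrN2 subrr mul0r powRr0 mulr1 /D powRM ?(ltW ba0) ?(ltW Lg)// mulrA.
  by apply: (lt_le_trans Eg); apply: ler_wpM2r hS; exact: powR_ge0.
have [p1 p1s Hp] := near_left cphi phis.
exists (Num.max p1 ((2 + s) / 2)); split.
- by rewrite lt_max; apply/orP; right; move: s2; lra.
- by rewrite gt_max p1s /=; move: s2; lra.
move=> p; rewrite gt_max => /andP[pp1 pp2] ps.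
have p2 : 2 < p by move: pp2 s2; lra.
have p0 : 0 < p by exact: lt_trans p2.
have cP : continuous Psi by have [] := @weight_Psi R N alpha alpha0.
have ga : C1c_annulus g.
  have [[h1 h2] _] := hg; split=> //; split=> //.
  exists ((1 + (rho - eta)) / 2), ((3 + (rho + eta)) / 2).
  split; [by move: r1; lra|by move: r1 r2 eta0; lra|by move: r2; lra|].
  move=> x hx; apply/eqP; apply: contraT => /gs; rewrite ler_norml => /andP[k1 k2].
  by case: hx => hx; move: hx r1 r2 k1 k2; lra.
have wc := Cc_Wp p0 cP gc.
have low : D * powR M (p - s) <= Wp Psi p g.
  rewrite /D mulrAC -(posfunZ HI _ (Cc_powR s0 gc)).
  apply: (posfun_le HI (CcZ _ (Cc_powR s0 gc)) wc) => x.
  have [->|gx] := eqVneq (g x) 0.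
    by rewrite normr0 !powR0 ?(gt_eqF p0) ?(gt_eqF s0)// !mulr0.
  have g0 : 0 < `|g x| by rewrite normr_gt0.
  rewrite -mulrA; apply: ler_pM; [exact: ltW|by rewrite mulr_ge0 ?powR_ge0| |].
    by apply: ge0_ler_powR; rewrite ?nnegrE ?(ltW alpha0) ?(ltW b0)//; apply/hb/gs.
  have -> : powR `|g x| s = powR `|g x| (s - p) * powR `|g x| p.
    by rewrite -powRD ?subrK// normr_eq0 gx implybT.
  rewrite mulrA; apply: ler_piMl; first exact: powR_ge0.
  have -> : p - s = - (s - p) by rewrite opprB.
  rewrite powRN ler_pdivrMl ?powR_gt0// mulr1.
  by apply: ge0_ler_powR; rewrite ?nnegrE ?(ltW M0) ?subr_ge0 ?(ltW ps).
pose W := Wp Psi p g.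
have W0 : 0 < W by apply: lt_le_trans low; rewrite mulr_gt0// powR_gt0.
have key : energy g < (S + e) * powR W (2 / p).
  have := Hp p pp1 ps; rewrite /phi ltrN2 => h; apply: (lt_le_trans h).
  apply: ler_wpM2l; first by rewrite addr_ge0// ltW.
  rewrite [powR M _]powRrM -(powRM _ (ltW D0) (powR_ge0 _ _)).
  apply: ge0_ler_powR; rewrite ?nnegrE ?(ltW W0)//; first by rewrite divr_ge0// ltW.
  by rewrite mulr_ge0 ?powR_ge0// ltW.
pose c := powR W (- p^-1); have c0 : 0 < c by exact: powR_gt0.
exists (fun x => c * g x); split; first exact: annulusZ.
- rewrite WpZ// gtr0_norm// /c -powRrM mulNr mulVf ?gt_eqF//.
  by rewrite powR_inv1 ?(ltW W0)// mulVf ?gt_eqF.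
- rewrite energyZ// /c -powR_mulrn ?powR_ge0// -powRrM mulNr mulrC.
  have -> : p^-1 * 2%:R = 2 / p by rewrite mulrC.
  by rewrite powRN ltr_pdivrMr// powR_gt0.
- by move=> x; rewrite mulf_eq0 (gt_eqF c0) /=; exact: gs.
Qed.

Let pick_b e : 0 < e -> exists b : R, [/\ 0 < b, b < 1 &
  S + e / 2 <= (S + e) * powR (powR b alpha) (2 / s)].
Proof.
move=> e0; pose q := (S + e / 2) / (S + e).
have Se : 0 < S + e by exact: addr_gt0.
have q0 : 0 < q by apply: divr_gt0 => //; apply: addr_gt0 => //; exact: divr_gt0.
have q1 : q < 1 by rewrite ltr_pdivrMr// mul1r ltrD2l ltr_pdivrMr// ltr_pMr// ltr1n.
have k0 : 0 < s / (2 * alpha) by rewrite divr_gt0// mulr_gt0.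
exists (powR q (s / (2 * alpha))); split; first exact: powR_gt0.
  rewrite -[ltRHS](_ : powR 1 (s / (2 * alpha)) = 1); last by rewrite powR1.
  by apply: gt0_ltr_powR; rewrite ?nnegrE ?(ltW q0).
rewrite -!powRrM [X in powR q X](_ : _ = 1); last by field; rewrite !gt_eqF.
rewrite (powRr1 (ltW q0)) [_ * q]mulrC /q divfK; first exact: lexx.
by rewrite gt_eqF.
Qed.

Let pick_eta (b : R) : b < 1 -> exists eta : R, [/\ 0 < eta, eta <= 1 / 12 & b <= 1 - 3 * eta].
Proof.
move=> b1; exists (Num.min (1 / 12) ((1 - b) / 3)); split.
- by rewrite lt_min; apply/andP; split; lra.
- by rewrite ge_min lexx.
- have : Num.min (1 / 12) ((1 - b) / 3) <= (1 - b) / 3 by rewrite ge_min lexx orbT.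
  by lra.
Qed.

(** A shell of half-width eta centred at distance 2 eta from a boundary sphere stays in the annulus
    and has |r - 2| >= 1 - 3 eta, so [Psi] is close to 1 on it. *)
Let test_at e (W : 'rV[R]_N -> R) (rh : R -> R) : 0 < e ->
  (forall eta, 0 < eta -> eta <= 1 / 12 ->
    [/\ 1 < rh eta - eta, rh eta + eta < 3,
      forall r, `|r - rh eta| <= eta -> 1 - 3 * eta <= `|r - 2| &
      forall x, `|eucl x - rh eta| <= eta -> W x = 0]) ->
  exists p1, [/\ 2 < p1, p1 < s & forall p, p1 < p -> p < s ->
    exists f, [/\ C1c_annulus f, Wp Psi p f = 1, energy f < S + e & Wp W p f = 0]].
Proof.
move=> e0 H; have [b [b0 b1 hS]] := pick_b e0; have [eta [eta0 eta1 hb]] := pick_eta b1.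
have [h1 h2 h3 h4] := H eta eta0 eta1.
have h5 r : `|r - rh eta| <= eta -> b <= `|r - 2| by move=> /h3; apply: le_trans.
have [p1 [p12 p1s Hp]] := shell_test e0 b0 eta0 h1 h2 h5 hS.
exists p1; split=> // p pp1 ps; have [f [f1 f2 f3 f4]] := Hp p pp1 ps.
have p0 : 0 < p by apply: lt_trans pp1; apply: lt_trans p12.
exists f; split=> //; rewrite /Wp -[RHS](posfun0 HI); congr integral_RN; apply/funext => x.
have [->|/f4/h4->] := eqVneq (f x) 0; last by rewrite mul0r.
by rewrite normr0 powR0 ?gt_eqF// mulr0.
Qed.

Lemma test_in e : 0 < e -> exists p1, [/\ 2 < p1, p1 < s & forall p, p1 < p -> p < s ->
  exists f, [/\ C1c_annulus f, Wp Psi p f = 1, energy f < S + e & Wp (Wout alpha) p f = 0]].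
Proof.
move=> e0; apply: (@test_at e (@Wout R N alpha) (fun eta => 1 + 2 * eta) e0).
move=> eta h1 h2; split; [lra|lra| |].
  by move=> r; rewrite ler_norml => /andP[a1 a2]; rewrite distrC ler_normr; apply/orP; left; lra.
move=> x; rewrite ler_norml => /andP[a1 a2]; rewrite /Wout max_l; last by lra.
by rewrite normr0 powR0// gt_eqF.
Qed.

Lemma test_out e : 0 < e -> exists p1, [/\ 2 < p1, p1 < s & forall p, p1 < p -> p < s ->
  exists f, [/\ C1c_annulus f, Wp Psi p f = 1, energy f < S + e & Wp (Win alpha) p f = 0]].
Proof.
move=> e0; apply: (@test_at e (@Win R N alpha) (fun eta => 3 - 2 * eta) e0).
move=> eta h1 h2; split; [lra|lra| |].
  by move=> r; rewrite ler_norml => /andP[a1 a2]; rewrite ler_normr; apply/orP; left; lra.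
move=> x; rewrite ler_norml => /andP[a1 a2]; rewrite /Win max_l; last by lra.
by rewrite normr0 powR0// gt_eqF.
Qed.

End TestFunctions.

(** * Limits of H^1 Cauchy sequences *)

Section Sequences.
Context {R : realType} {N : nat}.
Hypothesis N3 : (3 <= N)%N.
Variable S : R.
Implicit Types (f g : 'rV[R]_N -> R) (u v w : nat -> 'rV[R]_N -> R) (W : 'rV[R]_N -> R).
Let HI := @posfun_integral R N.
Notation s := (@crit_exp R N).
Hypotheses (S0 : 0 < S)
  (Ssob : forall f, C1c f -> S * powR (Lp s f) (2 / s) <= energy f).

Lemma real_cauchy_cvg (x : nat -> R) :
  (forall e : R, 0 < e -> exists M, forall m n, (M <= m)%N -> (M <= n)%N -> `|x m - x n| < e) ->
  cvgn x.
Proof.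
move=> H; apply/cauchy_cvgP; apply: cauchy_exP => e e0.
have [M HM] := H e e0; exists (x M); exists M => // n Mn.
exact: HM.
Qed.

Lemma lim_lt (x : nat -> R) (c : R) : cvgn x -> limn x < c ->
  exists n0, forall n, (n0 <= n)%N -> x n < c.
Proof. by move=> cx h; have [n0 _ H] := cvgr_lt _ cx _ h; exists n0. Qed.

Let young (t a b : R) : 0 < t -> (a + b) ^+ 2 <= (1 + t) * a ^+ 2 + (1 + t^-1) * b ^+ 2.
Proof.
move=> t0; have k0 : 0 < t^-1 by rewrite invr_gt0.
have h : t^-1 * t = 1 by rewrite mulVf// gt_eqF.
have : 0 <= t^-1 * (t * a - b) ^+ 2 by rewrite mulr_ge0 ?sqr_ge0// ltW.
have -> : t^-1 * (t * a - b) ^+ 2 =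
  (t^-1 * t) * (t * a ^+ 2) - 2 * (t^-1 * t) * a * b + t^-1 * b ^+ 2 by ring.
by rewrite h; move: t^-1 {h k0} => k; nra.
Qed.

(** Minkowski's inequality from the family of Young inequalities, optimal at t = sqrt (G / F); if F
    or G is 0, an extreme t is used instead. *)
Let sqrt_triangle (A F G : R) : 0 <= A -> 0 <= F -> 0 <= G ->
  (forall t, 0 < t -> A <= (1 + t) * F + (1 + t^-1) * G) ->
  Num.sqrt A <= Num.sqrt F + Num.sqrt G.
Proof.
move=> A0 F0 G0 H.
have [Fz|Fn] := eqVneq F 0.
  rewrite Fz sqrtr0 add0r ler_wsqrtr// leNgt; apply/negP => AG.
  have d0 : 0 < A - G by rewrite subr_gt0.
  pose t := (G + 1) / (A - G); have t0 : 0 < t by rewrite divr_gt0// ltr_wpDl.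
  have := H t t0; rewrite Fz mulr0 add0r mulrDl mul1r -lerBlDl.
  rewrite ler_pdivlMl// /t divfK ?gt_eqF//; lra.
have [Gz|Gn] := eqVneq G 0.
  rewrite Gz sqrtr0 addr0 ler_wsqrtr// leNgt; apply/negP => AF.
  have d0 : 0 < A - F by rewrite subr_gt0.
  have F1 : 0 < F by rewrite lt_neqAle eq_sym Fn.
  pose t := (A - F) / (2 * F); have t0 : 0 < t by rewrite divr_gt0// mulr_gt0.
  have := H t t0; rewrite Gz mulr0 addr0 mulrDl mul1r -lerBlDl.
  have -> : t * F = (A - F) / 2 by rewrite /t; field.
  by move: d0; lra.
have F1 : 0 < Num.sqrt F by rewrite sqrtr_gt0 lt_neqAle eq_sym Fn.
have G1 : 0 < Num.sqrt G by rewrite sqrtr_gt0 lt_neqAle eq_sym Gn.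
rewrite -(@ler_pXn2r _ 2) ?nnegrE ?sqrtr_ge0 ?addr_ge0 ?sqrtr_ge0// sqr_sqrtr//.
apply: (le_trans (H _ (divr_gt0 G1 F1))).
rewrite -[X in _ * X + _](sqr_sqrtr F0) -[X in _ + _ * X](sqr_sqrtr G0).
rewrite le_eqVlt; apply/orP; left; apply/eqP; field.
by rewrite !gt_eqF.
Qed.

Let grad_young t f g x : 0 < t -> C1 f -> C1 g ->
  grad_sq (fun x => f x + g x) x <= (1 + t) * grad_sq f x + (1 + t^-1) * grad_sq g x.
Proof.
move=> t0 hf hg; rewrite /grad_sq !mulr_sumr -big_split /=; apply: ler_sum => i _.
by rewrite pderivD//; exact: young.
Qed.

Lemma h1sqE f : C1c f -> h1sq f = integral_RN (fun x => f x ^+ 2) + energy f.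
Proof.
move=> hf; have fc := C1c_Cc hf.
exact: (posfunD HI (Cc_exp (isT : (0 < 2)%N) fc) (C1c_grad_sq hf)).
Qed.

Let sq_ge0 f : Cc f -> 0 <= integral_RN (fun x => f x ^+ 2).
Proof.
by move=> fc; apply: (posfun_ge0 HI (Cc_exp (isT : (0 < 2)%N) fc)) => x; exact: sqr_ge0.
Qed.

Lemma energy_le_h1sq f : C1c f -> energy f <= h1sq f.
Proof. by move=> hf; rewrite h1sqE// lerDr; exact: sq_ge0 (C1c_Cc hf). Qed.

Lemma h1sq_ge0 f : C1c f -> 0 <= h1sq f.
Proof. by move=> hf; apply: le_trans (energy_le_h1sq hf); exact: energy_ge0. Qed.

Lemma L2_le_energy f : C1c_annulus f -> integral_RN (fun x => f x ^+ 2) <= 49 * energy f.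
Proof.
move=> hf; have N0 : (0 < N)%N by exact: leq_trans N3.
have := poincare (Ordinal N0) (annulus_C1c hf) (ltr0n R 3) (annulus_norm hf).
by have -> : (2 * 3 + 1) ^+ 2 = 49 :> R by ring.
Qed.

Lemma h1sq_le_energy f : C1c_annulus f -> h1sq f <= 50 * energy f.
Proof.
move=> hf; rewrite h1sqE; last exact: annulus_C1c.
by have := L2_le_energy hf; move: (energy f) (integral_RN _) => a b; lra.
Qed.

Let h1_triangle f g : C1c_annulus f -> C1c_annulus g ->
  Num.sqrt (h1sq (fun x => f x + g x)) <= Num.sqrt (h1sq f) + Num.sqrt (h1sq g).
Proof.
move=> hf hg; have hs := annulusD hf hg.
have hf' := annulus_C1c hf; have hg' := annulus_C1c hg; have hs' := annulus_C1c hs.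
have sq (k : 'rV[R]_N -> R) : C1c k -> Cc (fun x => k x ^+ 2 + grad_sq k x).
  by move=> hk; apply: CcD; [exact: Cc_exp (C1c_Cc hk)|exact: C1c_grad_sq].
apply: sqrt_triangle; try exact: h1sq_ge0.
move=> t t0; rewrite /h1sq -(posfunZ HI _ (sq _ hf')) -(posfunZ HI _ (sq _ hg')).
rewrite -(posfunD HI (CcZ _ (sq _ hf')) (CcZ _ (sq _ hg'))).
apply: (posfun_le HI (sq _ hs') (CcD (CcZ _ (sq _ hf')) (CcZ _ (sq _ hg')))) => x.
have h1 := young (f x) (g x) t0; have h2 := grad_young x t0 (annulus_C1 hf) (annulus_C1 hg).
by rewrite !mulrDr addrACA; exact: lerD h1 h2.
Qed.

Let en_triangle f g : C1c_annulus f -> C1c_annulus g ->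
  Num.sqrt (energy (fun x => f x + g x)) <= Num.sqrt (energy f) + Num.sqrt (energy g).
Proof.
move=> hf hg; have hs := annulusD hf hg.
have cf := C1c_grad_sq (annulus_C1c hf); have cg := C1c_grad_sq (annulus_C1c hg).
have cs := C1c_grad_sq (annulus_C1c hs).
apply: sqrt_triangle; try (by apply: energy_ge0; exact: annulus_C1c).
move=> t t0; rewrite /energy -(posfunZ HI _ cf) -(posfunZ HI _ cg).
rewrite -(posfunD HI (CcZ _ cf) (CcZ _ cg)).
apply: (posfun_le HI cs (CcD (CcZ _ cf) (CcZ _ cg))) => x.
exact: grad_young (annulus_C1 hf) (annulus_C1 hg).
Qed.

Let sqrt_lip (Q : ('rV[R]_N -> R) -> R) f g :
  (forall f g, C1c_annulus f -> C1c_annulus g ->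
    Num.sqrt (Q (fun x => f x + g x)) <= Num.sqrt (Q f) + Num.sqrt (Q g)) ->
  (forall f, C1c_annulus f -> Q f <= h1sq f) ->
  C1c_annulus f -> C1c_annulus g ->
  `|Num.sqrt (Q f) - Num.sqrt (Q g)| <= Num.sqrt (h1sq (fun x => f x - g x)).
Proof.
move=> tri QH hf hg.
have H a b : C1c_annulus a -> C1c_annulus b ->
    Num.sqrt (Q a) - Num.sqrt (Q b) <= Num.sqrt (h1sq (fun x => a x - b x)).
  move=> ha hb; have hd := annulusB ha hb.
  rewrite lerBlDl; apply: (@le_trans _ _ (Num.sqrt (Q b) + Num.sqrt (Q (fun x => a x - b x)))).
    by have := tri _ _ hb hd; rewrite [X in Q X](_ : _ = a)//; apply/funext => x; rewrite addrC subrK.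
  by rewrite lerD2l; apply: ler_wsqrtr; exact: QH.
have sw : h1sq (fun x => g x - f x) = h1sq (fun x => f x - g x).
  have hd := annulus_C1 (annulusB hf hg).
  have e : (fun x => g x - f x) = (fun x => -1 * (f x - g x)).
    by apply/funext => x; rewrite mulN1r opprB.
  rewrite e /h1sq; congr integral_RN; apply/funext => x.
  by rewrite (grad_sqZ (-1) x hd) mulN1r !sqrrN expr1n mul1r.
rewrite ler_norml; apply/andP; split; last exact: H.
by rewrite lerNl opprB -sw; exact: H.
Qed.

Lemma H10_annulus u n : H10 u -> C1c_annulus (u n).
Proof. by case. Qed.

Let H10_sqrt_cvg (Q : ('rV[R]_N -> R) -> R) w :
  (forall f g, C1c_annulus f -> C1c_annulus g ->
    Num.sqrt (Q (fun x => f x + g x)) <= Num.sqrt (Q f) + Num.sqrt (Q g)) ->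
  (forall f, C1c_annulus f -> Q f <= h1sq f) ->
  H10 w -> cvgn (fun n => Num.sqrt (Q (w n))).
Proof.
move=> tri QH [hw cw]; apply: real_cauchy_cvg => e e0.
have [M HM] := cw _ (exprn_gt0 2 e0); exists M => m n Mm Mn.
apply: (le_lt_trans (sqrt_lip tri QH (hw m) (hw n))).
have h := HM m n Mm Mn.
by rewrite -[ltRHS](gtr0_norm e0) -sqrtr_sqr ltr_sqrt ?exprn_gt0.
Qed.

(** [h1dist] is a [limn], which says something about the sequence only once convergence is known. *)
Lemma H10_h1_cvg w : H10 w -> cvgn (fun n => Num.sqrt (h1sq (w n))).
Proof. by apply: H10_sqrt_cvg; [exact: h1_triangle|]. Qed.

Lemma H10_energy_cvg w : H10 w -> cvgn (fun n => energy (w n)).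
Proof.
move=> hw; have c : cvgn (fun n => Num.sqrt (energy (w n))).
  apply: H10_sqrt_cvg hw; first exact: en_triangle.
  by move=> f hf; apply: energy_le_h1sq; exact: annulus_C1c.
have -> : (fun n => energy (w n)) = (fun n => Num.sqrt (energy (w n)) * Num.sqrt (energy (w n))).
  apply/funext => n; rewrite -expr2 sqr_sqrtr//; apply: energy_ge0.
  by apply: annulus_C1c; exact: H10_annulus.
exact: is_cvgM.
Qed.

Lemma energy_young2 f g : C1c_annulus f -> C1c_annulus g ->
  energy (fun x => f x - g x) <= 2 * energy f + 2 * energy g.
Proof. by move=> hf hg; have [] := energyB_le (annulus_C1c hf) (annulus_C1c hg). Qed.

(** By the Poincare inequality on the annulus the Cauchy condition needs to be checked for the
    energy alone; 100 is twice the constant 50. *)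
Lemma H10P w : (forall n, C1c_annulus (w n)) ->
  (forall e : R, 0 < e -> exists M, forall m n, (M <= m)%N -> (M <= n)%N ->
    energy (fun x => w m x - w n x) <= e) -> H10 w.
Proof.
move=> hw H; split=> // e e0.
have [M HM] := H (e / 100) (divr_gt0 e0 (ltr0n _ 100)); exists M => m n Mm Mn.
have h1 := HM m n Mm Mn; have h2 := h1sq_le_energy (annulusB (hw m) (hw n)).
apply: (le_lt_trans h2); apply: (@le_lt_trans _ _ (50 * (e / 100))).
  by rewrite ler_pM2l.
by move: e0; lra.
Qed.

Lemma H10_energy w : H10 w -> forall e : R, 0 < e ->
  exists M, forall m n, (M <= m)%N -> (M <= n)%N -> energy (fun x => w m x - w n x) <= e.
Proof.
move=> [hw cw] e e0; have [M HM] := cw e e0; exists M => m n Mm Mn.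
have hd := annulus_C1c (annulusB (hw m) (hw n)).
apply: (le_trans (energy_le_h1sq hd)); apply: ltW; exact: HM.
Qed.

Lemma H10B u v : H10 u -> H10 v -> H10 (fun n x => u n x - v n x).
Proof.
move=> hu hv; apply: H10P => [n|e e0].
  by apply: annulusB; exact: H10_annulus.
have e4 : 0 < e / 4 by rewrite divr_gt0.
have [M1 H1] := H10_energy hu e4; have [M2 H2] := H10_energy hv e4.
exists (maxn M1 M2) => m n; rewrite !geq_max => /andP[a1 a2] /andP[b1 b2].
have k1 := H1 m n a1 b1; have k2 := H2 m n a2 b2.
have d1 := annulusB (H10_annulus m hu) (H10_annulus n hu).
have d2 := annulusB (H10_annulus m hv) (H10_annulus n hv).
have -> : (fun x => u m x - v m x - (u n x - v n x)) =
          (fun x => (u m x - u n x) - (v m x - v n x)).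
  by apply/funext => x; ring.
apply: (le_trans (energy_young2 d1 d2)).
by move: k1 k2; move: (energy _) (energy _) => a b; lra.
Qed.

Lemma H10_rotate (c : R) (A : 'M[R]_N) u : orthogonal_mx A -> H10 u ->
  H10 (fun n x => c * rotate A u n x).
Proof.
move=> oA hu; apply: H10P => [n|e e0].
  by apply: annulusZ; apply: (annulus_mulmx oA); exact: H10_annulus.
have c1 : 0 < c ^+ 2 + 1 by rewrite ltr_wpDl// sqr_ge0.
have [M HM] := H10_energy hu (divr_gt0 e0 c1).
exists M => m n Mm Mn; have hd := annulusB (H10_annulus m hu) (H10_annulus n hu).
have hr := annulus_mulmx oA hd.
have -> : (fun x => c * rotate A u m x - c * rotate A u n x) =
          (fun x => c * (u m (x *m A) - u n (x *m A))).
  by apply/funext => x; rewrite mulrBr.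
rewrite (energyZ c (annulus_C1c hr)).
have -> : energy (fun x => u m (x *m A) - u n (x *m A)) = energy (fun x => u m x - u n x).
  rewrite /energy -[RHS](integral_orthogonal oA (C1c_grad_sq (annulus_C1c hd))).
  by congr integral_RN; apply/funext => x; exact: (grad_sq_mulmx x oA (annulus_C1 hd)).
have h := HM m n Mm Mn; have E0 := energy_ge0 (annulus_C1c hd).
rewrite ler_pdivlMr// mulrC in h; apply: le_trans h.
by apply: ler_wpM2r => //; rewrite lerDl.
Qed.

Lemma h1dist_lt u v (d : R) : H10 u -> H10 v -> h1dist u v < d ->
  exists n0, forall n, (n0 <= n)%N -> energy (fun x => u n x - v n x) <= d ^+ 2.
Proof.
move=> hu hv hd; have hw := H10B hu hv.
have [n0 H] := lim_lt (H10_h1_cvg hw) hd.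
exists n0 => n nn; have h := H n nn; have cw := annulus_C1c (H10_annulus n hw).
apply: (le_trans (energy_le_h1sq cw)).
rewrite -[leLHS](sqr_sqrtr (h1sq_ge0 cw)).
have a0 := sqrtr_ge0 (h1sq (fun x => u n x - v n x)).
rewrite ler_pXn2r ?nnegrE//; first exact: ltW.
by apply: le_trans a0 _; exact: ltW.
Qed.

Lemma h1dist_le0 u v (e : R) : H10 u -> H10 v -> ~ 0 < h1dist u v -> 0 < e ->
  exists n0, forall n, (n0 <= n)%N -> energy (fun x => u n x - v n x) <= e.
Proof.
move=> hu hv /negP; rewrite -leNgt => hd e0.
have se : 0 < Num.sqrt e by rewrite sqrtr_gt0.
have [n0 H] := h1dist_lt hu hv (le_lt_trans hd se).
by exists n0 => n /H; rewrite sqr_sqrtr// ltW.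
Qed.

Lemma nonzero_lb u (c : R) : H10 u -> 0 < c -> (forall n, c <= energy (u n)) -> nonzero u.
Proof.
move=> hu c0 H; rewrite /nonzero /h1dist.
have -> : (fun n => Num.sqrt (h1sq (u n \- (fun=> 0)))) = (fun n => Num.sqrt (h1sq (u n))).
  apply/funext => n; congr (Num.sqrt (h1sq _)); apply/funext => x; exact: subr0.
apply: (@lt_le_trans _ _ (Num.sqrt c)); first by rewrite sqrtr_gt0.
apply: limr_ge; first exact: H10_h1_cvg.
near=> n; apply: ler_wsqrtr; apply: (le_trans (H n)); apply: energy_le_h1sq.
by apply: annulus_C1c; exact: H10_annulus.
Unshelve. all: by end_near. Qed.

Lemma LpBC (p : R) f g : Lp p (fun x => f x - g x) = Lp p (fun x => g x - f x).
Proof. by congr integral_RN; apply/funext => x; rewrite distrC. Qed.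

Lemma Wp_close (p M e : R) : 0 < p -> 0 < e -> exists2 eta : R, 0 < eta &
  forall W f g, weight W -> C1c_annulus f -> C1c_annulus g ->
    Wp W p g <= M -> Lp p (fun x => f x - g x) <= eta -> `|Wp W p f - Wp W p g| <= e.
Proof.
move=> p0 e0; have [eta h0 H] := @Wp_cont R N p (M + e) e p0 e0.
exists eta => // W f g wW hf hg gM fg.
have h1 : Wp W p f <= Wp W p g + e.
  by apply: H => //; apply: (le_trans gM); rewrite lerDl ltW.
have h2 : Wp W p g <= Wp W p f + e.
  by apply: H => //; [apply: (le_trans h1); rewrite lerD2r|rewrite LpBC].
rewrite ler_norml; apply/andP; split; last by rewrite lerBlDl.
by rewrite lerNl opprB lerBlDl.
Qed.

(** Energies along a Cauchy sequence are eventually bounded, and for p < s a small energy of the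
    difference forces a small change of mass. *)
Lemma H10_Wp_cvg W (p : R) v : 2 < p -> p < s -> weight W -> H10 v ->
  cvgn (fun n => Wp W p (v n)).
Proof.
move=> p2 ps wW hv; have p0 : 0 < p by exact: lt_trans p2.
have [C C0 HC] := Lp_le_energy N3 S0 Ssob p2 ps.
pose L := limn (fun n => energy (v n)).
have L1 : L < L + 1 by rewrite ltrDl.
have [n0 Hn0] := lim_lt (H10_energy_cvg hv) L1.
pose M := C * powR (L + 1) (p / 2).
have bd n : (n0 <= n)%N -> Wp W p (v n) <= M.
  move=> nn; have hn := H10_annulus n hv.
  apply: (le_trans (Wp_le_Lp p0 wW hn)); apply: (le_trans (HC _ hn)).
  have E0 := energy_ge0 (annulus_C1c hn); have h := Hn0 n nn.
  rewrite ler_pM2l//; apply: ge0_ler_powR; rewrite ?nnegrE//.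
  - by rewrite divr_ge0// ltW.
  - by apply: le_trans E0 _; exact: ltW.
  - exact: ltW.
apply: real_cauchy_cvg => e e0.
have [eta eta0 Heta] := Wp_close M p0 (divr_gt0 e0 (ltr0n _ 2)).
have [r r0 Hr] := Lp_small_energy N3 S0 Ssob p2 ps eta0.
have [M1 HM1] := H10_energy hv r0.
exists (maxn n0 M1) => m n; rewrite !geq_max => /andP[_ a2] /andP[b1 b2].
apply: (@le_lt_trans _ _ (e / 2)); last by rewrite ltr_pdivrMr// ltr_pMr// ltr1n.
apply: Heta => //; [exact: H10_annulus|exact: H10_annulus|exact: bd|].
by apply: Hr; [apply: annulusB; exact: H10_annulus|exact: HM1].
Qed.

Lemma parallelogram f g : C1c_annulus f -> C1c_annulus g ->
  energy (fun x => f x - g x) + energy (fun x => f x + g x) = 2 * energy f + 2 * energy g.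
Proof.
move=> hf hg.
have cf := C1c_grad_sq (annulus_C1c hf); have cg := C1c_grad_sq (annulus_C1c hg).
have cd := C1c_grad_sq (annulus_C1c (annulusB hf hg)).
have cs := C1c_grad_sq (annulus_C1c (annulusD hf hg)).
rewrite /energy -(posfunZ HI _ cf) -(posfunZ HI _ cg) -(posfunD HI (CcZ _ cf) (CcZ _ cg)).
rewrite -(posfunD HI cd cs); congr integral_RN; apply/funext => x.
rewrite /grad_sq !mulr_sumr -!big_split /=; apply: eq_bigr => i _.
rewrite (pderivB i x (annulus_C1 hf) (annulus_C1 hg)).
rewrite (pderivD i x (annulus_C1 hf) (annulus_C1 hg)); ring.
Qed.

End Sequences.

(** * Local minima *)

Section Existence.
Context {R : realType} {N : nat}.
Hypothesis N3 : (3 <= N)%N.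
Variables (alpha S p d : R) (V : 'rV[R]_N -> R).
Hypotheses (alpha0 : 0 < alpha) (p2 : 2 < p) (wV : weight V).
Implicit Types (f g : 'rV[R]_N -> R) (u v : nat -> 'rV[R]_N -> R).
Notation s := (@crit_exp R N).
Notation Psi := (@Psi R N alpha).
Hypothesis ps : p < s.
Hypotheses (S0 : 0 < S)
  (Ssob : forall f, C1c f -> S * powR (Lp s f) (2 / s) <= energy f).
Hypothesis gap : forall f, C1c_annulus f -> Wp Psi p f = 1 ->
  1 / 4 <= Wp V p f -> Wp V p f <= 3 / 4 -> S + d <= energy f.
Hypothesis test : exists f, [/\ C1c_annulus f, Wp Psi p f = 1, energy f < S + d & Wp V p f = 0].

Let p0 : 0 < p. Proof. exact: lt_trans p2. Qed.
Let wP : weight Psi. Proof. exact: weight_Psi. Qed.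

(** The threshold 1/2 lies strictly inside the window excluded by [gap], so members of energy below
    S + d have V-mass below 1/4. *)
Definition admissible f := [/\ C1c_annulus f, Wp Psi p f = 1 & Wp V p f <= 1 / 2].

Let level := [set r | exists2 f, admissible f & r = energy f].
Let m := inf level.

Let level_inf : has_inf level.
Proof.
have [f [h1 h2 h3 h4]] := test; split.
  by exists (energy f); exists f => //; split=> //; rewrite h4 divr_ge0.
by exists 0 => r [g [hg _ _] ->]; apply: energy_ge0; exact: annulus_C1c.
Qed.

Let m_le f : admissible f -> m <= energy f.
Proof.
by move=> hf; apply: inf_lbound; [have [] := level_inf|exists f].
Qed.

Let m_ge0 : 0 <= m.
Proof.
apply: lb_le_inf; first by have [] := level_inf.
by move=> r [g [hg _ _] ->]; apply: energy_ge0; exact: annulus_C1c.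
Qed.

Let m_lt : m < S + d.
Proof.
have [f [h1 h2 h3 h4]] := test; apply: le_lt_trans h3; apply: m_le.
by split=> //; rewrite h4 divr_ge0.
Qed.

Let half_arith (a D : R) : 5 / 6 <= D -> a <= 5 / 12 -> D^-1 * a <= 1 / 2.
Proof.
move=> h1 h2; have D0 : 0 < D by lra.
by rewrite ler_pdivrMl//; lra.
Qed.

(** A function within 1/6 of one with masses 1 and at most 1/4 has masses at least 5/6 and at most
    5/12, whose ratio is 1/2; normalising it gives an admissible function. *)
Let near_admissible g : C1c_annulus g -> 5 / 6 <= Wp Psi p g -> Wp V p g <= 5 / 12 ->
  m * powR (Wp Psi p g) (2 / p) <= energy g.
Proof.
move=> hg h1 h2; set D := Wp Psi p g in h1 *.
have gc := C1c_Cc (annulus_C1c hg).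
have D0 : 0 < D by apply: lt_le_trans h1; exact: divr_gt0.
pose c := powR D (- p^-1); have c0 : 0 < c by exact: powR_gt0.
have cp : powR `|c| p = D^-1.
  rewrite gtr0_norm// /c -powRrM mulNr mulVf ?gt_eqF// powR_inv1//; exact: ltW.
have hc : admissible (fun x => c * g x).
  have [cP _] := wP; have [cV _] := wV; split; first exact: annulusZ.
    by rewrite (WpZ c p0 cP gc) cp mulVf// gt_eqF.
  by rewrite (WpZ c p0 cV gc) cp; exact: half_arith.
have := m_le hc; rewrite (energyZ c (annulus_C1c hg)).
have -> : c ^+ 2 = (powR D (2 / p))^-1.
  rewrite /c -powR_mulrn ?powR_ge0// -powRrM mulNr mulrC.
  by rewrite powRN.
by rewrite ler_pdivlMl ?powR_gt0// mulrC.
Qed.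

Let minimizing : exists f : nat -> 'rV[R]_N -> R, forall n,
  [/\ C1c_annulus (f n), Wp Psi p (f n) = 1, Wp V p (f n) <= 1 / 4, energy (f n) < S + d &
      energy (f n) < m + n.+1%:R^-1].
Proof.
suff H n : exists f, [/\ C1c_annulus f, Wp Psi p f = 1, Wp V p f <= 1 / 4, energy f < S + d &
    energy f < m + n.+1%:R^-1] by have [f Hf] := boolp.choice H; exists f.
pose e := Num.min (S + d - m) n.+1%:R^-1.
have e0 : 0 < e by rewrite lt_min subr_gt0 m_lt invr_gt0 ltr0n.
have [r [f [f1 f2 f3] ->] h] := inf_adherent e0 level_inf.
have k1 : energy f < S + d.
  apply: (lt_le_trans h); rewrite -lerBrDl; by rewrite ge_min lexx.
exists f; split=> //.
  rewrite leNgt; apply/negP => k2.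
  have : S + d <= energy f by apply: gap => //; [exact: ltW|apply: (le_trans f3); lra].
  by rewrite leNgt k1.
by apply: (lt_le_trans h); rewrite lerD2l ge_min lexx orbT.
Qed.

Let mid f g x : 1 / 2 * (f x + g x) - f x = 1 / 2 * (g x - f x) :> R.
Proof. by field. Qed.

Let energy_mid f g : C1c_annulus f -> C1c_annulus g ->
  energy (fun x => f x - g x) = 2 * energy f + 2 * energy g -
    4 * energy (fun x => 1 / 2 * (f x + g x)).
Proof.
move=> hf hg; rewrite (energyZ _ (annulus_C1c (annulusD hf hg))).
have := parallelogram hf hg.
by move: (energy _) (energy _) (energy f) (energy g) => a b c e; lra.
Qed.

Let lower_arith (D t : R) : 0 < t -> 5 / 6 <= D -> 1 - t <= D -> 1 - t <= powR D (2 / p).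
Proof.
move=> t0 D1 Dt; have D0 : 0 < D by lra.
have q0 : 0 < 2 / p by rewrite divr_gt0.
have q1 : 2 / p <= 1 by rewrite ler_pdivrMr// mul1r ltW.
have [h|h] := leP D 1.
  apply: (le_trans Dt); rewrite -[leLHS](powRr1 (ltW D0)).
  by apply: powR_le_exp => //; exact: ltW.
apply: (@le_trans _ _ 1); first by lra.
rewrite -[leLHS](_ : powR 1 (2 / p) = 1); last by rewrite powR1.
by apply: ge0_ler_powR; rewrite ?nnegrE; lra.
Qed.

Let close_bounds (a b e : R) : `|a - b| <= e -> a <= b + e /\ b - e <= a.
Proof. by rewrite ler_norml => /andP[h1 h2]; split; lra. Qed.

Let cauchy_arith (a b c e : R) : 0 < e -> a < m + e / 16 -> b < m + e / 16 ->
  m * (1 - e / (8 * (m + 1))) <= c -> 2 * a + 2 * b - 4 * c <= e.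
Proof.
move=> e0 h1 h2 h3; have m1 : 0 < m + 1 by rewrite ltr_wpDl.
have : m * (e / (8 * (m + 1))) <= e / 8.
  have -> : m * (e / (8 * (m + 1))) = m / (m + 1) * (e / 8) by field; rewrite gt_eqF.
  apply: ler_piMl; first by rewrite divr_ge0// ltW.
  by rewrite ler_pdivrMr// mul1r lerDl.
by move: h3; rewrite mulrBr mulr1; move: (m * (e / _)) => z; lra.
Qed.

(** Along the Rellich subsequence the midpoint of two members is L^p-close to both, hence nearly
    admissible, so its energy is almost m or more. The parallelogram identity then makes the energy
    of the difference small. *)
Let minimizing_cauchy : exists u, [/\ H10 u,
  forall n, [/\ C1c_annulus (u n), Wp Psi p (u n) = 1, Wp V p (u n) <= 1 / 4 & energy (u n) < S + d] &
  (fun n => energy (u n)) @ \oo --> m].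
Proof.
have [f Hf] := minimizing.
have fa n : C1c_annulus (f n) by have [] := Hf n.
pose M := 49 * (S + d).
have Sd0 : 0 < S + d by exact: le_lt_trans m_ge0 m_lt.
have fE n : energy (f n) <= S + d by have [_ _ _ /ltW] := Hf n.
have fM n : energy (f n) <= M.
  by apply: (le_trans (fE n)); rewrite /M ler_peMl ?(ltW Sd0)// ler1n.
have f2 n : integral_RN (fun x => f n x ^+ 2) <= M.
  by apply: (le_trans (L2_le_energy N3 (fa n))); rewrite ler_pM2l.
have [phi [phik Hphi]] := rellich (ltr0n R 3) (fun n => annulus_C1c (fa n))
  (fun n => annulus_norm (fa n)) fM f2.
pose u n := f (phi n).
have ua n : C1c_annulus (u n) := fa (phi n).
have uP n : Wp Psi p (u n) = 1 by have [] := Hf (phi n).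
have uV n : Wp V p (u n) <= 1 / 4 by have [] := Hf (phi n).
have uE n : energy (u n) < m + n.+1%:R^-1.
  have [_ _ _ _ h] := Hf (phi n); apply: (lt_le_trans h).
  by rewrite lerD2l lef_pV2 ?posrE ?ltr0n// ler_nat ltnS.
have um n : m <= energy (u n).
  by apply: m_le; split=> //; apply: (le_trans (uV n)); lra.
have inv_small e : 0 < e -> exists k0, forall k, (k0 <= k)%N -> energy (u k) < m + e.
  move=> e0; have [k0 _ H] := near_infty_natSinv_lt (PosNum e0).
  exists k0 => k kk; apply: (lt_trans (uE k)); rewrite ltrD2l; exact: H.
have LpC e : 0 < e -> exists k0, forall k l, (k0 <= k)%N -> (k0 <= l)%N ->
    Lp p (fun x => u k x - u l x) <= e.
  move=> e0; have [eta eta0 Heta] := Lp_small_L2 N3 S0 Ssob (4 * (S + d)) p2 ps e0.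
  have [k0 Hk0] := Hphi eta eta0; exists k0 => k l kk ll.
  apply: Heta; [exact: annulusB| |exact: Hk0].
  have := energy_young2 (ua k) (ua l); have := fE (phi k); have := fE (phi l).
  by rewrite /u; move: (energy (f (phi k))) (energy (f (phi l))) (energy _) => a b c; lra.
exists u; split.
- apply: H10P => // e e0.
  have m1 : 0 < m + 1 by rewrite ltr_wpDl.
  (* 1/6 keeps the midpoint within reach of [near_admissible]; the other bound costs at most e/8 in
     its energy, which the factor 4 turns into e/2. *)
  pose t := Num.min (1 / 6) (e / (8 * (m + 1))).
  have t0 : 0 < t by rewrite lt_min divr_gt0//= divr_gt0// mulr_gt0.
  have t6 : t <= 1 / 6 by rewrite ge_min lexx.
  have t8 : t <= e / (8 * (m + 1)) by rewrite ge_min lexx orbT.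
  have [eta eta0 Heta] := @Wp_close R N p 1 t p0 t0.
  have [k1 Hk1] := LpC eta eta0.
  have e16 : 0 < e / 16 by rewrite divr_gt0.
  have [k2 Hk2] := inv_small _ e16.
  exists (maxn k1 k2) => k l; rewrite !geq_max => /andP[a1 a2] /andP[b1 b2].
  pose g x := 1 / 2 * (u k x + u l x).
  have hg : C1c_annulus g by exact: annulusZ (annulusD (ua k) (ua l)).
  have Lg : Lp p (fun x => g x - u k x) <= eta.
    have -> : (fun x => g x - u k x) = (fun x => 1 / 2 * (u l x - u k x)).
      by apply/funext => x; exact: mid.
    have hd := annulusB (ua l) (ua k); have dc := C1c_Cc (annulus_C1c hd).
    rewrite (LpZ _ p0 dc); apply: le_trans (Hk1 l k b1 a1).
    apply: ler_piMl; first exact: Lp_ge0.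
    rewrite -[leRHS](_ : powR 1 p = 1); last by rewrite powR1.
    apply: ge0_ler_powR; rewrite ?nnegrE ?(ltW p0)//.
    by rewrite ger0_norm ?divr_ge0// ler_pdivrMr// mul1r ler1n.
  have P1 : Wp Psi p (u k) <= 1 by rewrite uP.
  have V1 : Wp V p (u k) <= 1 by apply: (le_trans (uV k)); lra.
  have [_ c1] := close_bounds (Heta _ _ _ wP hg (ua k) P1 Lg).
  have [c2 _] := close_bounds (Heta _ _ _ wV hg (ua k) V1 Lg).
  rewrite uP in c1.
  have D56 : 5 / 6 <= Wp Psi p g by apply: le_trans c1; move: t6; lra.
  have V512 : Wp V p g <= 5 / 12 by apply: (le_trans c2); move: (uV k) t6; lra.
  have low := near_admissible hg D56 V512.
  have low2 : m * (1 - e / (8 * (m + 1))) <= energy g.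
    apply: le_trans low; apply: ler_wpM2l => //.
    apply: (@le_trans _ _ (1 - t)); first by rewrite lerD2l lerN2.
    exact: lower_arith.
  rewrite (energy_mid (ua k) (ua l)).
  exact: cauchy_arith e0 (Hk2 k a2) (Hk2 l b2) low2.
- by move=> n; split=> //; have [] := Hf (phi n).
- apply/cvgrPdist_lt => e e0; have [k0 Hk0] := inv_small e e0.
  exists k0 => // n kn; rewrite distrC ger0_norm ?subr_ge0//.
  by rewrite ltrBlDl; exact: Hk0.
Qed.

(** [Rlim] is a [limn] as well. The mass stays above 5/6, so the quotient converges. *)
Let Rquot_cvg v : H10 v -> (exists n0, forall n, (n0 <= n)%N -> 5 / 6 <= Wp Psi p (v n)) ->
  cvgn (fun n => Rquot alpha p (v n)).
Proof.
move=> hv [n0 H0]; have cD := H10_Wp_cvg N3 S0 Ssob p2 ps wP hv.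
have q0 : 0 < 2 / p by rewrite divr_gt0.
have D1 : 5 / 6 <= limn (fun n => Wp Psi p (v n)) by apply: limr_ge => //; exists n0.
have cpow : (fun n => powR `|Wp Psi p (v n)| (2 / p)) @ \oo -->
    powR `|limn (fun n => Wp Psi p (v n))| (2 / p).
  have cc := @continuous_powR_norm R (2 / p) q0.
  exact: (@continuous_cvg _ _ _ _ _ _ (fun x : R => powR `|x| (2 / p)) _ (cc _) cD).
have -> : (fun n => Rquot alpha p (v n)) =
    (fun n => energy (v n) * (powR `|Wp Psi p (v n)| (2 / p))^-1).
  apply/funext => n; rewrite [`|Wp _ _ _|]ger0_norm//.
  by apply: Wp_ge0 => //; exact: H10_annulus.
apply: is_cvgM; first exact: H10_energy_cvg.
apply: is_cvgV; last by apply/cvg_ex; exists (powR `|limn (fun n => Wp Psi p (v n))| (2 / p)).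
rewrite (cvg_lim _ cpow)// gt_eqF// powR_gt0// normr_gt0 gt_eqF//.
by apply: lt_le_trans D1; rewrite divr_gt0.
Qed.

(** In a small H^1 ball the masses move by at most 1/6, so every competitor is eventually covered by
    [near_admissible] and its quotient is at least m, the value at u. *)
Lemma local_min_exists : exists2 u, local_min alpha p u & forall n,
  [/\ C1c_annulus (u n), Wp Psi p (u n) = 1, Wp V p (u n) <= 1 / 4 & energy (u n) < S + d].
Proof.
have [u [hu Hu cu]] := minimizing_cauchy; exists u => //.
have ua n := H10_annulus n hu.
have uP n : Wp Psi p (u n) = 1 by have [] := Hu n.
have uV n : Wp V p (u n) <= 1 / 4 by have [] := Hu n.
split=> //; split.
  have h12 : 0 < 1 / 2 :> R by rewrite divr_gt0.
  have [c c0 Hc] := Lp_small_energy N3 S0 Ssob p2 ps h12.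
  apply: (nonzero_lb hu c0) => n; rewrite leNgt; apply/negP => /ltW/(Hc _ (ua n)).
  by have := Wp_le_Lp p0 wP (ua n); rewrite uP; lra.
have t0 : 0 < 1 / 6 :> R by rewrite divr_gt0.
have [eta eta0 Heta] := @Wp_close R N p 1 (1 / 6) p0 t0.
have [r r0 Hr] := Lp_small_energy N3 S0 Ssob p2 ps eta0.
exists (Num.sqrt r); first by rewrite sqrtr_gt0.
move=> v hv _ huv; have [n0 Hn0] := h1dist_lt N3 hu hv huv.
have near n : (n0 <= n)%N -> 5 / 6 <= Wp Psi p (v n) /\ Wp V p (v n) <= 5 / 12.
  move=> nn; have va := H10_annulus n hv.
  have Ld : Lp p (fun x => v n x - u n x) <= eta.
    rewrite LpBC; apply: Hr; first exact: annulusB.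
    by have := Hn0 n nn; rewrite sqr_sqrtr// ltW.
  have P1 : Wp Psi p (u n) <= 1 by rewrite uP.
  have V1 : Wp V p (u n) <= 1 by apply: (le_trans (uV n)); lra.
  have [_ c1] := close_bounds (Heta _ _ _ wP va (ua n) P1 Ld).
  have [c2 _] := close_bounds (Heta _ _ _ wV va (ua n) V1 Ld).
  rewrite uP in c1; split; first by apply: le_trans c1; lra.
  by apply: (le_trans c2); move: (uV n); lra.
have Ru : Rlim alpha p u = m.
  rewrite /Rlim (_ : (fun n => Rquot alpha p (u n)) = (fun n => energy (u n))).
    exact: cvg_lim.
  apply/funext => n; rewrite /Rquot -/(Wp Psi p (u n)) uP.
  by rewrite (_ : powR 1 (2 / p) = 1) ?divr1//; rewrite powR1.
rewrite Ru; apply: limr_ge.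
  by apply: Rquot_cvg => //; exists n0 => n /near[].
exists n0 => // n nn; have [k1 k2] := near n nn.
have D0 : 0 < Wp Psi p (v n) by apply: lt_le_trans k1; rewrite divr_gt0.
have h := near_admissible (H10_annulus n hv) k1 k2.
rewrite -ler_pdivlMr ?powR_gt0// in h; exact: h.
Qed.

End Existence.

(** * Reflections and transpositions of coordinates *)

Section Symmetries.
Context {R : realType} {N : nat}.
Implicit Types (f g : 'rV[R]_N -> R).

Lemma Wp_rotate (A : 'M[R]_N) (W W' : 'rV[R]_N -> R) p f : orthogonal_mx A -> 0 < p ->
  continuous W -> Cc f -> (forall x, W' x = W (x *m A)) ->
  Wp W' p (fun x => f (x *m A)) = Wp W p f.
Proof.
move=> oA p0 cW fc h; rewrite /Wp -[RHS](integral_orthogonal oA (Cc_Wp p0 cW fc)).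
by congr integral_RN; apply/funext => x; rewrite h.
Qed.

Definition refl_mx (i : 'I_N) : 'M[R]_N := diag_mx (\row_j (if j == i then -1 else 1)).

Lemma refl_orthogonal i : orthogonal_mx (refl_mx i).
Proof.
rewrite /orthogonal_mx /refl_mx tr_diag_mx mul_diag_mx; apply/matrixP => j k.
rewrite !mxE; case: (j == k); last by rewrite !mulr0n mulr0.
by rewrite !mulr1n; case: (j == i); rewrite ?mulrNN mulr1.
Qed.

Lemma refl_coord i (x : 'rV[R]_N) : (x *m refl_mx i) ord0 i = - x ord0 i.
Proof.
by rewrite /refl_mx mul_mx_diag !mxE eqxx mulrN1.
Qed.

Lemma tperm_orthogonal (i j : 'I_N) : orthogonal_mx (tperm_mx i j : 'M[R]_N).
Proof. by rewrite /orthogonal_mx tr_tperm_mx -perm_mxM tperm2 perm_mx1. Qed.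

Lemma tperm_coord (i j : 'I_N) (x : 'rV[R]_N) : (x *m tperm_mx i j) ord0 i = x ord0 j.
Proof. by rewrite -xcolE mxE tpermL. Qed.

End Symmetries.

(** * Non-radiality and distinctness *)

Section Conclusion.
Context {R : realType} {N : nat}.
Hypothesis N3 : (3 <= N)%N.
Variables (alpha S p : R).
Hypotheses (alpha0 : 0 < alpha) (p2 : 2 < p).
Implicit Types (f g : 'rV[R]_N -> R) (u v : nat -> 'rV[R]_N -> R).
Notation s := (@crit_exp R N).
Notation Psi := (@Psi R N alpha).
Hypothesis ps : p < s.
Hypotheses (S0 : 0 < S)
  (Ssob : forall f, C1c f -> S * powR (Lp s f) (2 / s) <= energy f).

Let p0 : 0 < p. Proof. exact: lt_trans p2. Qed.

Let close_bounds (a b e : R) : `|a - b| <= e -> a <= b + e /\ b <= a + e.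
Proof. by rewrite ler_norml => /andP[h1 h2]; split; lra. Qed.

(** The index n0 is fixed before the weight, so one late index serves all weights under
    comparison. *)
Lemma h1dist_Wp u v (M e : R) : H10 u -> H10 v -> ~ 0 < h1dist u v -> 0 < e ->
  exists n0, forall n W, (n0 <= n)%N -> weight W -> Wp W p (u n) <= M ->
    Wp W p (v n) <= Wp W p (u n) + e /\ Wp W p (u n) <= Wp W p (v n) + e.
Proof.
move=> hu hv h e0; have [eta eta0 Heta] := @Wp_close R N p M e p0 e0.
have [r r0 Hr] := Lp_small_energy N3 S0 Ssob p2 ps eta0.
have [n0 Hn0] := h1dist_le0 N3 hu hv h r0.
exists n0 => n W nn wW uM; apply: close_bounds.
apply: Heta => //; [exact: H10_annulus|exact: H10_annulus|].
by rewrite LpBC; apply: Hr; [apply: annulusB; exact: H10_annulus|exact: Hn0].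
Qed.

Lemma Wp_le_Psi W f : weight W -> (forall x, W x <= Psi x) -> C1c_annulus f ->
  Wp W p f <= Wp Psi p f.
Proof.
move=> [cW _] h hf; have fc := C1c_Cc (annulus_C1c hf).
have [cP _] := @weight_Psi R N alpha alpha0.
apply: (posfun_le (@posfun_integral R N) (Cc_Wp p0 cW fc) (Cc_Wp p0 cP fc)) => x.
by apply: ler_wpM2r => //; exact: powR_ge0.
Qed.

Let Wcos_le i x : Wcos alpha p i x <= Psi x.
Proof.
apply: ler_piMr; first exact: powR_ge0.
rewrite -[leRHS](_ : powR 1 p = 1); last by rewrite powR1.
by apply: ge0_ler_powR; rewrite ?nnegrE ?(ltW p0)//; exact: cos_max.
Qed.

Let Wsin_le i x : Wsin alpha p i x <= Psi x.
Proof.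
apply: ler_piMr; first exact: powR_ge0.
rewrite -[leRHS](_ : powR 1 p = 1); last by rewrite powR1.
by apply: ge0_ler_powR; rewrite ?nnegrE ?(ltW p0)//; exact: sin_max.
Qed.

Let Psi_rotate (A : 'M[R]_N) x : orthogonal_mx A -> Psi (x *m A) = Psi x.
Proof. by move=> oA; rewrite /Defs.Psi eucl_mulmx. Qed.

(** If u were radial, its late members would have masses invariant up to e2 under the reflection of
    i0 and the transpositions with i0, and the symmetry gap would contradict their low energy. *)
Lemma nonradial_of_gap (i0 : 'I_N) (d e2 : R) u : 0 < e2 ->
  (forall f, C1c_annulus f -> Wp Psi p f = 1 ->
    Wp (Wcos alpha p i0) p f <= Wp (Wsin alpha p i0) p f + e2 ->
    Wp (Wsin alpha p i0) p f <= Wp (Wcos alpha p i0) p f + e2 ->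
    (forall i, Wp (Wcos alpha p i) p f <= Wp (Wcos alpha p i0) p f + e2) ->
    (forall i, Wp (Wsin alpha p i) p f <= Wp (Wsin alpha p i0) p f + e2) ->
    S + d <= energy f) ->
  H10 u -> (forall n, Wp Psi p (u n) = 1 /\ energy (u n) < S + d) -> nonradial u.
Proof.
move=> e20 gap hu Hu; apply: contrapT => nr.
have sym A : orthogonal_mx A -> exists n0, forall n W W', (n0 <= n)%N -> weight W -> weight W' ->
    (forall x, W' x <= Psi x) -> (forall x, W' x = W (x *m A)) ->
    Wp W' p (u n) <= Wp W p (u n) + e2 /\ Wp W p (u n) <= Wp W' p (u n) + e2.
  move=> oA.
  have hr : H10 (rotate A u).
    have := H10_rotate N3 1 oA hu.
    by rewrite (_ : (fun n x => 1 * rotate A u n x) = rotate A u)//; apply/funext => n; apply/funext => x; rewrite mul1r.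
  have nd : ~ 0 < h1dist (rotate A u) u by move=> h; apply: nr; exists A.
  have [n0 Hn0] := h1dist_Wp 1 hr hu nd e20.
  exists n0 => n W W' nn wW wW' WP WW.
  have ua := H10_annulus n hu; have [cW _] := wW.
  have e := Wp_rotate oA p0 cW (C1c_Cc (annulus_C1c ua)) WW.
  have e1 : Wp W' p (rotate A u n) <= 1.
    have [h1 _] := Hu n; have [cP _] := @weight_Psi R N alpha alpha0.
    apply: (le_trans (Wp_le_Psi wW' WP (H10_annulus n hr))).
    rewrite -[leRHS]h1 le_eqVlt; apply/orP; left; apply/eqP.
    by apply: (Wp_rotate oA p0 cP (C1c_Cc (annulus_C1c ua))) => x; rewrite Psi_rotate.
  have := Hn0 n W' nn wW' e1; rewrite -e; exact.
have wc (i : 'I_N) : weight (Wcos alpha p i) by exact: weight_Wcos.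
have ws (i : 'I_N) : weight (Wsin alpha p i) by exact: weight_Wsin.
have [n1 H1] := sym _ (refl_orthogonal i0).
have /boolp.choice[nt Ht] : forall i, exists n0, forall n W W', (n0 <= n)%N -> weight W -> weight W' ->
    (forall x, W' x <= Psi x) -> (forall x, W' x = W (x *m tperm_mx i i0)) ->
    Wp W' p (u n) <= Wp W p (u n) + e2 /\ Wp W p (u n) <= Wp W' p (u n) + e2.
  by move=> i; apply: sym; exact: tperm_orthogonal.
(* A single index at which all these approximate invariances hold; the gap is then applied to [u n]
   alone. *)
pose n := maxn n1 (\max_i nt i).
have nn1 : (n1 <= n)%N by rewrite leq_maxl.
have nni i : (nt i <= n)%N.
  by apply: leq_trans (leq_maxr _ _); exact: (leq_bigmax i).
have [D1 En] := Hu n.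
have := gap (u n) (H10_annulus n hu) D1.
have hrefl x : Wsin alpha p i0 x = Wcos alpha p i0 (x *m refl_mx i0).
  rewrite /Wsin /Wcos Psi_rotate ?refl_coord; last exact: refl_orthogonal.
  by rewrite mulrN hcutN cosB cos_pihalf sin_pihalf mul0r mul1r add0r.
have [a1 a2] := H1 n (Wcos alpha p i0) (Wsin alpha p i0) nn1 (wc i0) (ws i0) (Wsin_le i0) hrefl.
have hc i x : Wcos alpha p i0 x = Wcos alpha p i (x *m tperm_mx i i0).
  by rewrite /Wcos Psi_rotate ?tperm_coord//; exact: tperm_orthogonal.
have hs i x : Wsin alpha p i0 x = Wsin alpha p i (x *m tperm_mx i i0).
  by rewrite /Wsin Psi_rotate ?tperm_coord//; exact: tperm_orthogonal.
have b i : Wp (Wcos alpha p i) p (u n) <= Wp (Wcos alpha p i0) p (u n) + e2.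
  by have [] := Ht i n (Wcos alpha p i) (Wcos alpha p i0) (nni i) (wc i) (wc i0) (Wcos_le i0) (hc i).
have c i : Wp (Wsin alpha p i) p (u n) <= Wp (Wsin alpha p i0) p (u n) + e2.
  by have [] := Ht i n (Wsin alpha p i) (Wsin alpha p i0) (nni i) (ws i) (ws i0) (Wsin_le i0) (hs i).
by move=> /(_ a2 a1 b c); rewrite leNgt En.
Qed.

(** Here a, b are the inner and outer mass of u, a', b' those of v, and k = |c|^p. The inner masses
    force k <= 1/2, and then b' <= 1/4, although b' >= 3/4. *)
Let ratio_arith (k a b a' b' : R) : 0 <= k -> a + b = 1 -> a' + b' = 1 -> b <= 1 / 4 ->
  a' <= 1 / 4 -> k * a <= a' + 1 / 8 -> b' <= k * b + 1 / 8 -> False.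
Proof. by nra. Qed.

Lemma distinct_of_masses u v : H10 u -> H10 v ->
  (forall n, Wp Psi p (u n) = 1 /\ Wp (Wout alpha) p (u n) <= 1 / 4) ->
  (forall n, Wp Psi p (v n) = 1 /\ Wp (Win alpha) p (v n) <= 1 / 4) ->
  essentially_distinct u v.
Proof.
move=> hu hv Hu Hv c A oA; apply: contrapT => nd.
have hr := H10_rotate N3 c oA hu.
have e0 : 0 < 1 / 8 :> R by rewrite divr_gt0.
have [n0 Hn0] := h1dist_Wp 1 hv hr nd e0.
have wi := @weight_Win R N alpha alpha0; have wo := @weight_Wout R N alpha alpha0.
have [ci _] := wi; have [co _] := wo.
have ua := H10_annulus n0 hu; have va := H10_annulus n0 hv.
have uc := C1c_Cc (annulus_C1c ua); have vc := C1c_Cc (annulus_C1c va).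
have [u1 u2] := Hu n0; have [v1 v2] := Hv n0.
rewrite (Wp_Psi alpha0 p0 uc) in u1; rewrite (Wp_Psi alpha0 p0 vc) in v1.
have vi := Wp_ge0 p0 wi va; have vo := Wp_ge0 p0 wo va.
have rot (W : 'rV[R]_N -> R) : continuous W -> (forall x, W x = W (x *m A)) ->
    Wp W p (fun x => c * rotate A u n0 x) = powR `|c| p * Wp W p (u n0).
  move=> cW hW; rewrite WpZ//; last by apply: C1c_Cc (annulus_C1c _); exact: annulus_mulmx.
  by congr (_ * _); exact: Wp_rotate.
have bi : Wp (Win alpha) p (v n0) <= 1 by rewrite -v1 lerDl.
have bo : Wp (Wout alpha) p (v n0) <= 1 by rewrite -v1 lerDr.
have [a1 _] := Hn0 n0 _ (leqnn _) wi bi; have [_ a2] := Hn0 n0 _ (leqnn _) wo bo.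
rewrite rot// in a1; last by move=> x; rewrite /Win eucl_mulmx.
rewrite rot// in a2; last by move=> x; rewrite /Wout eucl_mulmx.
exact: ratio_arith (powR_ge0 _ _) u1 v1 u2 v2 a1 a2.
Qed.

End Conclusion.

Theorem theorem3p1 (R : realType) (N : nat) (alpha : R) :
  (3 <= N)%N -> 0 < alpha ->
  exists2 p0 : R, p0 < crit_exp N &
    forall p : R, 2 < p -> p0 < p -> p < crit_exp N ->
      exists u v : nat -> 'rV[R]_N -> R,
        [/\ local_min alpha p u, local_min alpha p v,
            nonradial u, nonradial v & essentially_distinct u v].
Proof.
move=> N3 alpha0; have N0 : (0 < N)%N by exact: leq_trans N3.
have [S [S0 Ssob Sopt]] := @best_constant R N N3.
have [d1 [p1 [d10 _ p1s gap1]]] := balance_gap N3 alpha0 S0 Ssob.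
have [d2 [p2 [e2 [d20 _ p2s e20 gap2]]]] := symmetry_gap N3 alpha0 S0 Ssob (Ordinal N0).
pose d := Num.min d1 d2.
have d0 : 0 < d by rewrite lt_min d10.
have dd1 : d <= d1 by rewrite ge_min lexx.
have dd2 : d <= d2 by rewrite ge_min lexx orbT.
have [p3 [_ p3s tin]] := test_in N3 alpha0 S0 Sopt d0.
have [p4 [_ p4s tout]] := test_out N3 alpha0 S0 Sopt d0.
exists (Num.max (Num.max p1 p2) (Num.max p3 p4)); first by rewrite !gt_max p1s p2s p3s p4s.
move=> p pgt2; rewrite !gt_max => /andP[/andP[pp1 pp2] /andP[pp3 pp4]] ps.
have p0 : 0 < p by exact: lt_trans pgt2.
have gout (f : 'rV[R]_N -> R) : C1c_annulus f -> Wp (Psi alpha) p f = 1 ->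
    1 / 4 <= Wp (Wout alpha) p f -> Wp (Wout alpha) p f <= 3 / 4 -> S + d <= energy f.
  move=> hf h1 h2 h3; apply: le_trans (gap1 p f pp1 ps hf h1 h2 h3).
  by rewrite lerD2l.
(* The inner and outer masses add to 1 and the window from 1/4 to 3/4 is symmetric, so one gap
   serves both sides. *)
have gin (f : 'rV[R]_N -> R) : C1c_annulus f -> Wp (Psi alpha) p f = 1 ->
    1 / 4 <= Wp (Win alpha) p f -> Wp (Win alpha) p f <= 3 / 4 -> S + d <= energy f.
  move=> hf h1 h2 h3; have := Wp_Psi alpha0 p0 (C1c_Cc (annulus_C1c hf)); rewrite h1 => h4.
  by apply: gout => //; move: h2 h3 h4; move: (Wp _ _ _) (Wp _ _ _) => a b; lra.
have wi := @weight_Win R N alpha alpha0; have wo := @weight_Wout R N alpha alpha0.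
have [u lu Hu] := local_min_exists N3 alpha0 pgt2 wo ps S0 Ssob gout (tin p pp3 ps).
have [v lv Hv] := local_min_exists N3 alpha0 pgt2 wi ps S0 Ssob gin (tout p pp4 ps).
have [hu _] := lu; have [hv _] := lv.
exists u, v; split=> //.
- apply: (nonradial_of_gap N3 alpha0 pgt2 ps S0 Ssob e20 (fun f => gap2 p f pp2 ps) hu).
  by move=> n; have [_ h1 _ h2] := Hu n; split=> //; apply: (lt_le_trans h2); rewrite lerD2l.
- apply: (nonradial_of_gap N3 alpha0 pgt2 ps S0 Ssob e20 (fun f => gap2 p f pp2 ps) hv).
  by move=> n; have [_ h1 _ h2] := Hv n; split=> //; apply: (lt_le_trans h2); rewrite lerD2l.
- apply: (distinct_of_masses N3 alpha0 pgt2 ps S0 Ssob hu hv).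
    by move=> n; have [_ h1 h2 _] := Hu n.
  by move=> n; have [_ h1 h2 _] := Hv n.
Qed.
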